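(* Let $V$ be a braided vector space over $\mathbb{C}$, and let $N\ge 2$ and $I\ge 0$ be integers. Suppose that $H_i(B_n,V^{\otimes n})$ vanishes in the $(N,I)$ staircase, i.e. $H_i(B_n,V^{\otimes n})=0$ for all $(n,i)$ with $n\le N$ and $i\le I+n-N$. Then $H_i(B_n,V^{\otimes n})$ vanishes with slope $\frac{I+1}{N+1}$. More precisely, $H_i(B_n,V^{\otimes n})=0$ for all $(n,i)$ satisfying $$i\le (I+1)\left\lfloor \frac{n+1}{N+1}\right\rfloor+\max\left(I+\left\{\frac{n+1}{N+1}\right\}-N,\ 0\right)-1,$$ where $\left\{\frac{a}{b}\right\}$ denotes the remainder when the integer $a$ is divided by the integer $b$.
   Context: A braided vector space $(V,R)$ over $\mathbb{C}$ is a finite-dimensional $\mathbb{C}$-vector space $V$ with a linear isomorphism $R\colon V\otimes V\to V\otimes V$ satisfying the Yang–Baxter equation $(R\otimes \mathrm{id})(\mathrm{id}\otimes R)(R\otimes \mathrm{id})=(\mathrm{id}\otimes R)(R\otimes \mathrm{id})(\mathrm{id}\otimes R)$. $B_n$ is the Artin braid group on $n$ strands with standard generators $\sigma_1,\dots,\sigma_{n-1}$; it acts on $V^{\otimes n}$ with $\sigma_j$ acting by $R$ on the $j$-th and $(j+1)$-th tensor factors. $H_i(B_n,V^{\otimes n})$ is group homology; throughout $n\ge 1$ and $i\ge 0$ are integers. One says that $H_i(B_n,V^{\otimes n})$ vanishes with slope $s$ if there is a constant $t$ such that $H_i(B_n,V^{\otimes n})=0$ for all $(n,i)$ with $i\le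 sn+t$. *)

(* Defs.v *)
From HB Require Import structures.
From mathcomp Require Import all_boot all_order all_algebra.
From mathcomp Require Import finmap boolp.
From mathcomp Require Import reals complex.
From mathcomp.multinomials Require Import monalg.

Set Implicit Arguments.
Unset Strict Implicit.
Unset Printing Implicit Defensive.

Import Order.TTheory GRing.Theory Num.Theory.
Local Open Scope quotient_scope.
Local Open Scope ring_scope.

(* V^{(x) n} in coordinates: a tensor is the family of its coefficients on the
   basis (b_{t 0} (x) ... (x) b_{t n.-1})_t, where b := vbasis fullv is the
   canonical basis of V.  Lemmas [tens_multilinear] and [tens_universal] show
   that [tpow V n], with [tens], is the n-th tensor power of V. *)
Definition tpow (F : fieldType) (V : vectType F) (n : nat) :=
  {ffun {ffun 'I_n -> 'I_(\dim {:V})} -> F^o}.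

Section Tensors.
Context {F : fieldType} {V : vectType F}.

Definition tens n (v : {ffun 'I_n -> V}) : tpow V n :=
  [ffun t : {ffun 'I_n -> 'I_(\dim {:V})} =>
     \prod_i coord (vbasis {:V}) (t i) (v i)].

Definition upd n (v : {ffun 'I_n -> V}) (i : 'I_n) (x : V) :
  {ffun 'I_n -> V} := [ffun k => if k == i then x else v k].

Definition multilinear n (W : lmodType F) (phi : {ffun 'I_n -> V} -> W) :=
  forall v i, linear (fun x => phi (upd v i x)).

Lemma tens_multilinear n : multilinear (@tens n).
Proof.
move=> v i a x y; apply/ffunP => t; rewrite !ffunE.
rewrite (bigD1 i) //= [in X in _ = _ *: X + _](bigD1 i) //=.
rewrite [in X in _ = _ + X](bigD1 i) //=.
rewrite !ffunE eqxx linearP /= mulrDl -mulrA; congr (a * (_ * _) + _ * _);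
  by apply: eq_bigr => k /negPf nki; rewrite !ffunE nki.
Qed.

Definition btup n (t : {ffun 'I_n -> 'I_(\dim {:V})}) : {ffun 'I_n -> V} :=
  [ffun i => (vbasis {:V})`_(t i)].

Lemma multilinear_basis n (W : lmodType F) (phi psi : {ffun 'I_n -> V} -> W) :
  multilinear phi -> multilinear psi ->
  (forall t, phi (btup t) = psi (btup t)) -> phi =1 psi.
Proof.
move=> Mphi Mpsi E.
suff H k : (k <= n)%N -> forall v : {ffun 'I_n -> V},
    (forall i : 'I_n, (k <= i)%N ->
      exists j : 'I_(\dim {:V}), v i = (vbasis {:V})`_j) ->
    phi v = psi v.
  by move=> v; apply: (H n) => // i; rewrite leqNgt ltn_ord.
elim: k => [_ v Hv|k IHk ltkn v Hv].
  have /choice [j Hj] : forall i, exists j : 'I_(\dim {:V}),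
    v i = (vbasis {:V})`_j by move=> i; apply: Hv.
  have -> : v = btup [ffun i => j i] by apply/ffunP => i; rewrite !ffunE.
  exact: E.
pose i0 := Ordinal ltkn.
have exp (chi : {ffun 'I_n -> V} -> W) : multilinear chi ->
   chi v = \sum_j coord (vbasis {:V}) j (v i0) *: chi (upd v i0 (vbasis {:V})`_j).
  move=> Mchi; pose L := GRing.isLinear.Build F V W *:%R _ (Mchi v i0).
  pose f : {linear V -> W} := HB.pack (fun x => chi (upd v i0 x)) L.
  transitivity (f (v i0)).
    by congr chi; apply/ffunP => i; rewrite ffunE; case: eqP => // ->.
  rewrite {1}(coord_vbasis (memvf (v i0))) linear_sum.
  by apply: eq_bigr => j _; rewrite linearZ.
rewrite (exp _ Mphi) (exp _ Mpsi); apply: eq_bigr => j _; congr (_ *: _).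
apply: IHk => [|i leki]; first exact: ltnW.
rewrite ffunE; case: eqP => [_|/eqP ne]; first by exists j.
by apply: Hv; rewrite ltn_neqAle leki andbT; apply: contra ne => /eqP kE; apply/eqP/val_inj.
Qed.

Lemma tens_btup n (t u : {ffun 'I_n -> 'I_(\dim {:V})}) :
  tens (btup t) u = (u == t)%:R.
Proof.
rewrite ffunE; case: eqP => [->|/eqP ne].
  rewrite big1 // => i _; rewrite ffunE coord_free ?eqxx //.
  exact: (basis_free (vbasisP _)).
have /existsP[i ni] : [exists i, u i != t i].
  apply: contraNT ne => /existsPn H; apply/eqP/ffunP => i.
  by have := H i; rewrite negbK => /eqP.
rewrite (bigD1 i) //= ffunE coord_free ?(basis_free (vbasisP _)) //.
by rewrite eq_sym (negPf ni) mul0r.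
Qed.

Lemma tpow_expand n (f : tpow V n) : f = \sum_t f t *: tens (btup t).
Proof.
apply/ffunP => u; rewrite sum_ffunE (bigD1 u) //= ffunE tens_btup eqxx.
rewrite big1 ?addr0 => [|t ne]; first by rewrite /GRing.scale /= mulr1.
by rewrite ffunE tens_btup eq_sym (negPf ne) scaler0.
Qed.

Lemma tens_universal n (W : vectType F) (phi : {ffun 'I_n -> V} -> W) :
  multilinear phi ->
  exists! g : 'Hom(tpow V n, W), forall v, g (tens v) = phi v.
Proof.
move=> Mphi.
pose g0 (f : tpow V n) : W := \sum_t f t *: phi (btup t).
have g0L : linear g0.
  move=> a x y; rewrite /g0 scaler_sumr -big_split /=; apply: eq_bigr => t _.
  by rewrite !ffunE scalerDl scalerA.
pose gl : {linear tpow V n -> W} := HB.pack g0 (GRing.isLinear.Build F _ W *:%R _ g0L).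
exists (linfun gl); split=> [|h hE].
  apply: (@multilinear_basis n W (fun v => linfun gl (tens v))) => // [v i a x y|t].
    by rewrite (tens_multilinear v i) linearP.
  rewrite lfunE /= /g0 (bigD1 t) //= tens_btup eqxx scale1r big1 ?addr0 // => u.
  by rewrite tens_btup => /negPf ->; rewrite scale0r.
apply/lfunP => f; rewrite lfunE /= {1}[in RHS](tpow_expand f) linear_sum /g0.
by apply: eq_bigr => t _; rewrite -hE; exact: (esym (linearZ _ _)).
Qed.

(* Replaces the factors e 0, ..., e m.-1 of the multi-index t by those of p. *)
Definition put m n (e : 'I_m -> 'I_n) (t : {ffun 'I_n -> 'I_(\dim {:V})})
    (p : {ffun 'I_m -> 'I_(\dim {:V})}) : {ffun 'I_n -> 'I_(\dim {:V})} :=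
  [ffun k => if [pick l | e l == k] is Some l then p l else t k].

Definition factor_fun m n (e : 'I_m -> 'I_n) (A : 'End(tpow V m))
    (f : tpow V n) : tpow V n :=
  [ffun t : {ffun 'I_n -> 'I_(\dim {:V})} =>
     A [ffun p => f (put e t p)] [ffun l => t (e l)]].

Lemma factor_fun_linear m n (e : 'I_m -> 'I_n) A : linear (factor_fun e A).
Proof.
move=> a f g; apply/ffunP => t; rewrite !ffunE.
have -> : [ffun p => (a *: f + g) (put e t p)] =
  a *: ([ffun p => f (put e t p)] : tpow V m) + [ffun p => g (put e t p)].
  by apply/ffunP => p; rewrite !ffunE.
by rewrite linearP !ffunE.
Qed.

HB.instance Definition _ m n (e : 'I_m -> 'I_n) A :=
  GRing.isLinear.Build F (tpow V n) (tpow V n) *:%R (factor_fun e A)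
    (factor_fun_linear e A).

(* A acting on the factors e 0, ..., e m.-1 (with e injective), and the
   identity acting on the others. *)
Definition factor_op m n (e : 'I_m -> 'I_n) (A : 'End(tpow V m)) :
  'End(tpow V n) := linfun (factor_fun e A).

End Tensors.

Definition window (m n j : nat) (h : (j + m <= n)%N) (k : 'I_m) : 'I_n :=
  Ordinal (leq_trans (etrans (ltn_add2l j k m) (ltn_ord k)) h).

Lemma pair_subproof n (j : 'I_n.-1) : (j + 2 <= n)%N.
Proof. by rewrite addn2 -ltn_predRL. Qed.

(* id^{(x) j} (x) A (x) id^{(x) n-j-2}, for 0 <= j < n - 1. *)
Definition adjacent_op (F : fieldType) (V : vectType F) (A : 'End(tpow V 2))
    n (j : 'I_n.-1) : 'End(tpow V n) :=
  factor_op (window (pair_subproof j)) A.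

Record braided_vspace (F : fieldType) := BraidedVSpace {
  bvs_space :> vectType F;
  braiding : 'End(tpow bvs_space 2);
  braiding_iso : bijective braiding;
  yang_baxter :
    let R1 := adjacent_op (n := 3) braiding ord0 in
    let R2 := adjacent_op (n := 3) braiding ord_max in
    (R1 \o (R2 \o R1) = R2 \o (R1 \o R2))%VF
}.

Section FactorTheory.
Context {F : fieldType} {V : vectType F}.

Lemma factor_opE m n (e : 'I_m -> 'I_n) (A : 'End(tpow V m)) f t :
  factor_op e A f t = A [ffun p => f (put e t p)] [ffun l => t (e l)].
Proof. by rewrite lfunE /= ffunE. Qed.

Lemma put_put m n (e : 'I_m -> 'I_n) (t : {ffun 'I_n -> 'I_(\dim {:V})}) p q :
  put e (put e t p) q = put e t q.
Proof. by apply/ffunP => k; rewrite !ffunE; case: pickP. Qed.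

Lemma put_in m n (e : 'I_m -> 'I_n) (t : {ffun 'I_n -> 'I_(\dim {:V})}) p l :
  injective e -> put e t p (e l) = p l.
Proof.
move=> ei; rewrite ffunE; case: pickP => [l' /eqP/ei -> //|/(_ l)].
by rewrite eqxx.
Qed.

Lemma factor_op_comp m n (e : 'I_m -> 'I_n) (A B : 'End(tpow V m)) :
  injective e -> (factor_op e (A \o B) = factor_op e A \o factor_op e B)%VF.
Proof.
move=> ei; apply/lfunP => f; apply/ffunP => t.
rewrite comp_lfunE !factor_opE comp_lfunE; congr (A _ _).
apply/ffunP => p; rewrite [RHS]ffunE factor_opE.
rewrite (_ : [ffun l => _] = p); last by apply/ffunP => l; rewrite ffunE put_in.
by congr (B _ _); apply/ffunP => q; rewrite !ffunE put_put.
Qed.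

Lemma factor_op1 m n (e : 'I_m -> 'I_n) :
  (factor_op e \1 = \1 :> 'End(tpow V n))%VF.
Proof.
apply/lfunP => f; apply/ffunP => t; rewrite factor_opE !id_lfunE ffunE.
congr (f _); apply/ffunP => k; rewrite ffunE; case: pickP => // l /eqP <-.
by rewrite ffunE.
Qed.

Lemma put_comp l m n (e : 'I_m -> 'I_n) (d : 'I_l -> 'I_m)
   (t : {ffun 'I_n -> 'I_(\dim {:V})}) p :
  injective e -> injective d ->
  put (e \o d) t p = put e t (put d [ffun k => t (e k)] p).
Proof.
move=> ei di; apply/ffunP => k; rewrite !ffunE.
case: pickP => [i /eqP <-|H]; case: pickP => [j /eqP|H'].
- move/ei ->; rewrite ffunE; case: pickP => [i' /eqP/di -> //|/(_ i)].
  by rewrite eqxx.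
- by have := H' (d i); rewrite /= eqxx.
- move=> jk; rewrite ffunE; case: pickP => [i /eqP di'|_].
    by have := H i; rewrite /= di' jk eqxx.
  by rewrite ffunE jk.
- by [].
Qed.

Lemma factor_op_trans l m n (e : 'I_m -> 'I_n) (d : 'I_l -> 'I_m)
    (A : 'End(tpow V l)) :
  injective e -> injective d ->
  factor_op e (factor_op d A) = factor_op (e \o d) A.
Proof.
move=> ei di; apply/lfunP => f; apply/ffunP => t; rewrite !factor_opE.
congr (A _ _); first by apply/ffunP => p; rewrite !ffunE put_comp.
by apply/ffunP => i; rewrite !ffunE.
Qed.

Lemma lfun_tpowE m (A : 'End(tpow V m)) (f : tpow V m) u :
  A f u = \sum_p A (tens (btup p)) u * f p.
Proof.
rewrite {1}(tpow_expand f) linear_sum sum_ffunE; apply: eq_bigr => p _.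
by rewrite linearZ ffunE /GRing.scale /= mulrC.
Qed.

Lemma factor_op_disjoint l m n (e : 'I_l -> 'I_n) (d : 'I_m -> 'I_n)
    (A : 'End(tpow V l)) (B : 'End(tpow V m)) :
  (forall i j, e i != d j) ->
  (factor_op e A \o factor_op d B = factor_op d B \o factor_op e A)%VF.
Proof.
move=> dis; apply/lfunP => f; apply/ffunP => t; rewrite !comp_lfunE !factor_opE.
have out1 p : [ffun k => put e t p (d k)] = [ffun k => t (d k)].
  apply/ffunP => k; rewrite !ffunE; case: pickP => // i /eqP E.
  by have := dis i k; rewrite E eqxx.
have out2 q : [ffun k => put d t q (e k)] = [ffun k => t (e k)].
  apply/ffunP => k; rewrite !ffunE; case: pickP => // i /eqP E.
  by have := dis k i; rewrite E eqxx.
rewrite lfun_tpowE [RHS]lfun_tpowE.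
under eq_bigr => p _ do rewrite ffunE factor_opE out1 [B _ _]lfun_tpowE mulr_sumr.
under [RHS]eq_bigr => p _ do rewrite ffunE factor_opE out2 [A _ _]lfun_tpowE mulr_sumr.
rewrite exchange_big /=; apply: eq_bigr => q _; apply: eq_bigr => p _.
rewrite !ffunE mulrCA; congr (_ * (_ * f _)); apply/ffunP => k; rewrite !ffunE.
case: pickP => [j /eqP E|//]; case: pickP => // i /eqP E'.
by have := dis i j; rewrite E E' eqxx.
Qed.

End FactorTheory.

(* Words in the letters (false, j) = sigma_j and (true, j) = sigma_j^-1, with
   the generators sigma_0, ..., sigma_(n-2) indexed from 0. *)
Definition braid_word (n : nat) := seq (bool * 'I_n.-1).

Inductive braid_cong (n : nat) : braid_word n -> braid_word n -> Prop :=
| bc_refl w : braid_cong w w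
| bc_sym w w' : braid_cong w w' -> braid_cong w' w
| bc_trans w1 w2 w3 : braid_cong w1 w2 -> braid_cong w2 w3 -> braid_cong w1 w3
| bc_cat u u' w w' : braid_cong u u' -> braid_cong w w' ->
    braid_cong (u ++ w) (u' ++ w')
| bc_inv b j : braid_cong [:: (b, j); (~~ b, j)] [::]
| bc_far (i j : 'I_n.-1) : (i.+1 < j)%N ->
    braid_cong [:: (false, i); (false, j)] [:: (false, j); (false, i)]
| bc_near (i j : 'I_n.-1) : i.+1 = j :> nat ->
    braid_cong [:: (false, i); (false, j); (false, i)]
               [:: (false, j); (false, i); (false, j)].

Section BraidGroup.
Variable n : nat.

Definition braid_congb (w w' : braid_word n) : bool := `[< braid_cong w w' >].

Lemma braid_congb_equiv : equiv_class_of braid_congb.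
Proof.
split=> [w|w w'|w2 w1 w3]; first exact/asboolP/bc_refl.
  by apply/idP/idP => /asboolP H; apply/asboolP/bc_sym.
by move=> /asboolP H /asboolP H'; apply/asboolP; apply: bc_trans H H'.
Qed.

Canonical braid_congb_equiv_rel := EquivRelPack braid_congb_equiv.
Canonical braid_congb_encModRel := defaultEncModRel braid_congb.

Definition braid_group := {eq_quot braid_congb}.

HB.instance Definition _ : EqQuotient _ braid_congb braid_group :=
  EqQuotient.on braid_group.
HB.instance Definition _ := Choice.on braid_group.

Definition braid_of_word (w : braid_word n) : braid_group :=
  (\pi_braid_group w)%qT.

Lemma braid_of_wordP w w' :
  braid_of_word w = braid_of_word w' <-> braid_cong w w'.
Proof. by split=> [/eqquotP/asboolP|H]; last exact/eqquotP/asboolP. Qed.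

Definition inv_word (w : braid_word n) : braid_word n :=
  rev [seq (~~ x.1, x.2) | x <- w].

Definition braid_one : braid_group := braid_of_word [::].
Definition braid_mul (x y : braid_group) : braid_group :=
  braid_of_word (repr x ++ repr y).
Definition braid_inv (x : braid_group) : braid_group :=
  braid_of_word (inv_word (repr x)).

Lemma braid_ofK (x : braid_group) : braid_of_word (repr x) = x.
Proof. exact: reprK. Qed.

Lemma repr_braid_of w : braid_cong (repr (braid_of_word w)) w.
Proof. by apply/braid_of_wordP; rewrite braid_ofK. Qed.

Lemma braid_of_cat w w' :
  braid_of_word (w ++ w') = braid_mul (braid_of_word w) (braid_of_word w').
Proof. by apply/braid_of_wordP/bc_sym/bc_cat; apply: repr_braid_of. Qed.

Lemma inv_wordK : involutive inv_word.
Proof.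
move=> w; rewrite /inv_word map_rev revK -map_comp map_id_in // => -[b j] _ /=.
by rewrite negbK.
Qed.

Lemma cat_inv_word w : braid_cong (w ++ inv_word w) [::].
Proof.
elim: w => [|[b j] w IH] /=; first exact: bc_refl.
rewrite /inv_word /= rev_cons -cats1 -cat1s !catA.
apply: bc_trans (bc_inv b j); rewrite -[[:: _; _]]/([:: (b, j)] ++ [:: (~~ b, j)]).
apply: bc_cat (bc_refl _); rewrite -[X in braid_cong _ X]cats0 -catA.
exact: bc_cat (bc_refl _) IH.
Qed.

Lemma braid_mulA : associative braid_mul.
Proof.
move=> x y z; rewrite -[x]braid_ofK -[y]braid_ofK -[z]braid_ofK.
by rewrite -!braid_of_cat catA.
Qed.

Lemma braid_mul1 : left_id braid_one braid_mul.
Proof. by move=> x; rewrite -[x]braid_ofK -braid_of_cat. Qed.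

Lemma braid_mulr1 : right_id braid_one braid_mul.
Proof. by move=> x; rewrite -[x]braid_ofK -braid_of_cat cats0. Qed.

Lemma braid_mulV : right_inverse braid_one braid_inv braid_mul.
Proof.
move=> x; rewrite -{1}[x]braid_ofK -braid_of_cat.
exact/braid_of_wordP/cat_inv_word.
Qed.

Lemma braid_mulVl : left_inverse braid_one braid_inv braid_mul.
Proof.
move=> x; rewrite -{2}[x]braid_ofK -braid_of_cat; apply/braid_of_wordP.
by rewrite -{2}[repr x]inv_wordK; apply: cat_inv_word.
Qed.

HB.instance Definition _ := isGroup.Build braid_group
  braid_mulA braid_mul1 braid_mulr1 braid_mulVl braid_mulV.

End BraidGroup.

(* Left modules over the integral group ring Z[G]. *)
Record gmodule (G : groupType) := GModule {
  gmod_space :> zmodType;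
  gact : G -> gmod_space -> gmod_space;
  gactB : forall g, zmod_morphism (gact g);
  gact1 : forall x, gact 1%g x = x;
  gactM : forall g h x, gact (g * h)%g x = gact g (gact h x)
}.

(* The inhomogeneous bar complex: the group of i-chains is
   Z[G^i] (x) M, and the differential maps [g_1 | ... | g_i+1] (x) m to
     [g_2 | ... | g_i+1] (x) m
     + \sum_(1 <= j <= i) (-1)^j [g_1 | ... | g_j g_j+1 | ... | g_i+1] (x) m
     + (-1)^(i+1) [g_1 | ... | g_i] (x) g_i+1 m. *)
Section GroupHomology.
Context {G : groupType} (M : gmodule G).

HB.instance Definition _ g :=
  GRing.isZmodMorphism.Build M M (@gact G M g) (gactB g).

Definition bar_chain (i : nat) := {malg M[i.-tuple G]}.

Definition bar_face i (j : 'I_i.+2) (t : i.+1.-tuple G) : i.-tuple G :=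
  [tuple if (k.+1 < j)%N then tnth t (widen_ord (leqnSn i) k)
         else if k.+1 == j :> nat
         then (tnth t (widen_ord (leqnSn i) k) * tnth t (lift ord0 k))%g
         else tnth t (lift ord0 k) | k < i].

Definition bar_coef i (j : 'I_i.+2) (t : i.+1.-tuple G) (m : M) : M :=
  if j == ord_max then gact (tnth t ord_max) m else m.

Definition bar_diff i (c : bar_chain i.+1) : bar_chain i :=
  \sum_(t <- msupp c) \sum_(j < i.+2)
    << bar_coef j t c@_t *g bar_face j t >> *~ (-1) ^+ j.

Lemma bar_coef_is_zmod_morphism i (j : 'I_i.+2) t :
  zmod_morphism (bar_coef j t).
Proof. by move=> x y; rewrite /bar_coef; case: eqP => // _; rewrite raddfB. Qed.

HB.instance Definition _ i (j : 'I_i.+2) t :=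
  GRing.isZmodMorphism.Build M M (bar_coef j t)
    (bar_coef_is_zmod_morphism j t).

Lemma bar_diffEw i (c : bar_chain i.+1) (d : {fset i.+1.-tuple G}) :
  (msupp c `<=` d)%fset ->
  bar_diff c = \sum_(t <- d) \sum_(j < i.+2)
    << bar_coef j t c@_t *g bar_face j t >> *~ (-1) ^+ j.
Proof.
move=> sub; rewrite /bar_diff (big_fset_incl _ sub) // => t _ nt.
by rewrite big1 // => j _; rewrite (mcoeff_outdom nt) raddf0 monalgU0 mul0rz.
Qed.

Lemma bar_diff_is_zmod_morphism i : zmod_morphism (@bar_diff i).
Proof.
move=> x y; pose d := (msupp x `|` msupp y)%fset.
rewrite !(@bar_diffEw _ _ d) ?fsubsetUl ?fsubsetUr ?msuppB_le //.
rewrite -sumrB; apply: eq_bigr => t _; rewrite -sumrB; apply: eq_bigr => j _.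
by rewrite mcoeffB raddfB monalgUB mulrzBl.
Qed.

HB.instance Definition _ i :=
  GRing.isZmodMorphism.Build (bar_chain i.+1) (bar_chain i) (@bar_diff i)
    (@bar_diff_is_zmod_morphism i).

Definition is_cycle i : {pred bar_chain i} :=
  match i with
  | 0 => fun=> true
  | i'.+1 => fun c => bar_diff c == 0
  end.

Lemma is_cycle_zmod_closed i : zmod_closed (@is_cycle i).
Proof.
case: i => [|i]; first by [].
have E (c : bar_chain i.+1) : (c \in @is_cycle i.+1) = (bar_diff c == 0) by [].
split=> [|x y]; rewrite !E; first by apply/eqP; exact: raddf0.
by rewrite bar_diff_is_zmod_morphism => /eqP-> /eqP->; rewrite subr0.
Qed.

HB.instance Definition _ i := GRing.isZmodClosed.Build (bar_chain i)
  (@is_cycle i) (@is_cycle_zmod_closed i).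

Record bar_cycle i := BarCycle {
  cycle_val : bar_chain i;
  _ : cycle_val \in @is_cycle i
}.

HB.instance Definition _ i := [isSub for @cycle_val i].
HB.instance Definition _ i := [Choice of bar_cycle i by <:].
HB.instance Definition _ i := [SubChoice_isSubZmodule of bar_cycle i by <:].

Definition is_boundary i : {pred bar_cycle i} :=
  fun z => `[< exists b : bar_chain i.+1, bar_diff b = val z >].

Lemma is_boundary_zmod_closed i : zmod_closed (@is_boundary i).
Proof.
split=> [|x y]; first by apply/asboolP; exists 0; rewrite raddf0.
move=> /asboolP[b bx] /asboolP[b' by']; apply/asboolP; exists (b - b').
by rewrite bar_diff_is_zmod_morphism bx by'.
Qed.

HB.instance Definition _ i := GRing.isZmodClosed.Build (bar_cycle i)
  (@is_boundary i) (@is_boundary_zmod_closed i).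

Definition group_homology i : zmodType := {ideal_quot @is_boundary i}.

End GroupHomology.

Definition trivial_zmod (A : zmodType) : Prop := forall x : A, x = 0.

Section BraidAction.
Context {F : fieldType} (V : braided_vspace F) (n : nat).

(* sigma_j acts by the braiding on the factors j and j+1, and sigma_j^-1 by its
   inverse. *)
Definition letter_op (x : bool * 'I_n.-1) : 'End(tpow V n) :=
  adjacent_op (if x.1 then (braiding V)^-1%VF else braiding V) x.2.

Definition word_op (w : braid_word n) : 'End(tpow V n) :=
  foldr (fun x A => letter_op x \o A)%VF \1%VF w.

(* Independent of the representative of g, by [braid_act_word]. *)
Definition braid_act (g : braid_group n) (f : tpow V n) : tpow V n :=
  word_op (repr g) f.

Lemma word_op_cat w w' : (word_op (w ++ w') = word_op w \o word_op w')%VF.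
Proof.
by elim: w => [|x w /= ->]; rewrite ?comp_lfun1l ?comp_lfunA.
Qed.

Lemma window_inj m j h : injective (@window m n j h).
Proof. by move=> k l /(congr1 val) /addnI /val_inj. Qed.

Lemma letter_opK b (j : 'I_n.-1) :
  (letter_op (b, j) \o letter_op (~~ b, j) = \1)%VF.
Proof.
have k0 : lker (braiding V) == 0%VS.
  exact/lker0P/bij_inj/braiding_iso.
rewrite /letter_op /adjacent_op -factor_op_comp; last exact: window_inj.
by case: b => /=; rewrite ?lker0_compVf ?lker0_compfV // factor_op1.
Qed.

Lemma letter_op_far (i j : 'I_n.-1) : (i.+1 < j)%N ->
  (letter_op (false, i) \o letter_op (false, j) =
   letter_op (false, j) \o letter_op (false, i))%VF.
Proof.
move=> ij; apply: factor_op_disjoint => k l; apply/eqP => /(congr1 val) /= E.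
have := leq_trans (ltn_ord k) (isT : 2 <= 2)%N; rewrite ltnS => k1.
have : (i + k <= i.+1)%N by rewrite -[i.+1]addn1 leq_add2l.
by rewrite E leqNgt (leq_trans ij) // leq_addr.
Qed.

Lemma letter_op_near (i j : 'I_n.-1) : i.+1 = j :> nat ->
  (letter_op (false, i) \o (letter_op (false, j) \o letter_op (false, i)) =
   letter_op (false, j) \o (letter_op (false, i) \o letter_op (false, j)))%VF.
Proof.
move=> ij.
have h : (i + 3 <= n)%N by rewrite addn3 ij -ltn_predRL.
have Ei : letter_op (false, i) =
    factor_op (window h) (adjacent_op (n := 3) (braiding V) ord0).
  rewrite /letter_op /adjacent_op factor_op_trans; try exact: window_inj.
    by congr factor_op; apply/funext => k; apply/val_inj.
  by move=> k l /(congr1 val) /addnI /val_inj.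
have Ej : letter_op (false, j) =
    factor_op (window h) (adjacent_op (n := 3) (braiding V) ord_max).
  rewrite /letter_op /adjacent_op factor_op_trans; try exact: window_inj.
    by congr factor_op; apply/funext => k; apply/val_inj; rewrite /= -ij addSn addnS.
  by move=> k l /(congr1 val) /addnI /val_inj.
rewrite Ei Ej -!factor_op_comp; try exact: window_inj.
by rewrite (yang_baxter V).
Qed.

Lemma word_op_cong w w' : braid_cong w w' -> word_op w = word_op w'.
Proof.
elim=> {w w'} //=.
- by move=> w1 w2 w3 _ -> _ ->.
- by move=> u u' w w' _ E _ E'; rewrite !word_op_cat E E'.
- by move=> b j; rewrite comp_lfun1r letter_opK.
- by move=> i j ij; rewrite !comp_lfun1r letter_op_far.
- by move=> i j ij; rewrite !comp_lfun1r letter_op_near.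
Qed.

Lemma braid_act_word w f : braid_act (braid_of_word w) f = word_op w f.
Proof. by rewrite /braid_act (word_op_cong (repr_braid_of w)). Qed.

Lemma braid_actB g : zmod_morphism (braid_act g).
Proof. by move=> x y; rewrite /braid_act raddfB. Qed.

Lemma braid_act1 f : braid_act 1%g f = f.
Proof. by rewrite braid_act_word /= id_lfunE. Qed.

Lemma braid_actM g h f : braid_act (g * h)%g f = braid_act g (braid_act h f).
Proof. by rewrite [LHS]braid_act_word word_op_cat comp_lfunE. Qed.

Definition braid_module : gmodule (braid_group n) :=
  GModule braid_actB braid_act1 braid_actM.

End BraidAction.

Definition braid_homology (F : fieldType) (V : braided_vspace F) (n i : nat) :
  zmodType := group_homology (braid_module V n) i.

Definition vanishes_with_slope (R : realType) (V : braided_vspace R[i])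
    (s : R) : Prop :=
  exists t : R, forall n i : nat, (1 <= n)%N -> i%:R <= s * n%:R + t ->
    trivial_zmod (braid_homology V n i).

Definition vanishes_in_staircase (F : fieldType) (V : braided_vspace F)
    (N I : nat) : Prop :=
  forall n i : nat, (1 <= n)%N -> (n <= N)%N ->
    (i%:Z <= I%:Z + n%:Z - N%:Z)%R -> trivial_zmod (braid_homology V n i).

(* Main.v *)
Require Import Defs.
From HB Require Import structures.
From Stdlib Require Import Setoid Morphisms.
From mathcomp Require Import all_boot all_order all_algebra.
From mathcomp Require Import finmap boolp reals complex.
From mathcomp.multinomials Require Import monalg.
From mathcomp Require Import zify lra.

(** The braid group has a finite complex whose cells in degree [i] are the
    compositions of [n] with [n - i] parts; with coefficients in [V^{⊗n}] it is the
    degree [n] part of the cobar complex of the quantum shuffle coalgebra of [V],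
    the number of parts being the cobar degree.  On an induced module this
    complex is acyclic: the longest shuffle dominates the differential, and on the
    leading terms with a fixed product the complex is the simplex on the
    generators dividing that product, by Garside's lcm property.  Dimension
    shifting then identifies its homology with that of the bar complex.

    Let [t_p] be the least [n] at which the cobar complex has homology in cobar
    degree [p].  Then [t_(p+q) >= t_p + t_q]: exactness in degree [p] removes from
    a cycle the components whose first [q] parts have sum at least [t_q], and
    below [t_q] these parts can be contracted.  The staircase hypothesis says
    [t_q >= N + 1] for [q = N - I], so that [t_(qa+s) >= (N+1) a + s]; when
    [I >= N] it forces [V = 0]. *)

Set Implicit Arguments.
Unset Strict Implicit.
Unset Printing Implicit Defensive.
Import Order.TTheory GRing.Theory Num.Theory.

(** * Positive braid words *)

(** A part of a composition can merge with either neighbour, so it belongs to both sides of any cut: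
    the complex in cobar degree [p + q] is not a product of two shorter ones, and exactness of these
    does not pass to it formally. To contract the first parts inside a longer composition, the
    contraction has to be a linear operator on the first tensor factors alone, which then commutes
    with the differential of the remaining strands. Exactness gives only primitives; the operator is
    built from them on a basis, by induction on the number of strands, because the homotopy in
    degree [q + 1] can be taken to be the one on fewer strands with the last part as a spectator.

    For induced modules the leading terms are those of maximal braid length. Removing them lowers
    the length, and this stops only if the length is bounded below, hence the passage to positive
    braids: a power of the central full twist moves any finite support into the positive monoid and
    commutes with the differential. *)

Definition near (i j : nat) := (i.+1 == j) || (j.+1 == i).
Definition far (i j : nat) := (i.+1 < j) || (j.+1 < i).

Inductive braid_rel : seq nat -> seq nat -> Prop :=
| BraidFar i j : far i j -> braid_rel [:: i; j] [:: j; i]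
| BraidNear i j : near i j -> braid_rel [:: i; j; i] [:: j; i; j].

(** Equality in the positive braid monoid, as chains with the first elementary move exposed:
    Garside's lemma is proved by induction along the chain, following the first letter of the
    word. *)
Inductive pcong : seq nat -> seq nat -> Prop :=
| pcong_refl u : pcong u u
| pcong_step a b l r v : braid_rel l r -> pcong (a ++ r ++ b) v ->
    pcong (a ++ l ++ b) v.

Lemma nearC i j : near i j = near j i. Proof. by rewrite /near orbC. Qed.
Lemma farC i j : far i j = far j i. Proof. by rewrite /far orbC. Qed.

Lemma braid_rel_sym l r : braid_rel l r -> braid_rel r l.
Proof.
by case=> i j H; [apply: BraidFar; rewrite farC|apply: BraidNear; rewrite nearC].
Qed.

Lemma pcong_trans u v w : pcong u v -> pcong v w -> pcong u w.
Proof.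
elim=> // a b l r x lr _ IH /IH; exact: pcong_step.
Qed.

Lemma pcong_rel a b l r : braid_rel l r -> pcong (a ++ l ++ b) (a ++ r ++ b).
Proof. by move=> lr; apply: pcong_step lr (pcong_refl _). Qed.

Lemma pcong_sym u v : pcong u v -> pcong v u.
Proof.
elim=> [w|a b l r x lr _ IH]; first exact: pcong_refl.
exact: pcong_trans IH (pcong_rel _ _ (braid_rel_sym lr)).
Qed.

#[export] Instance pcong_equiv : Equivalence pcong.
Proof. by split; [exact: pcong_refl|exact: pcong_sym|exact: pcong_trans]. Qed.

#[export] Instance pcong_cat : Proper (pcong ==> pcong ==> pcong) (@cat nat).
Proof.
move=> u u' uu' v v' vv'; transitivity (u ++ v').
  elim: vv' => [w|a b l r x lr _ IH]; first reflexivity.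
  rewrite catA; apply: pcong_step lr _; by rewrite -catA.
elim: uu' => [w|a b l r x lr _ IH]; first reflexivity.
by rewrite -!catA; apply: pcong_step lr _; rewrite [r ++ _]catA catA.
Qed.

#[export] Instance pcong_cons : Proper (eq ==> pcong ==> pcong) (@cons nat).
Proof. by move=> i _ <- u v; apply: (pcong_cat (pcong_refl [:: i])). Qed.

Lemma pcong_size u v : pcong u v -> size u = size v.
Proof. by elim=> // a b l r x [] i j _ _ <-; rewrite !size_cat. Qed.

Lemma pcong_all (p : pred nat) u v : pcong u v -> all p u = all p v.
Proof.
elim=> // a b l r x lr _ <-; rewrite !all_cat; congr (_ && (_ && _)).
by case: lr => i j _ /=; case: (p i); case: (p j).
Qed.

Lemma pcong_far i j w : far i j -> pcong (i :: j :: w) (j :: i :: w).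
Proof. by move=> /BraidFar; apply: (@pcong_rel [::] w). Qed.

Lemma pcong_near i j w : near i j ->
  pcong (i :: j :: i :: w) (j :: i :: j :: w).
Proof. by move=> /BraidNear; apply: (@pcong_rel [::] w). Qed.

Lemma pcong_comm u v : (forall i j, i \in u -> j \in v -> far i j) ->
  pcong (u ++ v) (v ++ u).
Proof.
elim: u => [|i u IH] H; first by rewrite cats0; reflexivity.
rewrite /= IH => [|k j uk vj]; last by apply: H; rewrite // inE uk orbT.
have {H}: forall j, j \in v -> far i j by move=> j; apply: H; rewrite inE eqxx.
elim: v {IH} => [|j v IH] H; first by reflexivity.
rewrite /= (@pcong_far i j); last by apply: H; rewrite inE eqxx.
by rewrite IH => [|k vk]; [reflexivity|apply: H; rewrite inE vk orbT].
Qed.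

(** [i :: compl i j] is the least common right multiple of the generators [i] and [j]. *)
Definition compl i j :=
  if i == j then [::] else if near i j then [:: j; i] else [:: j].

Lemma compl_id i : compl i i = [::].
Proof. by rewrite /compl eqxx. Qed.

Lemma compl_far i j : far i j -> compl i j = [:: j].
Proof.
rewrite /far /compl /near => H; case: eqP => [E|_]; first by exfalso; lia.
by case: ifP => // E; exfalso; lia.
Qed.

Lemma compl_near i j : near i j -> compl i j = [:: j; i].
Proof.
rewrite /compl => nij; rewrite nij; case: eqP => // E.
by exfalso; move: nij; rewrite /near E; lia.
Qed.

Variant letters_spec i j : Prop :=
| LettersEq of i = j | LettersFar of far i j | LettersNear of near i j.

Lemma lettersP i j : letters_spec i j.
Proof.
have [E|[E|E]] : i = j \/ far i j \/ near i j by rewrite /far /near; lia.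
- exact: LettersEq.
- exact: LettersFar.
- exact: LettersNear.
Qed.

Definition has_lcm i u j v :=
  exists w, pcong u (compl i j ++ w) /\ pcong v (compl j i ++ w).

Lemma has_lcm_sym i u j v : has_lcm i u j v -> has_lcm j v i u.
Proof. by case=> w [? ?]; exists w. Qed.

(** * Common multiples of three generators *)

Section Combine.
Variable L : nat.
Hypothesis IH : forall i u j v, size u < L ->
  pcong (i :: u) (j :: v) -> has_lcm i u j v.

Let cancelL i u v : pcong (i :: u) (i :: v) -> size u < L -> pcong u v.
Proof.
move=> E su; have [w []] := IH su E.
by rewrite compl_id /= => Hu Hv; apply: pcong_trans Hu (pcong_sym Hv).
Qed.

Let farL i u j v : far i j -> pcong (i :: u) (j :: v) -> size u < L ->
  exists w, pcong u (j :: w) /\ pcong v (i :: w).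
Proof.
move=> ij E su; have [w []] := IH su E.
by rewrite compl_far // compl_far 1?farC // => ? ?; exists w.
Qed.

Let nearL i u j v : near i j -> pcong (i :: u) (j :: v) -> size u < L ->
  exists w, pcong u (j :: i :: w) /\ pcong v (i :: j :: w).
Proof.
move=> ij E su; have [w []] := IH su E.
by rewrite compl_near // compl_near 1?nearC // => ? ?; exists w.
Qed.

Let lcm_eq i u v : pcong u v -> has_lcm i u i v.
Proof.
by move=> uv; exists v; rewrite compl_id; split=> //; apply: pcong_refl.
Qed.

Let lcm_far i u j v w : far i j -> pcong u (j :: w) -> pcong v (i :: w) ->
  has_lcm i u j v.
Proof.
by move=> ij ? ?; exists w; rewrite compl_far // compl_far 1?farC.
Qed.

Let lcm_near i u j v w : near i j -> pcong u (j :: i :: w) ->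
  pcong v (i :: j :: w) -> has_lcm i u j v.
Proof.
by move=> ij ? ?; exists w; rewrite compl_near // compl_near 1?nearC.
Qed.

Let combine_far_far i u k j v w w' : far i k -> far j k ->
  pcong u (k :: w) -> pcong (i :: w) (j :: w') -> pcong v (k :: w') ->
  size w < L -> has_lcm i u j v.
Proof.
move=> ik jk Hu E Hv sw; case: (lettersP i j) => [ij|ij|ij].
- rewrite -ij in E *; have Ew := cancelL E sw.
  by apply: lcm_eq; rewrite Hu Hv Ew; reflexivity.
- have [z [Hw Hw']] := farL ij E sw.
  by apply: (@lcm_far _ _ _ _ (k :: z)); rewrite // ?Hu ?Hv ?Hw ?Hw';
    apply: pcong_far; rewrite farC.
- have [z [Hw Hw']] := nearL ij E sw; apply: (@lcm_near _ _ _ _ (k :: z)) => //.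
    rewrite Hu Hw (@pcong_far k j) 1?farC // (@pcong_far k i) 1?farC //.
    reflexivity.
  rewrite Hv Hw' (@pcong_far k i) 1?farC // (@pcong_far k j) 1?farC //.
  reflexivity.
Qed.

Let combine_far_near i u k j v w w' : far i k -> near j k ->
  pcong u (k :: w) -> pcong (i :: w) (j :: k :: w') -> pcong v (k :: j :: w') ->
  size w < L -> has_lcm i u j v.
Proof.
move=> ik jk Hu E Hv sw.
have /= sE := pcong_size E.
case: (lettersP i j) => [ij|ij|ij].
- by exfalso; move: ik jk; rewrite ij /far /near; lia.
- have [z [Hw Hw']] := farL ij E sw; have ki : far k i by rewrite farC.
  have [|z' [Hw2 Hz]] := farL ki Hw'; first lia.
  apply: (@lcm_far _ _ _ _ (k :: j :: z')) => //.
    by rewrite Hu Hw Hz (@pcong_near k j) 1?nearC //; reflexivity.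
  rewrite Hv Hw2 (@pcong_far j i) 1?farC // (@pcong_far k i) 1?farC //.
  reflexivity.
- have [z [Hw Hw']] := nearL ij E sw; have ki : far k i by rewrite farC.
  have [|y [Hw2 Hz]] := farL ki Hw'; first lia.
  have /= sz := pcong_size Hw.
  have [|y' [Hz2 Hy]] := nearL jk Hz; first lia.
  apply: (@lcm_near _ _ _ _ (k :: j :: i :: y')) => //.
    rewrite Hu Hw Hz2 (@pcong_far i k) // (@pcong_near k j) 1?nearC //.
    by rewrite (@pcong_near j i) 1?nearC // (@pcong_far k i) //; reflexivity.
  rewrite Hv Hw2 Hy (@pcong_near j i) 1?nearC // (@pcong_far k i) //.
  by rewrite (@pcong_far i k y') // (@pcong_near k j) 1?nearC //; reflexivity.
Qed.

(** Here [i] and [j] are equal or the two neighbours of [k]. In the second case the three letters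
    generate a braid monoid on four strands, and the word [i, j, k, j, i, k] that appears is its
    half twist, the least common multiple of the three. *)
Let combine_near_near i u k j v w w' : near i k -> near j k ->
  pcong u (k :: i :: w) -> pcong (i :: k :: w) (j :: k :: w') ->
  pcong v (k :: j :: w') -> size w < L.-1 -> has_lcm i u j v.
Proof.
move=> ik jk Hu E Hv sw; have /= sE := pcong_size E.
case: (lettersP i j) => [ij|ij|ij].
- rewrite -ij in E Hv *; apply: lcm_eq.
  have E1 : pcong (k :: w) (k :: w') by apply: cancelL E _ => /=; lia.
  have E2 : pcong w w' by apply: cancelL E1 _; lia.
  by rewrite Hu Hv E2; reflexivity.
- have [|z [Hw Hw']] := farL ij E; first by rewrite /=; lia.
  have kj : near k j by rewrite nearC.
  have ki : near k i by rewrite nearC.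
  have [|a [Ha Hza]] := nearL kj Hw; first by lia.
  have [|b [Hb Hzb]] := nearL ki Hw'; first by lia.
  have /= s1 := pcong_size Ha; have /= s2 := pcong_size Hza.
  have /= s3 := pcong_size Hb; have /= s4 := pcong_size Hzb.
  have /= s5 := pcong_size Hw.
  have Eab : pcong (k :: j :: a) (k :: i :: b) by rewrite -Hza -Hzb; reflexivity.
  have {}Eab : pcong (j :: a) (i :: b) by apply: cancelL Eab _ => /=; lia.
  have ji : far j i by rewrite farC.
  have [|e [He He']] := farL ji Eab; first by lia.
  apply: (@lcm_far _ _ _ _ (k :: j :: i :: k :: e)) => //.
    rewrite Hu Ha He (@pcong_far i j) // (@pcong_near i k) //.
    by rewrite (@pcong_near k j) //; reflexivity.
  rewrite Hv Hb He' (@pcong_far j i) // (@pcong_near j k) //.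
  by rewrite (@pcong_near k i) // (@pcong_far i j) //; reflexivity.
- by exfalso; move: ij ik jk; rewrite /near; lia.
Qed.

(* [k] is the first letter of an intermediate word in a chain of elementary
   moves from [i :: u] to [j :: v]; this is the cube condition. *)
Lemma has_lcm_trans i u k y j v : size y = L ->
  has_lcm i u k y -> has_lcm k y j v -> has_lcm i u j v.
Proof.
move=> sy [w [Hu Hy]] [w' [Hy' Hv]].
have E : pcong (compl k i ++ w) (compl k j ++ w').
  by rewrite -Hy -Hy'; reflexivity.
have sE := pcong_size Hy; rewrite sy in sE.
move: {y sy Hy Hy'} Hu E Hv sE; case: (lettersP i k) => [->|ik|ik].
- rewrite compl_id /= => Hu E Hv _; exists w'.
  by split=> //; apply: pcong_trans Hu E.
- case: (lettersP j k) => [->|jk|jk].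
  + rewrite !compl_id /= => Hu E Hv _; exists w.
    by split=> //; apply: pcong_trans Hv (pcong_sym E).
  + rewrite !compl_far 1?(farC k) //= => Hu E Hv sw.
    by apply: combine_far_far Hu E Hv _ => //; lia.
  + rewrite (compl_far ik) (@compl_far k i) 1?farC // (compl_near jk).
    rewrite (@compl_near k j) 1?nearC //= => Hu E Hv sw.
    by apply: combine_far_near Hu E Hv _ => //; lia.
- case: (lettersP j k) => [->|jk|jk].
  + rewrite !compl_id /= => Hu E Hv _; exists w.
    by split=> //; apply: pcong_trans Hv (pcong_sym E).
  + rewrite (compl_near ik) (@compl_near k i) 1?nearC // (compl_far jk).
    rewrite (@compl_far k j) 1?farC //= => Hu E Hv sw.
    have /= sE := pcong_size E; apply: has_lcm_sym.
    by apply: combine_far_near Hv (pcong_sym E) Hu _ => //; lia.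
  + rewrite (compl_near ik) (@compl_near k i) 1?nearC // (compl_near jk).
    rewrite (@compl_near k j) 1?nearC //= => Hu E Hv sw.
    by apply: combine_near_near Hu E Hv _ => //; lia.
Qed.
End Combine.

(* Garside's key lemma. *)
Lemma pcong_lcm i u j v : pcong (i :: u) (j :: v) -> has_lcm i u j v.
Proof.
(* Two inductions: this one on the length, which supplies the lemma for shorter words, and below one
   along the chain of moves at fixed length. *)
have [L sL] := ubnP (size u); elim: L => // L IHL in i u j v sL *.
have {}IHL i' u' j' v' : size u' < size u ->
    pcong (i' :: u') (j' :: v') -> has_lcm i' u' j' v'.
  by move=> su; apply: IHL; lia.
move Ex : (i :: u) => x; move Ey : (j :: v) => y xy.
have sx : size x = (size u).+1 by rewrite -Ex.
move: (size u) sx IHL => {sL}L sx IHL.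
elim: xy => [z|a b l r z lr zy IH] in i u sx Ex Ey *.
  move: Ex; rewrite -Ey => -[<- <-]; exists u; rewrite compl_id.
  by split; reflexivity.
have srl : size r = size l by case: {+}lr.
have sr : size (a ++ r ++ b) = L.+1.
  by rewrite -sx !size_cat srl.
case Er : (a ++ r ++ b) => [|k y']; first by move: sr; rewrite Er.
have := IH k y' sr (esym Er) Ey.
have sy : size y' = L by move: sr; rewrite Er => -[].
apply: (has_lcm_trans (L := L)) => //.
(* A move at the start of the word changes the first letter, and its two sides are the two words of
   a least common multiple. Any other move leaves the first letter alone, and the equal-letter case
   applies. *)
case: a Ex Er {IH sx sr zy} => [|i' a] /= Ex Er.
  case: lr Ex Er {srl} => p q pq /= [-> ->] [<- <-].
    exists b; rewrite compl_far // compl_far 1?farC //.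
    by split; reflexivity.
  exists b; rewrite compl_near // compl_near 1?nearC //.
  by split; reflexivity.
case: Ex Er => -> -> [<- <-]; exists (a ++ r ++ b); rewrite compl_id /=.
by split; [apply: pcong_rel|reflexivity].
Qed.

Lemma pcong_cons_inj i u v : pcong (i :: u) (i :: v) -> pcong u v.
Proof.
by move/pcong_lcm=> [w []]; rewrite compl_id => Hu Hv; rewrite Hu Hv; reflexivity.
Qed.

Lemma pcong_cat_inj w u v : pcong (w ++ u) (w ++ v) -> pcong u v.
Proof. by elim: w => //= i w IH /pcong_cons_inj. Qed.

(** The letter [j.+1] commutes with everything before [j]; one braid relation with [j, j.+1] turns
    it into [j], which commutes with everything after. *)
Lemma cyc_shift i m j w : i <= j -> j.+1 < i + m ->
  pcong (j.+1 :: iota i m ++ w) (iota i m ++ j :: w).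
Proof.
move=> ij jm; have -> : m = (j - i) + (2 + (m - (j - i) - 2)) by lia.
rewrite !iotaD -!catA subnKC //=.
set u := iota i _; set v := iota _ _.
have Hu : pcong (j.+1 :: u ++ [:: j, j.+1 & v ++ w])
                (u ++ [:: j.+1, j, j.+1 & v ++ w]).
  rewrite -cat1s catA (@pcong_comm [:: j.+1] u) -?catA; first reflexivity.
  by move=> p q; rewrite inE mem_iota /far => /eqP -> ?; lia.
rewrite Hu (@pcong_near j.+1 j); last by rewrite /near; lia.
rewrite -(cat1s j w) (catA v) (@pcong_comm v [:: j]); first reflexivity.
by move=> p q; rewrite inE mem_iota /far => ? /eqP ->; lia.
Qed.

Lemma pcong_shift i m u w :
  (forall j, j \in u -> (i <= j) && (j.+1 < i + m)) ->
  pcong (map S u ++ iota i m ++ w) (iota i m ++ u ++ w).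
Proof.
elim: u => [|j u IH] H /=; first by reflexivity.
rewrite IH => [|k ku]; last by apply: H; rewrite inE ku orbT.
have /andP[ij jm] := H j (mem_head _ _).
by apply: cyc_shift.
Qed.

(** * Powers of the Coxeter word and the full twist *)

Definition dpow m k := flatten (nseq k (iota 0 m)).

Lemma dpowD m k l : dpow m (k + l) = dpow m k ++ dpow m l.
Proof. by rewrite /dpow nseqD flatten_cat. Qed.

Lemma dpow1 m : dpow m 1 = iota 0 m.
Proof. by rewrite /dpow /= cats0. Qed.

Lemma dpow_shift m k j w : j + k < m ->
  pcong (j + k :: dpow m k ++ w) (dpow m k ++ j :: w).
Proof.
elim: k j w => [|k IH] j w jk; first by rewrite addn0; reflexivity.
rewrite -addn1 dpowD dpow1 -!catA.
have -> : j + (k + 1) = j.+1 + k by lia.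
rewrite IH; last by lia.
by apply: pcong_cat; [reflexivity|apply: cyc_shift; lia].
Qed.

(** In general the conjugate of the letter 0 by one Coxeter word is no longer a generator; a second
    conjugation brings it round to the last letter. *)
Lemma dpow2 m w : 0 < m ->
  pcong (0 :: dpow m 2 ++ w) (dpow m 2 ++ m.-1 :: w).
Proof.
case: m => // m _; rewrite -[2]/(1 + 1) dpowD dpow1 -!catA.
have E v : pcong (iota 0 m.+1 ++ iota 0 m ++ v) (iota 1 m ++ iota 0 m.+1 ++ v).
  symmetry; rewrite [iota 1 m](iotaDl 1 0 m) pcong_shift; first reflexivity.
  by move=> j; rewrite mem_iota; lia.
have Er : iota 0 m.+1 = iota 0 m ++ [:: m] by rewrite -addn1 iotaD.
have -> : pcong (iota 0 m.+1 ++ iota 0 m.+1 ++ w)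
                (iota 1 m ++ iota 0 m.+1 ++ m :: w).
  by rewrite {2}Er -catA E; reflexivity.
reflexivity.
Qed.

(** With [m] generators, that is [m.+1] strands, this is the full twist. It is central and divisible
    by every letter, so that each braid is a positive word divided by a power of [zeta]. *)
Definition zeta m := dpow m m.+1.

(** Of the [m.+1] Coxeter words, [j] lower the letter to 0, two carry it round to [m.-1], and the
    remaining [m - j.+1] bring it back to [j]. *)
Lemma zeta_comm m j : j < m -> pcong (j :: zeta m) (zeta m ++ [:: j]).
Proof.
move=> jm; rewrite /zeta.
have -> : m.+1 = j + (2 + (m - j.+1)) by lia.
rewrite (dpowD m j) (dpowD m 2) -(catA (dpow m j)) -(catA (dpow m 2)).
rewrite -{1}[j]/(0 + j) dpow_shift // dpow2; last by lia.
have -> : m.-1 = j + (m - j.+1) by lia.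
have := @dpow_shift m (m - j.+1) j [::]; rewrite cats0 => ->; first reflexivity.
lia.
Qed.

Definition zquot m j := dpow m j ++ iota 1 m.-1 ++ dpow m (m - j).

Lemma zquot_l m j : j < m -> pcong (j :: zquot m j) (zeta m).
Proof.
move=> jm; rewrite /zeta /zquot.
have -> : m.+1 = j + (1 + (m - j)) by lia.
rewrite (dpowD m j) (dpowD m 1) dpow1 -{1}[j]/(0 + j) dpow_shift //.
by case: m jm => //= m _; reflexivity.
Qed.

Lemma zquot_r m j : j < m -> pcong (zquot m j ++ [:: j]) (zeta m).
Proof.
move=> jm; apply: (@pcong_cons_inj j); rewrite -cat_cons zquot_l //.
by rewrite zeta_comm //; reflexivity.
Qed.

Lemma zeta_letters m : all (gtn m) (zeta m).
Proof.
rewrite /zeta /dpow; elim: m.+1 => //= k IH; rewrite all_cat IH andbT.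
by apply/allP => j; rewrite mem_iota.
Qed.

Lemma zquot_letters m j : j < m -> all (gtn m) (zquot m j).
Proof.
move=> jm; have := pcong_all (gtn m) (zquot_l jm).
by rewrite zeta_letters /= => /andP[].
Qed.

(** Words for the [(a, b)]-shuffles of the strands from [k] on, by Pascal's rule: either the last
    strand stays in place, or the last strand of the first block crosses the whole second block. *)
Fixpoint shuffles k a b : seq (seq nat) :=
  if a is a'.+1 then
    (fix shuf b := if b is b'.+1 then
       shuf b' ++ map (cat (iota (k + a') b)) (shuffles k a' b)
     else [:: [::]]) b
  else [:: [::]].

Lemma shufflesa0 k a : shuffles k a 0 = [:: [::]]. Proof. by case: a. Qed.
Lemma shufflesSS k a b : shuffles k a.+1 b.+1 =
  shuffles k a.+1 b ++ map (cat (iota (k + a) b.+1)) (shuffles k a b.+1).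
Proof. by []. Qed.

Lemma shuffles_letters k a b w j : w \in shuffles k a b -> j \in w ->
  (k <= j) && (j.+1 < k + a + b).
Proof.
elim: a b w => [|a IHa]; first by move=> b w; rewrite inE => /eqP ->.
elim=> [|b IHb] w; first by rewrite shufflesa0 inE => /eqP ->.
rewrite shufflesSS mem_cat => /orP[wi jw|/mapP[v vi ->]].
  by have := IHb _ wi jw; lia.
by rewrite mem_cat mem_iota => /orP[|/(IHa _ _ vi)]; lia.
Qed.

(* The longest shuffle. *)
Fixpoint top k a b : seq nat :=
  if a is a'.+1 then iota (k + a') b ++ top k a' b else [::].

Lemma topa0 k a : top k a 0 = [::]. Proof. by elim: a. Qed.

Lemma size_top k a b : size (top k a b) = a * b.
Proof. by elim: a => //= a IH; rewrite size_cat size_iota IH mulSn. Qed.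

Lemma top_letters k a b j : j \in top k a b -> (k <= j) && (j.+1 < k + a + b).
Proof.
by elim: a => //= a IH; rewrite mem_cat mem_iota => /orP[|/IH]; lia.
Qed.

Lemma top_map k a b : map S (top k a b) = top k.+1 a b.
Proof.
by elim: a => //= a <-; rewrite map_cat addSn [iota (k + a).+1 b](iotaDl 1 (k + a) b).
Qed.

Fixpoint small_shuffles k a b : seq (seq nat) :=
  if a is a'.+1 then
    if b is b'.+1 then
      shuffles k a b' ++ map (cat (iota (k + a') b)) (small_shuffles k a' b)
    else [::]
  else [::].

Lemma perm_shuffles k a b :
  perm_eq (shuffles k a b) (top k a b :: small_shuffles k a b).
Proof.
elim: a b => [|a IH] [|b] //; first by rewrite topa0 shufflesa0.
rewrite shufflesSS; set f := cat (iota _ _); set A := shuffles k a.+1 b.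
apply: (@perm_trans _ (A ++ map f (top k a b.+1 :: small_shuffles k a b.+1))).
  by rewrite perm_cat2l; apply: perm_map (IH _).
exact: (permEl (perm_catCA A [:: f (top k a b.+1)] _)).
Qed.

Lemma shuffles_size k a b w : w \in shuffles k a b -> size w <= a * b.
Proof.
elim: a b w => [|a IHa]; first by move=> b w; rewrite inE => /eqP ->.
elim=> [|b IHb] w; first by rewrite shufflesa0 inE => /eqP ->.
rewrite shufflesSS mem_cat => /orP[/IHb|/mapP[v /IHa sv ->]]; first by nia.
by rewrite size_cat size_iota; nia.
Qed.

Lemma small_shuffles_size k a b w : w \in small_shuffles k a b -> size w < a * b.
Proof.
elim: a b w => [|a IHa] // [|b] w //; rewrite [_ \in _]mem_cat.
move=> /orP[/shuffles_size|/mapP[v /IHa sv ->]]; first by nia.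
by rewrite size_cat size_iota; nia.
Qed.

Lemma small_shuffles_letters k a b w j : w \in small_shuffles k a b ->
  j \in w -> (k <= j) && (j.+1 < k + a + b).
Proof.
by move=> wi; apply: shuffles_letters; rewrite (perm_mem (perm_shuffles k a b)) inE wi orbT.
Qed.

(** Both sides reverse the order of three consecutive blocks; the induction peels off the last
    strand of the first block. *)
Lemma top_coassoc k a b c :
  pcong (top k a b ++ top k (a + b) c) (top (k + a) b c ++ top k a (b + c)).
Proof.
elim: a => [|a IH] /=; first by rewrite addn0 cats0; reflexivity.
rewrite -!catA (catA (top k a b)) (@pcong_comm (top k a b)); last first.
  by move=> i j /top_letters ij; rewrite mem_iota /far; lia.
rewrite -catA IH addnS -top_map pcong_shift; last first.
  by move=> j /top_letters; lia.
by rewrite (iotaD (k + a)) -catA addnA; reflexivity.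
Qed.

(** The half twist on [a] strands from [k] on: each new strand crosses all the earlier ones. *)
Fixpoint delta k a := if a is a'.+1 then delta k a' ++ top k a' 1 else [::].

Arguments delta : simpl never.

Lemma deltaS k a : delta k a.+1 = delta k a ++ top k a 1. Proof. by []. Qed.

Lemma deltaD k a b : pcong (delta k (a + b)) (delta k a ++ delta (k + a) b ++ top k a b).
Proof.
elim: b => [|b IH]; first by rewrite addn0 topa0 !cats0; reflexivity.
by rewrite addnS !deltaS IH -!catA top_coassoc addn1; reflexivity.
Qed.

Lemma delta_letters k a j : j \in delta k a -> (k <= j) && (j.+1 < k + a).
Proof.
by elim: a => //= a IH; rewrite deltaS mem_cat => /orP[/IH|/top_letters]; lia.
Qed.

(* A composition of n is encoded by the sequence of the predecessors of its
   parts, and [wt] is the composed integer. *)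
Definition wt (c : seq nat) := sumn c + size c.

Lemma wt_cat c c' : wt (c ++ c') = wt c + wt c'.
Proof. by rewrite /wt sumn_cat size_cat; lia. Qed.

Lemma wt_cons a c : wt (a :: c) = a.+1 + wt c.
Proof. by rewrite /wt /=; lia. Qed.

Lemma wt_rcons c a : wt (rcons c a) = wt c + a.+1.
Proof. by rewrite -cats1 wt_cat wt_cons /wt /=; lia. Qed.

Fixpoint cell_delta k c :=
  if c is a :: c' then delta k a.+1 ++ cell_delta (k + a.+1) c' else [::].

Lemma cell_deltaS k a c :
  cell_delta k (a :: c) = delta k a.+1 ++ cell_delta (k + a.+1) c.
Proof. by []. Qed.

Lemma cell_delta_cat k c c' :
  cell_delta k (c ++ c') = cell_delta k c ++ cell_delta (k + wt c) c'.
Proof.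
elim: c k => [|a c IH] k /=; first by rewrite /wt addn0.
by rewrite IH catA wt_cons addnA.
Qed.

Lemma cell_delta_letters k c j : j \in cell_delta k c ->
  (k <= j) && (j.+1 < k + wt c).
Proof.
elim: c k => // a c IH k; rewrite cell_deltaS mem_cat wt_cons.
by move=> /orP[/delta_letters|/IH]; lia.
Qed.

(** The origin of the leading term: the longest shuffle is the quotient of the products of half
    twists after and before a merge. *)
Lemma cell_delta_merge k c a b c' :
  pcong (cell_delta k (c ++ (a + b).+1 :: c'))
        (cell_delta k (c ++ [:: a, b & c']) ++ top (k + wt c) a.+1 b.+1).
Proof.
rewrite !cell_delta_cat -catA; apply: pcong_cat; first by reflexivity.
set l := k + _; rewrite !cell_deltaS -addSn -addnS deltaD addnA.
rewrite -2!(catA (delta l a.+1)); apply: pcong_cat; first by reflexivity.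
rewrite -2!(catA (delta (l + a.+1) b.+1)).
apply: pcong_cat; first by reflexivity.
apply: pcong_comm => i j /top_letters Hi /cell_delta_letters Hj.
by rewrite /far; lia.
Qed.

(** The letters between two strands of the same block; the letters left out are the walls of [c]. *)
Fixpoint inner k c :=
  if c is a :: c' then iota k a ++ inner (k + a.+1) c' else [::].

Lemma inner_letters k c j : j \in inner k c -> (k <= j) && (j.+1 < k + wt c).
Proof.
elim: c k => //= a c IH k; rewrite mem_cat mem_iota wt_cons.
by move=> /orP[|/IH]; lia.
Qed.

(** Cut the strands into three blocks, the middle one being the two strands exchanged by [s]: the
    half twist of that block is the letter [s], and it commutes with the half twist of the first
    block. *)
Lemma delta_inner k a s : s \in iota k a -> exists w, pcong (s :: w) (delta k a.+1).
Proof.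
rewrite mem_iota => sk; have -> : a.+1 = (s - k) + 2 + (a - (s - k).+1) by lia.
exists (delta k (s - k) ++ top k (s - k) 2 ++
  delta (k + (s - k + 2)) (a - (s - k).+1) ++ top k (s - k + 2) (a - (s - k).+1)).
have E2 : delta (k + (s - k)) 2 = [:: s].
  by rewrite -[delta _ 2]/[:: k + (s - k) + 0]; congr [:: _]; lia.
rewrite deltaD deltaD E2 -!catA -cat1s (catA [:: s]) (@pcong_comm [:: s]); last first.
  by move=> i j; rewrite inE => /eqP -> /delta_letters; rewrite /far; lia.
rewrite -catA.
reflexivity.
Qed.

Lemma cell_delta_inner k c s : s \in inner k c ->
  exists w, pcong (s :: w) (cell_delta k c).
Proof.
elim: c k => // a c IH k; rewrite cell_deltaS mem_cat => /orP[/delta_inner[w E]|sc].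
  by exists (w ++ cell_delta (k + a.+1) c); rewrite -cat_cons E; reflexivity.
have [w E] := IH _ sc; have /andP[sk _] := inner_letters sc.
exists (delta k a.+1 ++ w); rewrite -E -cat1s (catA [:: s]) (@pcong_comm [:: s]).
  by rewrite -catA; reflexivity.
by move=> i j; rewrite inE => /eqP -> /delta_letters; rewrite /far; lia.
Qed.

(** * Positive elements of the braid group *)

Section PositiveWords.
Variable n : nat.
Local Notation m := n.-1.
Local Notation G := (braid_group n).
Local Open Scope group_scope.

Definition lift_word (u : seq nat) : braid_word n :=
  [seq (false, i) | i <- pmap insub u].

Definition pos_elt (u : seq nat) : G := braid_of_word (lift_word u).

Lemma braid_of_catg w w' :
  braid_of_word (w ++ w') = (braid_of_word w : G) * (braid_of_word w' : G) :> G.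
Proof. exact: braid_of_cat. Qed.

Lemma braid_of_inv j :
  braid_of_word [:: (true, j)] = (braid_of_word [:: (false, j)] : G)^-1 :> G.
Proof.
apply: (mulgI (braid_of_word [:: (false, j)] : G)); rewrite mulgV -braid_of_catg.
by apply/braid_of_wordP; apply: (bc_inv false).
Qed.

Lemma pos_elt_cat u v : pos_elt (u ++ v) = pos_elt u * pos_elt v.
Proof. by rewrite /pos_elt /lift_word pmap_cat map_cat braid_of_catg. Qed.

Lemma pos_elt1 (j : 'I_m) : pos_elt [:: val j] = braid_of_word [:: (false, j)].
Proof. by rewrite /pos_elt /lift_word /= valK. Qed.

Lemma pos_elt_cons i u : pos_elt (i :: u) = pos_elt [:: i] * pos_elt u.
Proof. exact: (pos_elt_cat [:: i]). Qed.

Lemma pos_elt0 : pos_elt [::] = 1. Proof. by []. Qed.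

Lemma lift_word_cons i u : lift_word (i :: u) = lift_word [:: i] ++ lift_word u.
Proof. by rewrite /lift_word -map_cat -pmap_cat. Qed.

Lemma pos_elt_pcong u v : all (gtn m) u -> pcong u v -> pos_elt u = pos_elt v.
Proof.
move=> au uv; elim: uv au => // a b l r x lr _ IH.
have lru : pcong (a ++ l ++ b) (a ++ r ++ b) by apply: pcong_rel.
rewrite (pcong_all _ lru) => ar; rewrite -(IH ar) !pos_elt_cat; congr (_ * (_ * _)).
have {}ar: all (gtn m) r by move: ar; rewrite !all_cat => /and3P[].
rewrite /pos_elt; apply/braid_of_wordP; case: lr ar {IH lru}.
  move=> i j ij /= /and3P[jm im _].
  rewrite /lift_word /= !insubT /=.
  case/orP: ij => [ij|ij]; first exact: bc_far.
  by apply: bc_sym; apply: bc_far.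
move=> i j ij /= /and4P[jm im _ _].
rewrite /lift_word /= !insubT /=.
case/orP: ij => /eqP ij; first exact: bc_near.
by apply: bc_sym; apply: bc_near.
Qed.

Definition neg_count (w : braid_word n) := count fst w.

(** The numerator of [w] over the denominator [zpow (neg_count w)]: an inverse letter is [zquot m j]
    divided by [zeta m]. *)
Definition pos_part (w : braid_word n) : seq nat :=
  flatten [seq if x.1 then zquot m x.2 else [:: val x.2] | x : bool * 'I_m <- w].

Lemma pos_part_cat w w' : pos_part (w ++ w') = pos_part w ++ pos_part w'.
Proof. by rewrite /pos_part map_cat flatten_cat. Qed.

Lemma pos_part_letters w : all (gtn m) (pos_part w).
Proof.
elim: w => //= -[b j] w IH; rewrite /pos_part /= all_cat -/(pos_part w) IH andbT.
by case: b => /=; rewrite ?zquot_letters ?ltn_ord.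
Qed.

Lemma pos_part_lift u : all (gtn m) u -> pos_part (lift_word u) = u.
Proof.
elim: u => //= i u IH /andP[im um].
by rewrite lift_word_cons pos_part_cat IH // /lift_word /= insubT.
Qed.

Lemma neg_count_lift u : neg_count (lift_word u) = 0.
Proof.
by rewrite /neg_count /lift_word; elim: (pmap _ u).
Qed.

Definition zpow k := flatten (nseq k (zeta m)).

Lemma zpowD k l : zpow (k + l) = zpow k ++ zpow l.
Proof. by rewrite /zpow nseqD flatten_cat. Qed.

Lemma zpow1 : zpow 1 = zeta m. Proof. by rewrite /zpow /= cats0. Qed.

Lemma zpow_letters k : all (gtn m) (zpow k).
Proof. by elim: k => //= k IH; rewrite /zpow /= all_cat zeta_letters. Qed.

Lemma zpow_comm k u : all (gtn m) u -> pcong (u ++ zpow k) (zpow k ++ u).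
Proof.
move=> um; elim: k => [|k IH]; first by rewrite cats0; reflexivity.
rewrite -addn1 addnC zpowD zpow1 -catA -IH !catA.
apply: pcong_cat; last by reflexivity.
elim: u um {IH} => [|j u IHu] /=; first by rewrite cats0; reflexivity.
move=> /andP[jm um]; rewrite IHu // -cat_cons zeta_comm // -catA; reflexivity.
Qed.

(* Fractions [zeta^-k u] with [u] positive; this says that the braid group
   is the group of fractions of the monoid of positive words. *)
Lemma braid_cong_pos w w' : braid_cong w w' ->
  pcong (zpow (neg_count w') ++ pos_part w) (zpow (neg_count w) ++ pos_part w').
Proof.
elim=> {w w'}.
- by move=> w; reflexivity.
- by move=> w w' _ IH; symmetry.
(* Transitivity of fractions needs cancellation, here of the denominator of the middle word. *)
- move=> w1 w2 w3 _ IH1 _ IH2; apply: (@pcong_cat_inj (zpow (neg_count w2))).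
  rewrite !catA -!zpowD addnC zpowD -catA IH1 catA -zpowD addnC zpowD -catA IH2.
  by rewrite !catA -!zpowD addnC; reflexivity.
- move=> u u' w w' _ IH1 _ IH2.
  rewrite /neg_count !count_cat -!/(neg_count _) !zpowD !pos_part_cat.
  have H k l (x y : braid_word n) :
      pcong ((zpow k ++ zpow l) ++ pos_part x ++ pos_part y)
            ((zpow k ++ pos_part x) ++ (zpow l ++ pos_part y)).
    rewrite -!catA; apply: pcong_cat; first by reflexivity.
    by rewrite !catA zpow_comm ?pos_part_letters //; reflexivity.
  by rewrite !H IH1 IH2; reflexivity.
- move=> b j; rewrite /pos_part /neg_count /= cats0 addn0.
  have -> : (b + ~~ b = 1)%N by case: b.
  rewrite zpow1 cats0; case: b => /=.
    by rewrite zquot_r //; reflexivity.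
  by rewrite zquot_l //; reflexivity.
- move=> i j ij; rewrite /pos_part /neg_count /=.
  by apply: pcong_far; rewrite /far ij.
- move=> i j ij; rewrite /pos_part /neg_count /=.
  by apply: pcong_near; rewrite /near ij eqxx.
Qed.

(** Positive words are fractions with trivial denominator, so [braid_cong_pos] specializes to the
    embedding of the braid monoid in the braid group. *)
Lemma pos_elt_inj u v : all (gtn m) u -> all (gtn m) v ->
  pos_elt u = pos_elt v -> pcong u v.
Proof.
move=> um vm /braid_of_wordP /braid_cong_pos.
by rewrite !neg_count_lift !pos_part_lift.
Qed.

Definition positive (g : G) := exists2 u, all (gtn m) u & g = pos_elt u.

Lemma positive_elt u : positive (pos_elt u).
Proof.
exists [seq val i | i <- (pmap insub u : seq 'I_m)].
  by apply/allP => _ /mapP[i _ ->] /=; apply: ltn_ord.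
rewrite /pos_elt /lift_word; congr (braid_of_word (map _ _)).
elim: u => //= i u IH; case: insubP => //= j _ ji; rewrite insubT // => im.
by rewrite -IH; congr (_ :: _); apply: val_inj.
Qed.

Lemma positiveM g h : positive g -> positive h -> positive (g * h).
Proof. by move=> [u _ ->] [v _ ->]; rewrite -pos_elt_cat; apply: positive_elt. Qed.

Lemma zpow_central k g : pos_elt (zpow k) * g = g * pos_elt (zpow k).
Proof.
have H u : all (gtn m) u -> pos_elt (zpow k) * pos_elt u = pos_elt u * pos_elt (zpow k).
  move=> um; rewrite -!pos_elt_cat; symmetry; apply: pos_elt_pcong.
    by rewrite all_cat um zpow_letters.
  exact: zpow_comm.
rewrite -[g]braid_ofK; elim: (repr g) => [|x w IH]; first by rewrite mulg1 mul1g.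
rewrite -cat1s braid_of_catg mulgA.
suff -> : pos_elt (zpow k) * (braid_of_word [:: x] : G) =
          (braid_of_word [:: x] : G) * pos_elt (zpow k) by rewrite -!mulgA IH.
case: x => b j.
have Hj : pos_elt (zpow k) * (braid_of_word [:: (false, j)] : G) =
          (braid_of_word [:: (false, j)] : G) * pos_elt (zpow k).
  by rewrite -pos_elt1 H //= ltn_ord.
case: b => //; rewrite braid_of_inv.
by apply: (mulgI (braid_of_word [:: (false, j)] : G)); rewrite !mulgA -Hj mulgK mulgV mul1g.
Qed.

Lemma zpow_positive g : exists k, positive (pos_elt (zpow k) * g).
Proof.
rewrite -[g]braid_ofK; elim: (repr g) => [|[b j] w [k IH]].
  by exists 0%N; rewrite mulg1; apply: positive_elt.
exists (b + k)%N; rewrite -cat1s braid_of_catg.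
rewrite zpowD pos_elt_cat mulgA -(mulgA (pos_elt (zpow b))) (zpow_central k).
rewrite (mulgA (pos_elt (zpow b))) -mulgA; apply: positiveM => //.
case: b => /=; last by rewrite mul1g -pos_elt1; apply: positive_elt.
rewrite zpow1 -(pos_elt_pcong _ (zquot_r (ltn_ord j))); last first.
  by rewrite all_cat zquot_letters //= ltn_ord.
by rewrite pos_elt_cat -mulgA pos_elt1 braid_of_inv mulgV mulg1; apply: positive_elt.
Qed.

Lemma zpow_positive_le k l g : (k <= l)%N ->
  positive (pos_elt (zpow k) * g) -> positive (pos_elt (zpow l) * g).
Proof.
move=> kl H; rewrite -(subnK kl) zpowD pos_elt_cat -mulgA.
by apply: positiveM => //; apply: positive_elt.
Qed.

(** The exponent sum, a homomorphism to the integers that extends the length of positive words. *)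
Definition word_len (w : braid_word n) : int :=
  ((size w)%:Z - (2 * neg_count w)%N%:Z)%R.

Lemma word_len_cong w w' : braid_cong w w' -> word_len w = word_len w'.
Proof.
elim=> {w w'} //; rewrite /word_len /neg_count.
- by move=> w1 w2 w3 _ -> _ ->.
- by move=> u u' w w' _ H _ H'; rewrite !size_cat !count_cat; lia.
- by case.
Qed.

Definition braid_len (g : G) : int := word_len (repr g).

Lemma braid_lenM g h : braid_len (g * h) = (braid_len g + braid_len h)%R.
Proof.
rewrite /braid_len (word_len_cong (repr_braid_of _)).
by rewrite /word_len /neg_count size_cat count_cat; lia.
Qed.

Lemma braid_len_elt u : all (gtn m) u -> braid_len (pos_elt u) = Posz (size u).
Proof.
move=> um; rewrite /braid_len (word_len_cong (repr_braid_of _)) /word_len.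
rewrite neg_count_lift subr0 size_map.
by elim: u um => //= i u IH /andP[im um]; rewrite insubT /= -[in RHS]add1n PoszD -IH.
Qed.

Lemma braid_lenV g : braid_len g^-1 = (- braid_len g)%R.
Proof.
have := braid_lenM g g^-1; rewrite mulgV (_ : braid_len 1 = 0%R); first by lia.
exact: (@braid_len_elt [::]).
Qed.

Lemma braid_len_ge0 g : positive g -> (0 <= braid_len g)%R.
Proof. by move=> [u um ->]; rewrite braid_len_elt. Qed.

(** * Left divisibility in the positive monoid *)

Definition dvdw u (g : G) := positive ((pos_elt u)^-1 * g).

Lemma dvdw0 g : positive g -> dvdw [::] g.
Proof. by rewrite /dvdw pos_elt0 invg1 mul1g. Qed.

Lemma dvdw_prefix u v g : dvdw (u ++ v) g -> dvdw u g.
Proof.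
rewrite /dvdw pos_elt_cat invgM -mulgA => H.
rewrite -(mulVKg (pos_elt v) (_ * g)); apply: positiveM => //.
exact: positive_elt.
Qed.

(** As [z] and the quotient are positive, divisibility is an equality [i u = j v] of positive words
    with [v] a word for [z]; Garside's lemma then makes [compl j i] a prefix of [v]. The same holds
    for [dvdw_near]. *)
Lemma dvdw_far i j z : i < m -> j < m -> far i j -> positive z ->
  dvdw [:: i] (pos_elt [:: j] * z) -> dvdw [:: i] z.
Proof.
move=> im jm ij [v vm ->] [u um] /(canRL (mulVKg _)).
rewrite -!pos_elt_cat => /pos_elt_inj; rewrite /= im jm um vm => /(_ isT isT).
move=> /pcong_lcm [w []]; rewrite compl_far 1?farC //.
move=> Hv _; rewrite /dvdw (pos_elt_pcong vm Hv) pos_elt_cat mulKg.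
exact: positive_elt.
Qed.

Lemma dvdw_near i j z : i < m -> j < m -> near i j -> positive z ->
  dvdw [:: i] (pos_elt [:: j] * z) -> dvdw [:: i; j] z.
Proof.
move=> im jm ij [v vm ->] [u um] /(canRL (mulVKg _)).
rewrite -!pos_elt_cat => /pos_elt_inj; rewrite /= im jm um vm => /(_ isT isT).
move=> /pcong_lcm [w []]; rewrite compl_near 1?nearC //.
move=> Hv _; rewrite /dvdw (pos_elt_pcong vm Hv) (pos_elt_cat [:: i; j] w) mulKg.
exact: positive_elt.
Qed.

Lemma pos_elt_comm u v : all (gtn m) u -> all (gtn m) v ->
  (forall i j, i \in u -> j \in v -> far i j) ->
  pos_elt u * pos_elt v = pos_elt v * pos_elt u.
Proof.
move=> um vm uv; rewrite -!pos_elt_cat; apply: pos_elt_pcong.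
  by rewrite all_cat um vm.
exact: pcong_comm.
Qed.

Lemma dvdw_far_word i u z : i < m -> all (gtn m) u ->
  (forall j, j \in u -> far i j) -> positive z ->
  dvdw [:: i] (pos_elt u * z) -> dvdw [:: i] z.
Proof.
elim: u => [|j u IH] im; first by rewrite mul1g.
move=> /= /andP[jm um] iu pz; rewrite pos_elt_cons -mulgA => H.
apply: IH => //; first by move=> k ku; apply: iu; rewrite inE ku orbT.
apply: dvdw_far H => //; first by apply: iu; rewrite mem_head.
by apply: positiveM => //; apply: positive_elt.
Qed.

Lemma dvdw_word_far u j z : all (gtn m) u -> j < m ->
  (forall i, i \in u -> far i j) -> positive z ->
  dvdw u (pos_elt [:: j] * z) -> dvdw u z.
Proof.
elim: u z => [|i u IH] z; first by move=> _ _ _ pz _; apply: dvdw0.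
move=> /= /andP[im um] jm iu pz H.
have iuj k : k \in u -> far k j by move=> ku; apply: iu; rewrite inE ku orbT.
have ij : far i j by apply: iu; rewrite mem_head.
have Hz : dvdw [:: i] z by apply: (dvdw_far im jm ij pz); apply: (dvdw_prefix (v := u)).
rewrite /dvdw pos_elt_cons invgM -mulgA; apply: IH => //.
move: H; rewrite /dvdw pos_elt_cons invgM -mulgA; congr (positive (_ * _)).
apply: (mulgI (pos_elt [:: i])); rewrite mulVKg !mulgA; congr (_ * z).
by rewrite -(pos_elt_comm (u := [:: j])) ?mulgK //= ?im ?jm // => a b; rewrite !inE
  => /eqP -> /eqP ->; rewrite farC.
Qed.

(** The prefix [pre] serves the induction: [dvdw_near] trades the first letter of [top k a 1] for
    one more letter of the divisor, once that letter has been moved past the far letters of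
    [pre]. *)
Lemma dvdw_top k a pre z : all (gtn m) pre -> k + a < m ->
  (forall j, j \in pre -> k + a < j) -> positive z ->
  dvdw (pre ++ [:: k + a]%N) (pos_elt (top k a 1) * z) ->
  dvdw (pre ++ top k a.+1 1) z.
Proof.
elim: a pre => [|a IH] pre prem kam pl pz; first by rewrite mul1g.
rewrite [top k a.+2 1]/= [top k a.+1 1]/= => H.
have pz' : positive (pos_elt (top k a 1) * z).
  by apply: positiveM => //; apply: positive_elt.
rewrite -[_ :: _]/([:: k + a.+1]%N ++ top k a.+1 1) catA; apply: IH => //.
- by rewrite all_cat prem /= kam.
- by lia.
- by move=> j; rewrite mem_cat inE => /orP[/pl|/eqP ->]; lia.
move: H; rewrite pos_elt_cons -mulgA -catA => H.
have Hpre : dvdw pre (pos_elt (top k a 1) * z).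
  apply: dvdw_word_far (dvdw_prefix H) => //; first by lia.
  by move=> i /pl; rewrite /far; lia.
rewrite /dvdw pos_elt_cat invgM -mulgA; apply: dvdw_near => //; first by lia.
  by rewrite /near; lia.
move: H; rewrite /dvdw pos_elt_cat invgM -mulgA; congr (positive (_ * _)).
apply: (mulgI (pos_elt pre)); rewrite mulVKg !mulgA; congr (_ * z).
rewrite (pos_elt_comm (u := pre)) ?mulgK //= ?andbT; first by lia.
by move=> i j /pl Hi; rewrite inE /far => /eqP ->; lia.
Qed.

(** The half twist is the least common multiple of its letters. Write
    [y = delta k a * top k a 1 * z]: the new letter [k + a] is far from the letters of [delta k a],
    so it divides [top k a 1 * z], and by [dvdw_top] the missing factor [top k a.+1 1] divides
    [z]. *)
Lemma dvdw_delta k a y : k + a <= m -> positive y ->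
  (forall s, s \in iota k a -> dvdw [:: s] y) -> dvdw (delta k a.+1) y.
Proof.
elim: a => [|a IH] kam py H; first exact: dvdw0.
have Hy : dvdw (delta k a.+1) y.
  by apply: IH => // [|s]; [lia|rewrite mem_iota => sk; apply: H; rewrite mem_iota; lia].
have Hs : dvdw [:: k + a]%N y by apply: H; rewrite mem_iota; lia.
rewrite deltaS /dvdw pos_elt_cat invgM -mulgA.
apply: (dvdw_top (pre := [::])) => //; first by lia.
have dm : all (gtn m) (delta k a) by apply/allP => j /delta_letters /=; lia.
have tm : all (gtn m) (top k a 1) by apply/allP => j /top_letters /=; lia.
apply: (dvdw_far_word (u := delta k a)) => //; first by lia.
- by move=> j /delta_letters; rewrite /far; lia.
- by apply: positiveM => //; apply: positive_elt.
by rewrite mulgA -pos_elt_cat -deltaS mulVKg.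
Qed.

Lemma dvdw_cell k c y : k + wt c <= m.+1 -> positive y ->
  (forall s, s \in inner k c -> dvdw [:: s] y) -> dvdw (cell_delta k c) y.
Proof.
elim: c k y => [|a c IH] k y km py H; first exact: dvdw0.
rewrite wt_cons in km.
have Hy : dvdw (delta k a.+1) y.
  by apply: dvdw_delta => // [|s sk]; [lia|apply: H; rewrite /= mem_cat sk].
rewrite cell_deltaS /dvdw pos_elt_cat invgM -mulgA; apply: IH => //; first by lia.
move=> s sk; have sk' := inner_letters sk.
have dm : all (gtn m) (delta k a.+1) by apply/allP => j /delta_letters /=; lia.
apply: (dvdw_far_word (u := delta k a.+1)) => //; first by lia.
  by move=> j /delta_letters; rewrite /far; lia.
by rewrite mulVKg; apply: H; rewrite /= mem_cat sk orbT.
Qed.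

Lemma dvdw_inner k c y s : k + wt c <= m.+1 -> s \in inner k c ->
  dvdw (cell_delta k c) y -> dvdw [:: s] y.
Proof.
move=> km /cell_delta_inner[w E]; rewrite /dvdw.
have cm : all (gtn m) (cell_delta k c).
  by apply/allP => j /cell_delta_letters /=; lia.
rewrite -(pos_elt_pcong _ E) ?(pcong_all _ E) //.
exact: (@dvdw_prefix [:: s] w).
Qed.

End PositiveWords.

(** * Shuffles and the cobar differential *)

Local Open Scope ring_scope.

Lemma shuffles_shift s k a b :
  shuffles (s + k) a b = map (map (addn s)) (shuffles k a b).
Proof.
elim: a b => [|a IHa] // b; elim: b => [|b IHb] //.
rewrite !shufflesSS map_cat -IHb IHa -!map_comp; congr (_ ++ _).
by apply: eq_map => w; rewrite [RHS]map_cat -iotaDl addnA.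
Qed.

Record braid_ops (A : zmodType) := BraidOps {
  op :> nat -> A -> A;
  op_is_zmod_morphism : forall i, zmod_morphism (op i);
  op_far : forall i j v, far i j -> op i (op j v) = op j (op i v);
  op_near : forall i j v, near i j -> op i (op j (op i v)) = op j (op i (op j v))
}.

Section Operators.
Variables (A : zmodType) (X : braid_ops A).

HB.instance Definition _ i :=
  GRing.isZmodMorphism.Build A A (X i) (@op_is_zmod_morphism A X i).

Definition word_act (w : seq nat) (v : A) : A := foldr X v w.

Lemma word_act_cat u w v : word_act (u ++ w) v = word_act u (word_act w v).
Proof. exact: foldr_cat. Qed.

Lemma word_act_is_zmod_morphism w : zmod_morphism (word_act w).
Proof. by move=> u v; elim: w => //= i w ->; rewrite raddfB. Qed.

HB.instance Definition _ w :=
  GRing.isZmodMorphism.Build A A (word_act w) (word_act_is_zmod_morphism w).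

Lemma word_actB w u v : word_act w (u - v) = word_act w u - word_act w v.
Proof. exact: raddfB. Qed.

Lemma word_act_sum w (I : Type) (r : seq I) (F : I -> A) :
  word_act w (\sum_(i <- r) F i) = \sum_(i <- r) word_act w (F i).
Proof. exact: raddf_sum. Qed.

Lemma word_act_pcong u w v : pcong u w -> word_act u v = word_act w v.
Proof.
elim=> // a b l r y lr _ <-; rewrite !word_act_cat; congr (word_act a _).
by case: lr => i j ij; [apply: op_far|apply: op_near].
Qed.

Definition sh k a b (v : A) : A := \sum_(w <- shuffles k a b) word_act w v.

Lemma sh_is_zmod_morphism k a b : zmod_morphism (sh k a b).
Proof.
by move=> u v; rewrite /sh -sumrB; apply: eq_bigr => w _; rewrite raddfB.
Qed.

HB.instance Definition _ k a b :=
  GRing.isZmodMorphism.Build A A (sh k a b) (sh_is_zmod_morphism k a b).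

Lemma shB k a b u v : sh k a b (u - v) = sh k a b u - sh k a b v.
Proof. exact: raddfB. Qed.

Lemma shD k a b u v : sh k a b (u + v) = sh k a b u + sh k a b v.
Proof. exact: raddfD. Qed.

Lemma sh0b k b v : sh k 0 b v = v.
Proof. by rewrite /sh big_seq1. Qed.

Lemma sha0 k a v : sh k a 0 v = v.
Proof. by rewrite /sh shufflesa0 big_seq1. Qed.

Lemma shSS k a b v : sh k a.+1 b.+1 v =
  sh k a.+1 b v + word_act (iota (k + a) b.+1) (sh k a b.+1 v).
Proof.
rewrite /sh shufflesSS big_cat big_map word_act_sum; congr (_ + _).
by apply: eq_bigr => w _; rewrite word_act_cat.
Qed.

Lemma sh_xw_far k a b w v :
  (forall j, j \in w -> (j.+1 < k)%N || (k + a + b <= j)%N) ->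
  sh k a b (word_act w v) = word_act w (sh k a b v).
Proof.
move=> H; rewrite /sh word_act_sum; apply: eq_big_seq => u uk.
rewrite -!word_act_cat; apply: word_act_pcong; apply: pcong_comm => i j iu /H.
by have := shuffles_letters uk iu; rewrite /far; lia.
Qed.

Lemma sh_shift k a b v : (0 < a + b)%N ->
  sh k.+1 a b (word_act (iota k (a + b)) v) = word_act (iota k (a + b)) (sh k a b v).
Proof.
move=> ab; rewrite /sh word_act_sum -add1n shuffles_shift big_map.
apply: eq_big_seq => u uk; rewrite -!word_act_cat; apply: word_act_pcong.
have := @pcong_shift k (a + b) u [::]; rewrite !cats0; apply=> j ju.
by have := shuffles_letters uk ju; lia.
Qed.

(** Coassociativity of the quantum shuffle coproduct. Pascal's rule splits both sides into three
    terms according to the block that provides the last strand, and the terms agree by induction on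
    the number of strands. *)
Lemma sh_coassoc k a b c v :
  sh k a b (sh k (a + b) c v) = sh (k + a) b c (sh k a (b + c) v).
Proof.
have [N le_N] := ubnP (a + b + c); elim: N => // N IH in a b c v le_N *.
case: a le_N => [|a] le_N; first by rewrite !sh0b addn0.
case: b le_N => [|b] le_N; first by rewrite sha0 sh0b addn0.
case: c le_N => [|c] le_N; first by rewrite !sha0 addn0.
have e1 := IH a.+1 b.+1 c v (ltac:(lia)).
have e2 := IH a.+1 b c.+1 v (ltac:(lia)).
have e3 := IH a b.+1 c.+1 v (ltac:(lia)).
have l1 : sh k a.+1 b.+1 (sh k (a.+1 + b.+1) c.+1 v) =
    sh k a.+1 b.+1 (sh k (a.+1 + b.+1) c v) +
    (word_act (iota (k + (a + b.+1)) c.+1) (sh k a.+1 b (sh k (a.+1 + b) c.+1 v)) +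
     word_act (iota (k + a) (b.+1 + c.+1)) (sh k a b.+1 (sh k (a + b.+1) c.+1 v))).
  rewrite [sh k (_ + _) c.+1 v](shSS k (a + b.+1)) shD; congr (_ + _).
  rewrite shSS sh_xw_far; last by move=> j; rewrite mem_iota; lia.
  rewrite sh_xw_far; last by move=> j; rewrite mem_iota; lia.
  by rewrite -word_act_cat [(k + (a + b.+1))%N]addnA -iotaD -(addnA k) (addSnnS a b).
have l2 : sh (k + a.+1) b.+1 c.+1 (sh k a.+1 (b.+1 + c.+1) v) =
    sh (k + a.+1) b.+1 c (sh k a.+1 (b.+1 + c) v) +
    (word_act (iota (k + (a + b.+1)) c.+1)
        (sh (k + a.+1) b c.+1 (sh k a.+1 (b + c.+1) v)) +
     word_act (iota (k + a) (b.+1 + c.+1)) (sh (k + a) b.+1 c.+1 (sh k a (b.+1 + c.+1) v))).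
  rewrite [sh k a.+1 _ v](shSS k a (b + c.+1)) shD addrA; congr (_ + _).
    rewrite shSS -(addSnnS b c) (_ : k + a.+1 + b = k + (a + b.+1))%N //; lia.
  by rewrite addnS sh_shift.
by rewrite l1 l2 e1 e2 e3.
Qed.

(** Cochains are functions on all sequences, but only compositions of the same weight as [c] with
    one part fewer are evaluated. Parts are stored as predecessors, so [(a + b).+1] stands for
    [a.+1 + b.+1]; [k] counts the strands before [c]. *)
Fixpoint cobar_d k c (f : seq nat -> A) : A :=
  if c is a :: c1 then
    if c1 is b :: c2 then
      sh k a.+1 b.+1 (f ((a + b).+1 :: c2)) - cobar_d (k + a.+1) c1 (f \o cons a)
    else 0
  else 0.

Lemma cobar_dE k a b c f : cobar_d k [:: a, b & c] f =
  sh k a.+1 b.+1 (f ((a + b).+1 :: c)) - cobar_d (k + a.+1) (b :: c) (f \o cons a).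
Proof. by []. Qed.

Lemma eq_cobar_d k c f g :
  (forall e, (size e).+1 = size c -> wt e = wt c -> f e = g e) ->
  cobar_d k c f = cobar_d k c g.
Proof.
elim: c k f g => [|a [|b c] IH] // k f g fg; rewrite !cobar_dE; congr (sh _ _ _ _ - _).
  by apply: fg; rewrite // !wt_cons; lia.
by apply: IH => e se we; apply: fg; rewrite /= ?se // !wt_cons we wt_cons.
Qed.

Lemma cobar_d0 k c f : (forall e, (size e).+1 = size c -> wt e = wt c -> f e = 0) ->
  cobar_d k c f = 0.
Proof.
move=> f0; rewrite (@eq_cobar_d _ _ _ (fun=> 0)) //.
by elim: c k {f0} => [|a [|b c] IH] // k; rewrite cobar_dE raddf0 sub0r IH oppr0.
Qed.

Lemma cobar_dB k c f g : cobar_d k c (fun e => f e - g e) = cobar_d k c f - cobar_d k c g.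
Proof.
elim: c k f g => [|a [|b c] IH] k f g; try by rewrite /= subr0.
rewrite !cobar_dE shB (IH _ (f \o cons a) (g \o cons a)).
by rewrite !opprB addrACA [RHS]addrACA [X in _ + X = _]addrC.
Qed.

Lemma cobar_dN k c f : cobar_d k c (fun e => - f e) = - cobar_d k c f.
Proof.
rewrite -[RHS]sub0r -(@cobar_d0 k c (fun=> 0)) // -cobar_dB.
by apply: eq_cobar_d => e _ _; rewrite sub0r.
Qed.

Lemma cobar_dD k c f g : cobar_d k c (fun e => f e + g e) = cobar_d k c f + cobar_d k c g.
Proof.
rewrite -[cobar_d k c g]opprK -cobar_dN -cobar_dB.
by apply: eq_cobar_d => e _ _; rewrite opprK.
Qed.

Lemma cobar_d_sum k c (I : Type) (r : seq I) (P : pred I) (F : I -> seq nat -> A) :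
  cobar_d k c (fun e => \sum_(i <- r | P i) F i e) = \sum_(i <- r | P i) cobar_d k c (F i).
Proof.
elim: r => [|i r IH]; first by rewrite big_nil cobar_d0 // => e _ _; rewrite big_nil.
rewrite big_cons -IH; case: ifP => Pi; last first.
  by apply: eq_cobar_d => e _ _; rewrite big_cons Pi.
by rewrite -cobar_dD; apply: eq_cobar_d => e _ _; rewrite big_cons Pi.
Qed.

Lemma cobar_d_mulrz k c f z : cobar_d k c (fun e => f e *~ z) = cobar_d k c f *~ z.
Proof.
have Dn f' i : cobar_d k c (fun e => f' e *+ i) = cobar_d k c f' *+ i.
  elim: i => [|i IH]; first by rewrite cobar_d0 // => e _ _; rewrite mulr0n.
  by rewrite mulrS -IH -cobar_dD; apply: eq_cobar_d => e _ _; rewrite mulrS.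
case: z => i; first exact: Dn.
by rewrite NegzE mulrNz -pmulrn -Dn -cobar_dN; apply: eq_cobar_d => e _ _; rewrite mulrNz -pmulrn.
Qed.

(** Each merge takes place within [rcons c1 b] or within [b :: c2]. The part [b] occurs in both, as
    it can merge to either side. *)
Lemma cobar_d_split k c1 b c2 f :
  cobar_d k (c1 ++ b :: c2) f = cobar_d k (rcons c1 b) (fun e => f (e ++ c2)) +
    cobar_d (k + wt c1) (b :: c2) (fun e => f (c1 ++ e)) *~ (-1) ^+ size c1.
Proof.
elim: c1 k f => [|a c1 IH] k f.
  by rewrite [cobar_d k (rcons _ _) _]/= add0r /wt addn0 mulr1z.
have H l : rcons (a :: c1) b ++ l = a :: rcons c1 b ++ l by [].
have {IH} IH := IH (k + a.+1)%N (f \o cons a).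
rewrite exprS mulN1r mulrNz wt_cons addnA.
case: c1 H IH => [|a' c1] H IH.
  by rewrite [_ ++ _]/= !cobar_dE IH [cobar_d _ (rcons _ _) _]/= add0r subr0.
rewrite -[rcons _ b]/[:: a, a' & rcons c1 b].
rewrite -[_ ++ b :: c2]/[:: a, a' & c1 ++ b :: c2] !cobar_dE.
rewrite -[a' :: c1 ++ _]/((a' :: c1) ++ b :: c2) IH opprD addrA.
by rewrite -cat_rcons.
Qed.

Lemma cobar_d_far_word_act k c w f :
  (forall j, j \in w -> (j.+1 < k)%N || (k + wt c <= j)%N) ->
  cobar_d k c (fun e => word_act w (f e)) = word_act w (cobar_d k c f).
Proof.
elim: c k f => [|a [|b c] IH] // k f H; rewrite ?raddf0 //.
rewrite !cobar_dE word_actB; congr (_ - _).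
  by rewrite sh_xw_far // => j /H; rewrite !wt_cons; lia.
by apply: (IH _ (f \o cons a)) => j /H; rewrite !wt_cons; lia.
Qed.

Lemma cobar_d_sh k a b k' c f : (k + a + b <= k')%N ->
  cobar_d k' c (fun e => sh k a b (f e)) = sh k a b (cobar_d k' c f).
Proof.
move=> kk'; rewrite cobar_d_sum; apply: eq_big_seq => w wk.
by apply: cobar_d_far_word_act => j /(shuffles_letters wk); lia.
Qed.

(** Merges of disjoint pairs act by far letters and cancel by sign; overlapping pairs cancel by
    coassociativity. *)
Lemma cobar_dK k c f : cobar_d k c (fun e => cobar_d k e f) = 0.
Proof.
elim: c k f => [|a [|b c] IH] // k f; rewrite cobar_dE.
case: c IH => [|b2 c] IH; first by rewrite [cobar_d k _ f]/= raddf0 [cobar_d _ _ _]/= subr0.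
have E : cobar_d (k + a.+1) [:: b, b2 & c] ((fun e => cobar_d k e f) \o cons a) =
    cobar_d (k + a.+1) [:: b, b2 & c] (fun e =>
      sh k a.+1 (head 0%N e).+1 (f ((a + head 0%N e).+1 :: behead e)) -
      cobar_d (k + a.+1) e (f \o cons a)).
  apply: eq_cobar_d => -[|x e] //= se _; rewrite cobar_dE //.
rewrite E cobar_dB IH subr0 cobar_dE [cobar_d (k + a.+1) _ _]cobar_dE.
rewrite shB [head _ _]/= [behead _]/=.
have -> : ((a + b).+1.+1 = a.+1 + b.+1)%N by lia.
have -> : ((b + b2).+1.+1 = b.+1 + b2.+1)%N by lia.
rewrite sh_coassoc.
have -> : ((a + b).+1 + b2 = a + (b + b2).+1)%N by lia.
have -> : (k + (a.+1 + b.+1) = k + a.+1 + b.+1)%N by lia.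
rewrite (@eq_cobar_d (k + a.+1 + b.+1) (b2 :: c) (_ \o cons b) (fun e =>
  sh k a.+1 b.+1 (f ((a + b).+1 :: e)))) //.
rewrite cobar_d_sh; last by lia.
exact: subrr.
Qed.
End Operators.

Section Naturality.
Variables (A B : zmodType) (X : braid_ops A) (Y : braid_ops B).
Variable phi : {additive A -> B}.

Lemma word_act_nat s w v : (forall j u, j \in w -> phi (X j u) = Y (s + j)%N (phi u)) ->
  phi (word_act X w v) = word_act Y (map (addn s) w) (phi v).
Proof.
elim: w => //= i w IH H; rewrite H ?mem_head // IH // => j u jw.
by apply: H; rewrite inE jw orbT.
Qed.

(** Compatibility is asked only for letters between strands of [c], so that the lemma also covers
    maps that see just a window of strands. *)
Lemma cobar_d_nat s k c f :
  (forall j v, (k <= j)%N -> (j.+1 < k + wt c)%N -> phi (X j v) = Y (s + j)%N (phi v)) ->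
  phi (cobar_d X k c f) = cobar_d Y (s + k) c (fun e => phi (f e)).
Proof.
elim: c k f => [|a [|b c] IH] k f H; rewrite ?raddf0 //.
rewrite !wt_cons in H.
rewrite !cobar_dE raddfB -addnA; congr (_ - _); last first.
  by apply: IH => j v kj jk; apply: H; rewrite wt_cons in jk; lia.
rewrite /sh raddf_sum shuffles_shift big_map; apply: eq_big_seq => w wk.
apply: word_act_nat => j u /(shuffles_letters wk) Hj; apply: H; lia.
Qed.

End Naturality.

(** * Group homology *)

Section MalgMaps.
Variables (J : choiceType) (A : zmodType).

Variables (B : zmodType) (h : J -> {additive A -> B}).

Definition msum (c : {malg A[J]}) : B := \sum_(j <- msupp c) h j c@_j.

Lemma msumEw (c : {malg A[J]}) (d : {fset J}) : (msupp c `<=` d)%fset ->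
  msum c = \sum_(j <- d) h j c@_j.
Proof.
move=> sub; rewrite /msum (big_fset_incl _ sub) // => j _ nj.
by rewrite (mcoeff_outdom nj) raddf0.
Qed.

Lemma msum_is_zmod_morphism : zmod_morphism msum.
Proof.
move=> x y; pose d := (msupp x `|` msupp y)%fset.
rewrite !(@msumEw _ d) ?fsubsetUl ?fsubsetUr ?msuppB_le //.
by rewrite -sumrB; apply: eq_bigr => j _; rewrite mcoeffB raddfB.
Qed.

HB.instance Definition _ :=
  GRing.isZmodMorphism.Build {malg A[J]} B msum msum_is_zmod_morphism.

Lemma msumU x j : msum << x *g j >> = h j x.
Proof. by rewrite (@msumEw _ _ msuppU_le) big_seq_fset1 mcoeffUU. Qed.

End MalgMaps.

Section Cmap.
Variables (J : choiceType) (A B : zmodType) (phi : {additive A -> B}).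

Definition cmap : {malg A[J]} -> {malg B[J]} := msum (fun j => mkmalgU j \o phi).

HB.instance Definition _ := GRing.Additive.copy cmap cmap.

Lemma cmapU x j : cmap << x *g j >> = << phi x *g j >>.
Proof. exact: msumU. Qed.

Lemma cmapE c j : (cmap c)@_j = phi c@_j.
Proof.
rewrite {2}[c]monalgE /cmap /msum !raddf_sum; apply: eq_bigr => k _ /=.
by rewrite !mcoeffU raddfMn.
Qed.
End Cmap.

Lemma malg_ind (J : choiceType) (A : zmodType) (P : {malg A[J]} -> Prop) :
  P 0 -> (forall c d, P c -> P d -> P (c + d)) ->
  (forall x j, P << x *g j >>) -> forall c, P c.
Proof.
move=> P0 PD PU c; rewrite [c]monalgE.
by elim/big_ind: _ => // j _; apply: PU.
Qed.

Fact bar_key : unit. Proof. exact: tt. Qed.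

Section BarMonomials.
Variables (G : groupType) (A : gmodule G).

Definition bmon i (t : i.-tuple G) : A -> bar_chain A i :=
  locked_with bar_key (mkmalgU t).

Definition bdiff i : bar_chain A i.+1 -> bar_chain A i :=
  locked_with bar_key (@bar_diff G A i).

Lemma bmonB i (t : i.-tuple G) : zmod_morphism (bmon t).
Proof. rewrite /bmon locked_withE; exact: (monalgUB t). Qed.

HB.instance Definition _ i (t : i.-tuple G) :=
  GRing.isZmodMorphism.Build A (bar_chain A i) (bmon t) (bmonB t).

Lemma bdiff_is_zmod_morphism i : zmod_morphism (@bdiff i).
Proof. rewrite /bdiff locked_withE; exact: raddfB. Qed.

HB.instance Definition _ i :=
  GRing.isZmodMorphism.Build (bar_chain A i.+1) (bar_chain A i) (@bdiff i)
    (@bdiff_is_zmod_morphism i).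

Lemma bar_ind i (P : bar_chain A i -> Prop) :
  P 0 -> (forall c d, P c -> P d -> P (c + d)) ->
  (forall t x, P (bmon t x)) -> forall c, P c.
Proof.
move=> P0 PD PU; apply: malg_ind => // x t.
by have := PU t x; rewrite /bmon locked_withE.
Qed.

Lemma bdiffU i (t : i.+1.-tuple G) (x : A) : bdiff (bmon t x) =
  \sum_(j < i.+2) bmon (bar_face j t) (bar_coef j t x) *~ (-1) ^+ j.
Proof.
rewrite /bmon /bdiff !locked_withE (bar_diffEw msuppU_le) big_seq_fset1.
by apply: eq_bigr => j _; rewrite locked_withE mcoeffUU.
Qed.

Lemma bdiff0 i : bdiff (0 : bar_chain A i.+1) = 0. Proof. exact: raddf0. Qed.
Lemma bdiffD i : {morph @bdiff i : c d / c + d}. Proof. exact: raddfD. Qed.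
Lemma bdiffB i : {morph @bdiff i : c d / c - d}. Proof. exact: raddfB. Qed.
Lemma bdiffMz i (c : bar_chain A i.+1) z : bdiff (c *~ z) = bdiff c *~ z.
Proof. exact: raddfMz. Qed.
Lemma bdiff_sum i (I : Type) (r : seq I) (F : I -> bar_chain A i.+1) :
  bdiff (\sum_(i <- r) F i) = \sum_(i <- r) bdiff (F i).
Proof. exact: raddf_sum. Qed.
End BarMonomials.

Section BarMap.
Variables (G : groupType) (A B : gmodule G) (phi : {additive A -> B}) (i : nat).

Definition bmap : bar_chain A i -> bar_chain B i :=
  locked_with bar_key (cmap phi).

Lemma bmapB : {morph bmap : c d / c - d}.
Proof. rewrite /bmap locked_withE; exact: raddfB. Qed.
HB.instance Definition _ :=
  GRing.isZmodMorphism.Build (bar_chain A i) (bar_chain B i) bmap bmapB.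
Lemma bmap0 : bmap 0 = 0. Proof. exact: raddf0. Qed.
Lemma bmapD : {morph bmap : c d / c + d}. Proof. exact: raddfD. Qed.
Lemma bmapMz c z : bmap (c *~ z) = bmap c *~ z. Proof. exact: raddfMz. Qed.
Lemma bmap_sum (I : Type) (r : seq I) (F : I -> bar_chain A i) :
  bmap (\sum_(i <- r) F i) = \sum_(i <- r) bmap (F i).
Proof. exact: raddf_sum. Qed.

Lemma bmapU t x : bmap (bmon t x) = bmon t (phi x).
Proof. rewrite /bmap /bmon !locked_withE; exact: cmapU. Qed.
End BarMap.

Definition equivariant (G : groupType) (A B : gmodule G) (phi : A -> B) :=
  forall g x, phi (gact g x) = gact g (phi x).

Lemma bdiff_bmap (G : groupType) (A B : gmodule G) (phi : {additive A -> B})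
    i (c : bar_chain A i.+1) :
  equivariant phi -> bdiff (bmap phi c) = bmap phi (bdiff c).
Proof.
move=> eqv; elim/bar_ind: c => [|c d IHc IHd|t x].
- by rewrite bmap0 !bdiff0 bmap0.
- by rewrite bmapD !bdiffD bmapD IHc IHd.
rewrite bmapU !bdiffU bmap_sum; apply: eq_bigr => j _.
rewrite bmapMz bmapU; have -> // : bar_coef j t (phi x) = phi (bar_coef j t x).
by rewrite /bar_coef; case: eqP => // _; rewrite eqv.
Qed.

(** * Induced modules and the kernel of the counit *)

Section Induced.
Variables (G : groupType) (A : gmodule G).

Definition ind_act (g : G) : {malg A[G]} -> {malg A[G]} :=
  msum (fun h => mkmalgU (g * h)%g).

HB.instance Definition _ g := GRing.Additive.copy (ind_act g) (ind_act g).

Lemma ind_actU g x h : ind_act g << x *g h >> = << x *g (g * h)%g >>.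
Proof. exact: msumU. Qed.

Lemma ind_act_is_zmod_morphism g : zmod_morphism (ind_act g).
Proof. by move=> x y; rewrite raddfB. Qed.

Lemma ind_act1 c : ind_act 1%g c = c.
Proof.
elim/malg_ind: c => [|c d IHc IHd|x h]; first by rewrite raddf0.
  by rewrite raddfD /= IHc IHd.
by rewrite ind_actU mul1g.
Qed.

Lemma ind_actM g h c : ind_act (g * h)%g c = ind_act g (ind_act h c).
Proof.
elim/malg_ind: c => [|c d IHc IHd|x k]; first by rewrite !raddf0.
  by rewrite !raddfD /= IHc IHd.
by rewrite !ind_actU mulgA.
Qed.

(** [Z[G] (x) A] with [G] acting on the first factor only. The counit sends [g (x) x] to [g x]; as a
    map of abelian groups it is split by [imon 1]. *)
Definition induced : gmodule G :=
  @GModule G {malg A[G]} ind_act ind_act_is_zmod_morphism ind_act1 ind_actM.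

Definition imon (g : G) : A -> induced := mkmalgU g.
HB.instance Definition _ g := GRing.Additive.copy (imon g) (mkmalgU g).

Lemma gact_imon g h x : gact g (imon h x) = imon (g * h)%g x.
Proof. exact: ind_actU. Qed.

Lemma ind_ind (Q : induced -> Prop) :
  Q 0 -> (forall c d, Q c -> Q d -> Q (c + d)) ->
  (forall x g, Q (imon g x)) -> forall c, Q c.
Proof. exact: malg_ind. Qed.

Lemma ind_actE g c h : (ind_act g c)@_h = c@_(g^-1 * h)%g.
Proof.
elim/malg_ind: c => [|c d IHc IHd|x k]; first by rewrite raddf0 !mcoeff0.
  by rewrite raddfD /= !mcoeffD IHc IHd.
rewrite ind_actU !mcoeffU; congr (x *+ nat_of_bool _).
by apply/eqP/eqP => [<-|->]; rewrite ?mulKg ?mulVKg.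
Qed.

Definition gact_add g : A -> A := gact g.
HB.instance Definition _ g :=
  GRing.isZmodMorphism.Build A A (gact_add g) (@gactB G A g).

Definition ind_counit : induced -> A := msum gact_add.
HB.instance Definition _ := GRing.Additive.copy ind_counit ind_counit.

Lemma ind_counitU x g : ind_counit (imon g x) = gact g x.
Proof. exact: msumU. Qed.

Lemma ind_counit_equivariant : equivariant ind_counit.
Proof.
move=> g c; elim/ind_ind: c => [|c d IHc IHd|x k].
- by rewrite !raddf0.
- by rewrite !raddfD /= IHc IHd.
by rewrite gact_imon !ind_counitU gactM.
Qed.

Definition ind_rmul (h : G) : induced -> induced :=
  msum (fun g => mkmalgU (g * h)%g).
HB.instance Definition _ h := GRing.Additive.copy (ind_rmul h) (ind_rmul h).

Lemma ind_rmulU x g h : ind_rmul h (imon g x) = imon (g * h)%g x.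
Proof. exact: msumU. Qed.

Lemma ind_rmul_equivariant h : equivariant (ind_rmul h).
Proof.
move=> g c; elim/ind_ind: c => [|c d IHc IHd|x k].
- by rewrite !raddf0.
- by rewrite !raddfD /= IHc IHd.
by rewrite gact_imon !ind_rmulU gact_imon mulgA.
Qed.

Definition ind_kernel : {pred induced} := fun c => ind_counit c == 0.

Lemma ind_kernelE c : (c \in ind_kernel) = (ind_counit c == 0).
Proof. by []. Qed.

Lemma ind_kernel_zmod_closed : zmod_closed ind_kernel.
Proof.
split=> [|x y]; rewrite !ind_kernelE; first by apply/eqP; exact: raddf0.
by rewrite raddfB /= => /eqP -> /eqP ->; rewrite subr0.
Qed.

HB.instance Definition _ := GRing.isZmodClosed.Build induced ind_kernel
  ind_kernel_zmod_closed.

Record ind_ker := IndKer { ind_ker_val : induced; _ : ind_ker_val \in ind_kernel }.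
HB.instance Definition _ := [isSub for ind_ker_val].
HB.instance Definition _ := [Choice of ind_ker by <:].
HB.instance Definition _ := [SubChoice_isSubZmodule of ind_ker by <:].

Lemma ind_ker_counit (x : ind_ker) : ind_counit (val x) = 0.
Proof. exact/eqP/(valP x). Qed.

Lemma ind_ker_subproof g (x : ind_ker) : gact g (val x) \in ind_kernel.
Proof.
apply/eqP; rewrite ind_counit_equivariant ind_ker_counit.
exact: (raddf0 (gact_add g)).
Qed.

Definition ker_act g (x : ind_ker) : ind_ker := IndKer (ind_ker_subproof g x).

Lemma ker_actB g : zmod_morphism (ker_act g).
Proof. by move=> x y; apply: val_inj; rewrite /= !raddfB. Qed.

Lemma ker_act1 x : ker_act 1%g x = x.
Proof. by apply: val_inj; apply: ind_act1. Qed.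

Lemma ker_actM g h x : ker_act (g * h)%g x = ker_act g (ker_act h x).
Proof. by apply: val_inj; apply: ind_actM. Qed.

Definition kernel_module : gmodule G := GModule ker_actB ker_act1 ker_actM.

Definition ker_incl : kernel_module -> induced := val.
HB.instance Definition _ := GRing.Additive.copy ker_incl (val : ind_ker -> induced).

Lemma ker_incl_equivariant : equivariant ker_incl.
Proof. by []. Qed.
End Induced.

Section Faces.
Variable G : groupType.
Local Open Scope group_scope.

Lemma eq_tuple_nth n (s t : n.-tuple G) :
  (forall k, (k < n)%N -> nth 1 s k = nth 1 t k) -> s = t.
Proof. by move=> st; apply: eq_from_tnth => k; rewrite !(tnth_nth 1) st. Qed.

Lemma nth_bar_face i (j : 'I_i.+2) (t : i.+1.-tuple G) k : (k < i)%N ->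
  nth 1 (bar_face j t) k = if (k.+1 < j)%N then nth 1 t k
    else if k.+1 == j :> nat then nth 1 t k * nth 1 t k.+1 else nth 1 t k.+1.
Proof.
move=> ki; rewrite -[k]/(val (Ordinal ki)) -tnth_nth tnth_mktuple.
by rewrite !(tnth_nth 1) lift0.
Qed.

Lemma bar_face_rcons i (t : i.+1.-tuple G) g (j : 'I_i.+2) :
  bar_face (widen_ord (leqnSn _) j) [tuple of rcons t g] =
  [tuple of rcons (bar_face j t) (if j == ord_max then tnth t ord_max * g else g)].
Proof.
apply: eq_tuple_nth => k ki; rewrite nth_bar_face //= !nth_rcons !size_tuple card_ord ki ltnS.
case: (ltnP k i) => [ki'|ik]; first by rewrite nth_bar_face.
have {ik}ki : k = i by lia.
rewrite ki !eqxx -(inj_eq val_inj) /= (tnth_nth 1) /= [i.+1 == j]eq_sym.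
by have -> : (i.+1 < j)%N = false by have := ltn_ord j; lia.
Qed.

Lemma tnth_rcons_max i (t : i.-tuple G) g : tnth [tuple of rcons t g] ord_max = g.
Proof. by rewrite (tnth_nth 1) /= nth_rcons size_tuple ltnn eqxx. Qed.

Lemma bar_face_rcons_max i (t : i.+1.-tuple G) g :
  bar_face ord_max [tuple of rcons t g] = t.
Proof.
apply: eq_tuple_nth => k ki; rewrite nth_bar_face //= !nth_rcons size_tuple ki ltnS.
by rewrite ki.
Qed.
End Faces.

Section Contraction.
Variables (G : groupType) (A : gmodule G).
Local Notation P := (induced A).

Lemma ind_bar_ind i (Q : bar_chain P i -> Prop) :
  Q 0 -> (forall c d, Q c -> Q d -> Q (c + d)) ->
  (forall t (x : A) g, Q (bmon t (imon g x))) -> forall c, Q c.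
Proof.
move=> Q0 QD QU; apply: bar_ind => // t x; elim/ind_ind: x => [|x y Qx Qy|x g].
- by rewrite raddf0.
- by rewrite raddfD; apply: QD.
exact: QU.
Qed.

(** The contraction stores the group element of the coefficient as a new last bar entry, [[t] (g (x)
    x)] becoming [[t | g] (1 (x) x)]; the last face restores it. *)
Definition bsec_fun i (t : i.-tuple G) : P -> bar_chain P i.+1 :=
  msum (fun g => bmon [tuple of rcons t g] \o imon 1%g).
HB.instance Definition _ i t := GRing.Additive.copy (@bsec_fun i t) (@bsec_fun i t).

Definition bsec i : bar_chain P i -> bar_chain P i.+1 :=
  locked_with bar_key (msum (@bsec_fun i)).

Lemma bsec_is_zmod_morphism i : {morph @bsec i : c d / c - d}.
Proof. rewrite /bsec locked_withE; exact: raddfB. Qed.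

HB.instance Definition _ i := GRing.isZmodMorphism.Build (bar_chain P i)
  (bar_chain P i.+1) (@bsec i) (@bsec_is_zmod_morphism i).

Lemma bsec0 i : bsec (0 : bar_chain P i) = 0. Proof. exact: raddf0. Qed.
Lemma bsecD i : {morph @bsec i : c d / c + d}. Proof. exact: raddfD. Qed.
Lemma bsecMz i (c : bar_chain P i) z : bsec (c *~ z) = bsec c *~ z.
Proof. exact: raddfMz. Qed.
Lemma bsec_sum i (I : Type) (r : seq I) (F : I -> bar_chain P i) :
  bsec (\sum_(i <- r) F i) = \sum_(i <- r) bsec (F i).
Proof. exact: raddf_sum. Qed.

Lemma bsecU i (t : i.-tuple G) (x : A) g : bsec (bmon t (imon g x)) =
  bmon [tuple of rcons t g] (imon 1%g x).
Proof.
rewrite /bsec {1}/bmon !locked_withE msumU.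
apply: etrans; first exact: msumU.
by rewrite /= /bmon locked_withE.
Qed.

Lemma gact1U (x : A) g : gact g (imon 1%g x) = imon g x.
Proof. by rewrite gact_imon mulg1. Qed.

Lemma bar_coef_max i (t : i.-tuple G) (x : A) g :
  bar_coef ord_max [tuple of rcons t g] (imon 1%g x) = imon g x.
Proof. by rewrite /bar_coef eqxx tnth_rcons_max gact1U. Qed.

Lemma bdiff_bsec i (c : bar_chain P i.+1) :
  bdiff (bsec c) = bsec (bdiff c) + c *~ (-1) ^+ i.+2.
Proof.
elim/ind_bar_ind: c => [|c d IHc IHd|t x g].
- by rewrite bsec0 !bdiff0 bsec0 mul0rz addr0.
- by rewrite bsecD !bdiffD bsecD IHc IHd mulrzDl addrACA.
rewrite bsecU !bdiffU big_ord_recr bar_face_rcons_max bar_coef_max.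
congr (_ + _); rewrite bsec_sum; apply: eq_bigr => j _.
rewrite bsecMz bar_face_rcons.
have -> : bar_coef (widen_ord (leqnSn i.+2) j) [tuple of rcons t g] (imon 1%g x)
    = imon 1%g x.
  rewrite /bar_coef -(inj_eq val_inj) /=.
  by have -> : (j == i.+2 :> nat) = false by have := ltn_ord j; lia.
rewrite /bar_coef; case: eqP => [_|_]; last by rewrite bsecU.
by rewrite gact_imon bsecU.
Qed.

Lemma bdiff_bsec0 (t : 0.-tuple G) (x : A) g :
  bdiff (bsec (bmon t (imon g x))) =
  bmon t (imon 1%g x) - bmon t (imon g x).
Proof.
rewrite bsecU bdiffU big_ord_recr big_ord1 expr0 expr1 mulr1z mulrN1z.
rewrite bar_coef_max; set c := bar_coef _ _ _; have {c}-> : c = imon 1%g x by [].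
by rewrite !(tuple0 (bar_face _ _)) (tuple0 t).
Qed.

Lemma ind_exact i (c : bar_chain P i.+1) : bdiff c = 0 -> exists b, bdiff b = c.
Proof.
move=> dc; exists (bsec c *~ (-1) ^+ i.+2).
rewrite bdiffMz bdiff_bsec dc raddf0 add0r -mulrzA -exprD addnn.
by rewrite -signr_odd odd_double mulr1z.
Qed.

End Contraction.

Lemma bdiff1 (G : groupType) (A : gmodule G) (t : 1.-tuple G) (x : A) :
  bdiff (bmon t x) = bmon [tuple] x - bmon [tuple] (gact (tnth t ord0) x).
Proof.
rewrite bdiffU big_ord_recr big_ord1 expr0 expr1 mulr1z mulrN1z.
set y := bar_coef _ _ _; have {y}-> : y = x by [].
set y := bar_coef _ _ _; have {y}-> : y = gact (tnth t ord0) x.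
  by rewrite /y /bar_coef eqxx; congr (gact (tnth t _) x); apply: val_inj.
by rewrite !(tuple0 (bar_face _ _)).
Qed.

Lemma telescope3 (V : zmodType) (a b c : V) : a - b - (a - c) + (b - c) = 0.
Proof.
by rewrite -addrA opprB [c - a + _]addrC addrA !subrKA subrr.
Qed.

Lemma tuple_rcons (T : Type) n (t : n.+1.-tuple T) :
  exists (t' : n.-tuple T) g, t = [tuple of rcons t' g].
Proof.
case: t => s; case/lastP: s => [//|s g] sP.
have sn : size s == n by move: sP; rewrite size_rcons.
by exists (Tuple sn), g; apply: val_inj.
Qed.

Section DifferentialSquare.
Variables (G : groupType) (A : gmodule G).
Local Notation P := (induced A).

(* Right translations act on the induced module and commute with the
   differential, so that it is enough to treat the values of the contraction. *)
Lemma ind_bdiff_bdiff_bsec i :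
  (forall t (x : A) g, bdiff (bdiff (bsec (bmon t (imon g x) : bar_chain P i.+1))) = 0) ->
  forall c : bar_chain P i.+2, bdiff (bdiff c) = 0.
Proof.
move=> H; elim/ind_bar_ind=> [|c d IHc IHd|t x g].
- by rewrite !bdiff0.
- by rewrite !bdiffD IHc IHd addr0.
have -> : bmon t (imon g x) = bmap (ind_rmul g) (bmon t (imon 1%g x)).
  by rewrite bmapU /= ind_rmulU mul1g.
have E := @ind_rmul_equivariant G A g; rewrite (bdiff_bmap _ E) (bdiff_bmap _ E).
by have [t' [h ->]] := tuple_rcons t; rewrite -bsecU H bmap0.
Qed.

(** For the contraction [s], the homotopy formula turns [d d s] into [s d d] plus two copies of [d]
    with opposite signs, and [s d d] vanishes by induction. *)
Lemma ind_bdiff_bdiff i (c : bar_chain P i.+2) : bdiff (bdiff c) = 0.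
Proof.
elim: i c => [|i IH]; apply: ind_bdiff_bdiff_bsec => t x g; rewrite bdiff_bsec bdiffD.
  rewrite bdiffMz bdiff1 gact_imon bsec_is_zmod_morphism bdiffB !bdiff_bsec0.
  by rewrite -signr_odd expr0 mulr1z telescope3.
rewrite bdiff_bsec IH bsec0 add0r bdiffMz -mulrzDr.
by rewrite [_ ^+ i.+3]exprS mulN1r subrr mulr0z.
Qed.

End DifferentialSquare.

(** * Dimension shifting in the bar complex *)

Section DimensionShift.
Variables (G : groupType) (A : gmodule G).
Local Notation P := (induced A).
Local Notation K := (kernel_module A).
Local Notation pr := (@ind_counit G A).
Local Notation incl := (@ker_incl G A).

Definition bar_exact (M : gmodule G) i := forall c : bar_chain M i.+1,
  bdiff c = 0 -> exists b, bdiff b = c.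

Lemma bmap_pr_imon i (c : bar_chain A i) : bmap pr (bmap (imon 1%g) c) = c.
Proof.
elim/bar_ind: c => [|c d IHc IHd|t x]; first by rewrite !bmap0.
  by rewrite !bmapD IHc IHd.
by rewrite !bmapU /= ind_counitU gact1.
Qed.

Lemma bmap_pr_incl i (c : bar_chain K i) : bmap pr (bmap incl c) = 0.
Proof.
elim/bar_ind: c => [|c d IHc IHd|t x]; first by rewrite !bmap0.
  by rewrite !bmapD IHc IHd addr0.
by rewrite !bmapU /= ind_ker_counit raddf0.
Qed.

Lemma bmap_incl_inj i (c d : bar_chain K i) : bmap incl c = bmap incl d -> c = d.
Proof.
rewrite /bmap !locked_withE => cd; apply/malgP => t; apply: val_inj.
exact: etrans (esym (cmapE incl c t)) (etrans (congr1 (mcoeff t) cd) (cmapE incl d t)).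
Qed.

Lemma bmap_incl_surj i (c : bar_chain P i) : bmap pr c = 0 ->
  exists k : bar_chain K i, bmap incl k = c.
Proof.
rewrite /bmap !locked_withE => /malgP c0.
have cK t : c@_t \in @ind_kernel G A.
  by rewrite ind_kernelE -(cmapE (@ind_counit G A) c t) c0 mcoeff0.
exists [malg t in msupp c => (IndKer (cK t) : K)].
apply/malgP => t; rewrite cmapE mcoeffE; case: ifP => // /negbT tc.
by rewrite raddf0 (mcoeff_outdom tc).
Qed.

(** From the long exact sequence of [K -> P -> A]: as [P] is acyclic in positive degrees, the
    homology of [A] in degree [i.+1] is the kernel of the map from that of [K] to that of [P] in
    degree [i]. This form includes [i = 0], where [P] does have homology. *)
Lemma bar_exact_shift i : bar_exact A i <->
  (forall k : bar_chain K i, (exists b : bar_chain P i.+1, bdiff b = bmap incl k) ->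
   exists b : bar_chain K i.+1, bdiff b = k).
Proof.
have Epr := @ind_counit_equivariant G A; have Ei := @ker_incl_equivariant G A.
split=> [exA k [b bk]|H c dc].
  have [|g gb] := exA (bmap pr b); first by rewrite (bdiff_bmap _ Epr) bk bmap_pr_incl.
  have [|b' b'E] := @bmap_incl_surj _ (b - bdiff (bmap (imon 1%g) g)).
    by rewrite bmapB -(bdiff_bmap _ Epr) bmap_pr_imon gb subrr.
  exists b'; apply: bmap_incl_inj; rewrite -(bdiff_bmap _ Ei) b'E bdiffB.
  by rewrite ind_bdiff_bdiff subr0.
pose b := bmap (imon 1%g) c : bar_chain P _.
have [|k kb] := @bmap_incl_surj _ (bdiff b).
  by rewrite -(bdiff_bmap _ Epr) bmap_pr_imon.
have [|b' b'k] := H k; first by exists b.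
have [|g gE] := @ind_exact G A _ (b - bmap incl b').
  by rewrite bdiffB (bdiff_bmap _ Ei) b'k kb subrr.
exists (bmap pr g); rewrite (bdiff_bmap _ Epr) gE bmapB bmap_pr_imon.
by rewrite bmap_pr_incl subr0.
Qed.

Lemma bar_exact_shiftS i : bar_exact A i.+1 <-> bar_exact K i.
Proof.
have Ei := @ker_incl_equivariant G A.
apply: iff_trans (bar_exact_shift _) _; split=> [H k dk|H k [b bk]].
  apply: H; apply: ind_exact; rewrite (bdiff_bmap _ Ei) dk bmap0 //.
apply: H; apply: bmap_incl_inj; rewrite -(bdiff_bmap _ Ei) -bk bmap0.
exact: ind_bdiff_bdiff.
Qed.
End DimensionShift.

Section Triviality.
Variables (G : groupType) (A : gmodule G).

Lemma trivial_homologyE i : trivial_zmod (group_homology A i) <->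
  forall c : bar_chain A i, c \in @is_cycle G A i -> exists b, bdiff b = c.
Proof.
rewrite /bdiff locked_withE; split=> [H c cc|H x].
  have : BarCycle cc - 0 \in @is_boundary G A i.
    rewrite Quotient.idealrBE; apply/eqP; rewrite [LHS]H.
    exact: (esym (H _)).
  by rewrite subr0 => /asboolP.
rewrite -[x]reprK -[RHS](raddf0 (\pi_{ideal_quot @is_boundary G A i}%qT)).
apply/eqP; rewrite -Quotient.idealrBE subr0; apply/asboolP.
by have [b] := H _ (valP (repr x)); exists b.
Qed.

Lemma trivial_homologyS i : trivial_zmod (group_homology A i.+1) <-> bar_exact A i.
Proof.
apply: iff_trans (trivial_homologyE _) _.
by split=> H c dc; apply: H; move: dc; rewrite /bdiff locked_withE => /eqP.
Qed.

Lemma trivial_homology0 : trivial_zmod (group_homology A 0) <->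
  forall c : bar_chain A 0, exists b, bdiff b = c.
Proof. by apply: iff_trans (trivial_homologyE _) _; split=> H c *; apply: H. Qed.
End Triviality.

(** * The cobar complex of a module over the braid group *)

Definition cobar_exact (A : zmodType) (X : braid_ops A) n p :=
  forall f : seq nat -> A,
    (forall c, size c = p.+1 -> wt c = n -> cobar_d X 0 c f = 0) ->
    exists g, forall c, size c = p -> wt c = n -> cobar_d X 0 c g = f c.

(** When [X j] is minus a generator, the quotient by these elements is the module of coinvariants,
    that is, homology in degree 0. *)
Definition coinv0 (A : zmodType) (X : braid_ops A) n (x : A) :=
  exists v : nat -> A, x = \sum_(j < n.-1) (v j + X j (v j)).

(** * The last cobar degree and coinvariants *)

Section Ones.
Variables (A : zmodType) (X : braid_ops A).

Definition bump_at j m : seq nat := nseq j 0%N ++ 1%N :: nseq (m - j.+1) 0%N.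

(** Two parts of size 1 have two shuffles, the identity and one crossing. *)
Lemma cobar_d_ones k m b : cobar_d X k (nseq m.+1 0%N) b =
  \sum_(j < m) (b (bump_at j m) + X (k + j)%N (b (bump_at j m))) *~ (-1) ^+ j.
Proof.
elim: m k b => [|m IH] k b; first by rewrite big_ord0.
rewrite [nseq _ _]/= cobar_dE -[0%N :: nseq m _]/(nseq m.+1 0%N) IH big_ord_recl.
congr (_ + _).
  by rewrite expr0 mulr1z shSS sha0 sh0b addn0 /= addn0 /bump_at subn1.
rewrite -sumrN; apply: eq_bigr => j _.
by rewrite lift0 exprS mulN1r mulrNz /bump_at subSS addn1 addSnnS.
Qed.

Lemma coinv0P n x : (0 < n)%N ->
  (exists b, cobar_d X 0 (nseq n 0%N) b = x) <-> coinv0 X n x.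
Proof.
case: n => // n _; split=> [[b <-]|[v ->]].
  exists (fun j => b (bump_at j n) *~ (-1) ^+ j); rewrite cobar_d_ones.
  by apply: eq_bigr => j _; rewrite mulrzDl raddfMz.
(* The compositions that occur have a single part of size 2, encoded by 1, and its place determines
   them. *)
exists (fun e => v (index 1%N e) *~ (-1) ^+ index 1%N e).
rewrite cobar_d_ones; apply: eq_bigr => j _.
have -> : index 1%N (bump_at j n) = j.
  rewrite /bump_at index_cat mem_nseq andbF size_nseq /= addn0 //.
rewrite raddfMz -mulrzDl -mulrzA -exprD addnn.
by rewrite -signr_odd odd_double mulr1z.
Qed.

Lemma coinv0D n x y : coinv0 X n x -> coinv0 X n y -> coinv0 X n (x + y).
Proof.
move=> [v ->] [w ->]; exists (fun j => v j + w j); rewrite -big_split.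
by apply: eq_bigr => j _; rewrite raddfD addrACA.
Qed.

Lemma coinv0N n x : coinv0 X n x -> coinv0 X n (- x).
Proof.
move=> [v ->]; exists (fun j => - v j); rewrite -sumrN.
by apply: eq_bigr => j _; rewrite raddfN opprD.
Qed.

Lemma coinv00 n : coinv0 X n 0.
Proof. by exists (fun=> 0); rewrite big1 // => j _; rewrite raddf0 addr0. Qed.

Lemma coinv0U n j v : (j < n.-1)%N -> coinv0 X n (v + X j v).
Proof.
move=> jn; exists (fun k => if k == j then v else 0).
rewrite (bigD1 (Ordinal jn)) //= eqxx big1 ?addr0 // => k.
by rewrite -(inj_eq val_inj) /= => /negPf ->; rewrite raddf0 addr0.
Qed.

Lemma size_wt_ones c n : size c = n -> wt c = n -> c = nseq n 0%N.
Proof.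
rewrite /wt => sc wc; have {wc}: sumn c = 0%N by lia.
by elim: c n sc => [|[|a] c IH] [|n] //= [sc] H; rewrite (IH n).
Qed.

Lemma cobar_exact_ones n : (0 < n)%N ->
  cobar_exact X n n <-> forall x, coinv0 X n x.
Proof.
move=> n0; split=> [H x|H f _].
  apply/coinv0P => //; have [|g gE] := H (fun=> x).
    by move=> c; rewrite /wt; lia.
  exists g; apply: gE; rewrite ?size_nseq // /wt size_nseq.
  by elim: (n) => //= k; lia.
have /coinv0P [//|b bE] := H (f (nseq n 0%N)).
by exists b => c sc wc; rewrite (size_wt_ones sc wc).
Qed.
End Ones.

Section GModuleOps.
Variable n : nat.
Local Notation G := (braid_group n).

Section Ops.
Variable A : gmodule G.

(* The signs turn the signed shuffles into plain ones; the letters outside the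
   range act by zero, so that the braid relations hold for all letters. *)
Definition neg_gen j (v : A) : A :=
  if (j < n.-1)%N then - gact (pos_elt n [:: j]) v else 0.

Lemma neg_gen_is_zmod_morphism j : zmod_morphism (neg_gen j).
Proof.
move=> u v; rewrite /neg_gen; case: ifP => _; last by rewrite subr0.
by rewrite gactB opprB opprK addrC.
Qed.

Lemma gactN g (v : A) : gact g (- v) = - gact g v.
Proof. exact: (raddfN (@gact_add G A g)). Qed.

Lemma gact0 g : gact g (0 : A) = 0.
Proof. exact: (raddf0 (@gact_add G A g)). Qed.

Lemma gactMz g (v : A) z : gact g (v *~ z) = gact g v *~ z.
Proof. exact: (raddfMz (@gact_add G A g)). Qed.

Lemma neg_gen_far i j v : far i j -> neg_gen i (neg_gen j v) = neg_gen j (neg_gen i v).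
Proof.
move=> ij; rewrite /neg_gen.
case im: (i < n.-1)%N; case jm: (j < n.-1)%N; rewrite ?gact0 ?oppr0 //.
rewrite !gactN !opprK.
rewrite -!gactM; congr gact; apply: pos_elt_comm; rewrite /= ?im ?jm //.
by move=> a b; rewrite !inE => /eqP -> /eqP ->.
Qed.

Lemma neg_gen_near i j v : near i j ->
  neg_gen i (neg_gen j (neg_gen i v)) = neg_gen j (neg_gen i (neg_gen j v)).
Proof.
move=> ij; rewrite /neg_gen.
case im: (i < n.-1)%N; case jm: (j < n.-1)%N; rewrite ?gact0 ?oppr0 //.
rewrite !gactN !opprK.
rewrite -!gactM -!pos_elt_cat; congr (- gact _ v); apply: pos_elt_pcong.
  by rewrite /= im jm.
exact: pcong_near.
Qed.

Definition gmod_ops : braid_ops A :=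
  BraidOps neg_gen_is_zmod_morphism neg_gen_far neg_gen_near.

Lemma word_act_gmod w v : all (gtn n.-1) w ->
  word_act gmod_ops w v = gact (pos_elt n w) v *~ (-1) ^+ size w.
Proof.
elim: w => [|j w IH] /=; first by rewrite gact1 mulr1z.
move=> /andP[jm wm]; rewrite [word_act _ _ _]/= -/(word_act gmod_ops w v) IH //.
rewrite /neg_gen jm (@pos_elt_cons n j w) gactM exprS mulN1r mulrNz.
by rewrite gactMz.
Qed.

End Ops.

Lemma cobar_d_equivariant (A B : gmodule G) (phi : {additive A -> B}) k c f :
  equivariant phi ->
  phi (cobar_d (gmod_ops A) k c f) = cobar_d (gmod_ops B) k c (fun e => phi (f e)).
Proof.
move=> eqv; apply: (cobar_d_nat (s := 0%N)) => j v _ _.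
by rewrite /= /neg_gen; case: ifP => _; rewrite ?raddf0 ?raddfN ?eqv.
Qed.

Section Shift.
Variable A : gmodule G.
Local Notation P := (induced A).
Local Notation K := (kernel_module A).
Local Notation pr := (@ind_counit G A).
Local Notation incl := (@ker_incl G A).

Definition to_ker (v : P) : K := insubd (0 : K) v.

Lemma to_kerK v : pr v = 0 -> incl (to_ker v) = v.
Proof. by move=> v0; apply: insubdK; apply/eqP. Qed.

Lemma pr_incl (x : K) : pr (incl x) = 0.
Proof. exact: ind_ker_counit. Qed.

(** The counterpart of [bar_exact_shift]. With [n = p + i], lowering the homological degree [i]
    raises the cobar degree [p]. *)
Lemma cobar_shift p : cobar_exact (gmod_ops P) n p ->
  cobar_exact (gmod_ops A) n p <->
  (forall k : seq nat -> K,
    (exists b : seq nat -> P, forall c, size c = p.+1 -> wt c = n ->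
       cobar_d (gmod_ops P) 0 c b = incl (k c)) ->
    exists b : seq nat -> K, forall c, size c = p.+1 -> wt c = n ->
       cobar_d (gmod_ops K) 0 c b = k c).
Proof.
move=> exP; have Epr := @ind_counit_equivariant G A; have Ei := @ker_incl_equivariant G A.
have pr1 v : pr (imon 1%g v) = v by rewrite ind_counitU gact1.
split=> [exA k [b bk]|H f fc].
  have [|g gE] := exA (pr \o b).
    by move=> c sc wc; rewrite -(cobar_d_equivariant _ _ _ Epr) bk //; apply: pr_incl.
  exists (fun c => to_ker (b c - cobar_d (gmod_ops P) 0 c (imon 1%g \o g))).
  move=> c sc wc; apply: val_inj; rewrite -[LHS]/(incl _) (cobar_d_equivariant _ _ _ Ei).
  rewrite (@eq_cobar_d _ _ _ _ _ (fun e => b e - cobar_d (gmod_ops P) 0 e (imon 1%g \o g))).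
    by rewrite cobar_dB cobar_dK subr0 bk.
  move=> e se we; apply: to_kerK; rewrite raddfB (cobar_d_equivariant _ _ _ Epr).
  have se' : size e = p by move: se; rewrite sc => -[].
  apply/eqP; rewrite subr_eq0; apply/eqP; rewrite -[LHS](gE e se') ?we //.
  by apply: eq_cobar_d => e' _ _; rewrite [RHS]pr1.
pose b := imon 1%g \o f : seq nat -> P.
have [|b' b'E] := H (fun c => to_ker (cobar_d (gmod_ops P) 0 c b)).
  exists b => c sc wc; rewrite to_kerK // (cobar_d_equivariant _ _ _ Epr) -[RHS](fc c) //.
  by apply: eq_cobar_d => e _ _; apply: pr1.
have [|g gE] := exP (fun c => b c - incl (b' c)).
  move=> c sc wc; rewrite cobar_dB -(cobar_d_equivariant _ _ _ Ei) b'E //= to_kerK ?subrr //.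
  rewrite (cobar_d_equivariant _ _ _ Epr) -[RHS](fc c) //.
  by apply: eq_cobar_d => e _ _; apply: pr1.
exists (pr \o g) => c sc wc; rewrite -(cobar_d_equivariant _ _ _ Epr) gE //.
by rewrite raddfB /= pr_incl subr0; apply: pr1.
Qed.

Lemma cobar_shiftS p :
  cobar_exact (gmod_ops P) n p -> cobar_exact (gmod_ops P) n p.+1 ->
  cobar_exact (gmod_ops A) n p <-> cobar_exact (gmod_ops K) n p.+1.
Proof.
move=> exP exP'; have Ei := @ker_incl_equivariant G A.
apply: iff_trans (cobar_shift exP) _; split=> [H k kc|H k [b bk]].
  apply: H; have [|g gE] := exP' (incl \o k); last by exists g.
  by move=> c sc wc; rewrite -(cobar_d_equivariant _ _ _ Ei) kc // raddf0.
apply: H => c sc wc; apply: val_inj; rewrite -[LHS]/(incl _) (cobar_d_equivariant _ _ _ Ei).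
rewrite (@eq_cobar_d _ _ _ _ _ (fun e => cobar_d (gmod_ops P) 0 e b)) ?cobar_dK //.
by move=> e se we; rewrite bk // ?we //; move: se; rewrite sc => -[].
Qed.

(** The boundary case, where the shift ends in cobar degree [n]. There the induced module has
    homology, and the statement compares coinvariants just as [bar_exact0_shift] does. *)
Lemma cobar_shift_ones : (1 < n)%N -> cobar_exact (gmod_ops P) n n.-1 ->
  cobar_exact (gmod_ops A) n n.-1 <->
  (forall k : K, coinv0 (gmod_ops P) n (incl k) -> coinv0 (gmod_ops K) n k).
Proof.
move=> n1 exP; have n0 : (0 < n)%N by lia.
have sn : n.-1.+1 = n by lia.
apply: iff_trans (cobar_shift exP) _; rewrite sn; split=> H k.
  move=> /coinv0P [//|b bk]; apply/coinv0P => //.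
  have [|b' b'E] := H (fun=> k).
    by exists b => c sc wc; rewrite (size_wt_ones sc wc).
  exists b'; apply: b'E; rewrite ?size_nseq // /wt size_nseq.
  by elim: (n) => //= m; lia.
move=> [b bk]; have wtn : wt (nseq n 0%N) = n.
  by rewrite /wt size_nseq; elim: (n) => //= m; lia.
have [|b' b'E] := (coinv0P (gmod_ops K) (k (nseq n 0%N)) n0).2.
  by apply: H; apply/coinv0P => //; exists b; rewrite bk ?size_nseq.
by exists b' => c sc wc; rewrite (size_wt_ones sc wc).
Qed.
End Shift.

Section Boundaries.
Variable A : gmodule G.

(** Telescoping along a word for the braid: [1 - s h = (1 - h) + (1 - s) h], and
    [1 - s^-1 = - (1 - s) s^-1] for inverse letters. *)
Lemma coinv0_gact g (x : A) : coinv0 (gmod_ops A) n (x - gact g x).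
Proof.
rewrite -[g]braid_ofK; elim: (repr g) x => [|[b j] w IH] x.
  by rewrite gact1 subrr; apply: coinv00.
rewrite -cat1s braid_of_catg gactM; set y := gact _ x.
have -> : x - gact (braid_of_word [:: (b, j)]) y =
    (x - y) + (y - gact (braid_of_word [:: (b, j)]) y) by rewrite subrKA.
apply: coinv0D; first exact: IH.
have H z : coinv0 (gmod_ops A) n (z - gact (braid_of_word [:: (false, j)]) z).
  have := @coinv0U A (gmod_ops A) n j z (ltn_ord j).
  by rewrite /= /neg_gen ltn_ord pos_elt1.
case: b => //; rewrite braid_of_inv; set s := braid_of_word _ in H *.
have -> : y - gact s^-1%g y = - (gact s^-1%g y - gact s (gact s^-1%g y)).
  by rewrite -gactM mulgV gact1 opprB.
exact/coinv0N/H.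
Qed.

Lemma bmon_inj i (t : i.-tuple G) (x y : A) : bmon t x = bmon t y -> x = y.
Proof.
rewrite /bmon locked_withE => /(congr1 (mcoeff t)).
by move=> E; rewrite -[x](mcoeffUU t) E mcoeffUU.
Qed.

Lemma bar_chain0E (c : bar_chain A 0) : exists x, c = bmon [tuple] x.
Proof.
elim/bar_ind: c => [|c d [x ->] [y ->]|t x].
- by exists 0; rewrite raddf0.
- by exists (x + y); rewrite raddfD.
by exists x; rewrite (tuple0 t).
Qed.

Lemma boundary0P (x : A) :
  (exists b, bdiff b = bmon [tuple] x) <-> coinv0 (gmod_ops A) n x.
Proof.
split=> [[b]|[v ->]].
  suff [y -> cy] : exists2 y, bdiff b = bmon [tuple] y & coinv0 (gmod_ops A) n y.
    by move/bmon_inj => <-.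
  elim/bar_ind: b => [|c d [y Ey cy] [z Ez cz]|t y].
  - by exists 0; [rewrite bdiff0 raddf0|apply: coinv00].
  - by exists (y + z); [rewrite bdiffD Ey Ez raddfD|apply: coinv0D].
  exists (y - gact (tnth t ord0) y); first by rewrite bdiff1 raddfB.
  exact: coinv0_gact.
exists (\sum_(j < n.-1) bmon [tuple pos_elt n [:: val j]] (v j)).
rewrite bdiff_sum raddf_sum; apply: eq_bigr => j _.
by rewrite bdiff1 /= /neg_gen ltn_ord raddfD raddfN.
Qed.

Lemma trivial_homology0P : trivial_zmod (group_homology A 0) <->
  forall x : A, coinv0 (gmod_ops A) n x.
Proof.
apply: iff_trans (trivial_homology0 A) _; split=> [H x|H c].
  by apply/boundary0P; apply: H.
by have [x ->] := bar_chain0E c; apply/boundary0P.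
Qed.
End Boundaries.

Lemma bar_exact0_shift (A : gmodule G) : bar_exact A 0 <->
  (forall k : kernel_module A,
    coinv0 (gmod_ops (induced A)) n (ker_incl k) -> coinv0 (gmod_ops (kernel_module A)) n k).
Proof.
apply: iff_trans (bar_exact_shift A 0) _; split=> [H k kc|H c].
  apply/boundary0P; apply: H; rewrite bmapU; exact/boundary0P.
have [k ->] := bar_chain0E c; rewrite bmapU => /boundary0P kc.
exact/boundary0P/H.
Qed.

(** Degrees 0 and 1 are compared directly through coinvariants, since the induced module has
    homology in degree 0; from degree 2 on both sides shift to the kernel module. *)
Theorem trivial_homologyP i p (A : gmodule G) : (0 < p)%N -> n = (p + i)%N ->
  (forall (B : gmodule G) q j, (0 < q)%N -> n = (q + j.+1)%N ->
     cobar_exact (gmod_ops (induced B)) n q) ->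
  trivial_zmod (group_homology A i) <-> cobar_exact (gmod_ops A) n p.
Proof.
move=> p0 np acyc; elim: i p A p0 np => [|[|i] IH] p A p0 np.
- have np' : p = n by lia.
  by rewrite np'; apply: iff_trans (trivial_homology0P A) _; apply: iff_sym;
    apply: cobar_exact_ones; lia.
- have np' : p = n.-1 by lia.
  apply: iff_trans (trivial_homologyS A 0) _.
  apply: iff_trans (bar_exact0_shift A) _; rewrite np'; apply: iff_sym.
  by apply: cobar_shift_ones; [lia|rewrite -np'; apply: (acyc _ _ 0%N); lia].
apply: iff_trans (trivial_homologyS A i.+1) _.
apply: iff_trans (bar_exact_shiftS A i) _.
apply: iff_trans (iff_sym (trivial_homologyS _ i)) _.
apply: iff_trans (IH p.+1 _ _ _) _ => //; first by lia.
apply: iff_sym; apply: cobar_shiftS; [apply: (acyc _ _ i.+1)|apply: (acyc _ _ i)]; lia.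
Qed.

End GModuleOps.

(** * Acyclicity of the cobar complex of an induced module *)

Fixpoint cells (n p : nat) : seq (seq nat) :=
  if p is p'.+1 then
    flatten [seq [seq a :: c | c <- cells (n - a.+1)%N p'] | a <- iota 0 n]
  else if n == 0%N then [:: [::]] else [::].

Lemma mem_cells n p c : (c \in cells n p) = (size c == p) && (wt c == n).
Proof.
elim: p n c => [|p IH] n c /=.
  case: c => [|a c]; last by case: ifP => _; rewrite ?inE.
  by rewrite /wt /= eq_sym; case: ifP.
apply/flatten_mapP/idP => [[a]|].
  rewrite mem_iota => /andP[_ an] /mapP[e].
  by rewrite IH => /andP[/eqP <- /eqP we] ->; rewrite eqxx wt_cons we /=; apply/eqP; lia.
case: c => // a c /= /andP[sc]; rewrite wt_cons => /eqP wc.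
exists a; first by rewrite mem_iota; lia.
by apply: map_f; rewrite IH -eqSS sc; apply/eqP; lia.
Qed.

Lemma cells_uniq n p : uniq (cells n p).
Proof.
elim: p n => [|p IH] n /=; first by case: ifP.
have : uniq (iota 0 n) by apply: iota_uniq.
elim: (iota 0 n) => //= a s IHs /andP[nas us].
rewrite cat_uniq IHs // andbT map_inj_uniq; last by move=> ? ? [].
rewrite IH; apply/hasPn => c /flatten_mapP[b bs /mapP[e _ ->]].
by apply/mapP => -[e' _ [ba _]]; rewrite -ba bs in nas.
Qed.

(* The differential of the simplex on the set of walls of a composition. *)
Fixpoint wallD (A : zmodType) c (F : seq nat -> A) : A :=
  if c is a :: c1 then
    if c1 is b :: c2 then F ((a + b).+1 :: c2) - wallD c1 (F \o cons a) else 0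
  else 0.

(** * Contraction of a simplex *)

Section Walls.
Variable A : zmodType.
Implicit Types F : seq nat -> A.

Lemma wallDE a b c F :
  wallD [:: a, b & c] F = F ((a + b).+1 :: c) - wallD (b :: c) (F \o cons a).
Proof. by []. Qed.

Lemma eq_wallD c F H : (forall e, (size e).+1 = size c -> wt e = wt c -> F e = H e) ->
  wallD c F = wallD c H.
Proof.
elim: c F H => [|a [|b c] IH] // F H FH; rewrite !wallDE; congr (_ - _).
  by apply: FH; rewrite // !wt_cons; lia.
by apply: IH => e se we; apply: FH; rewrite /= ?se // !wt_cons we wt_cons.
Qed.

Lemma wallD0 c F : (forall e, (size e).+1 = size c -> wt e = wt c -> F e = 0) ->
  wallD c F = 0.
Proof.
move=> F0; rewrite (@eq_wallD _ _ (fun=> 0)) //.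
by elim: c {F0} => [|a [|b c] IH] //; rewrite wallDE IH subr0.
Qed.

Lemma wallDN c F : wallD c (fun e => - F e) = - wallD c F.
Proof.
elim: c F => [|a [|b c] IH] F; rewrite ?oppr0 // !wallDE opprB.
by rewrite (IH (F \o cons a)) opprK addrC.
Qed.

Fixpoint starts_with_ones k (c : seq nat) : bool :=
  if k is k'.+1 then if c is 0%N :: c' then starts_with_ones k' c' else false else true.

(* A cone in the simplex, whose apex is the wall after the [k+1]-st strand. *)
Fixpoint cone k F (c : seq nat) : A :=
  if k is k'.+1 then
    if c is 0%N :: c' then - cone k' (F \o cons 0%N) c' else 0
  else if c is a.+1 :: c' then F [:: 0%N, a & c'] else 0.

Lemma eq_cone k F H c : F =1 H -> cone k F c = cone k H c.
Proof.
elim: k F H c => [|k IH] F H [|[|a] c] //= FH; congr (- _).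
by apply: IH => e; apply: FH.
Qed.

Lemma coneN k F c : cone k (fun e => - F e) c = - cone k F c.
Proof.
elim: k F c => [|k IH] F [|[|a] c]; rewrite /= ?oppr0 //.
by rewrite (IH (F \o cons 0%N)).
Qed.

(** If [F] lives on compositions that start with [k] ones, merging across any of the first [k] walls
    leaves its support. These walls then contribute nothing, and stripping the ones reduces to an
    apex at the first wall. *)
Lemma cone_homotopy k F c : (k.+1 < wt c)%N ->
  (forall e, ~~ starts_with_ones k e -> F e = 0) ->
  wallD c (cone k F) + cone k (fun e => wallD e F) c = F c.
Proof.
elim: k F c => [|k IH] F [|a c] //.
  rewrite wt_cons => wc _; case: a wc => [|a] wc.
    case: c wc => [|b c] wc; first by rewrite /wt in wc.
    by rewrite wallDE (@wallD0 (b :: c)) // [cone _ _ (0%N :: _)]/= subr0 addr0.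
  case: c {wc} => [|b c]; first by rewrite /= subr0 add0r.
  rewrite wallDE [cone 0 _ (a.+1 :: _)]/= -/(wallD (b :: c) _) addSn.
  by rewrite [X in X + _]/(F _ - wallD _ _) addrC subrK.
rewrite wt_cons => wc F0; case: a wc => [|a] wc; last first.
  rewrite F0 // [cone _ _ (a.+1 :: _)]/= addr0; case: c {wc} => [|b c] //.
  by rewrite wallDE (@wallD0 (b :: c)) // subr0.
case: c wc => [|b c] wc; first by move: wc; rewrite /wt /=; lia.
rewrite wallDE [cone _ _ (_.+1 :: _)]/= sub0r [cone k.+1 _ (0%N :: _)]/=.
rewrite (@eq_wallD (b :: c) _ (fun e => - cone k (F \o cons 0%N) e)) // wallDN opprK.
have E e : wallD (0%N :: e) F = - wallD e (F \o cons 0%N).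
  case: e => [|x e]; first by rewrite /= oppr0.
  by rewrite wallDE F0 // sub0r.
rewrite (@eq_cone _ _ (fun e => - wallD e (F \o cons 0%N))) => [|e]; last exact: E.
by rewrite coneN opprK IH // => e Fe; apply: F0.
Qed.

Lemma cone_neq0 k F c : cone k F c <> 0 -> exists a c',
  c = nseq k 0%N ++ a.+1 :: c' /\ F (nseq k 0%N ++ [:: 0%N, a & c']) <> 0.
Proof.
elim: k F c => [|k IH] F [|[|a] c] //=.
  by exists a, c.
by move=> H; have [|a' [c' [-> ?]]] := IH (F \o cons 0%N) c;
  [move=> E; apply: H; rewrite E oppr0|exists a', c'].
Qed.
End Walls.

Lemma inner_cat k c c' : inner k (c ++ c') = inner k c ++ inner (k + wt c) c'.
Proof.
elim: c k => [|a c IH] k; first by rewrite /wt addn0.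
by rewrite /= IH -catA wt_cons addnA.
Qed.

Lemma inner_starts k j e : (k <= wt e)%N ->
  (forall s, s \in inner j e -> (j + k <= s)%N) -> starts_with_ones k e.
Proof.
elim: k j e => [|k IH] j [|[|a] e] //= we H.
  apply: (IH j.+1); first by rewrite wt_cons in we; lia.
  by move=> s se; rewrite addSnnS; apply: H; rewrite addn1.
by have := H j; rewrite mem_head => /(_ isT); lia.
Qed.

Lemma bound_seq (T : eqType) (s : seq T) (Q : nat -> T -> Prop) :
  (forall k l x, (k <= l)%N -> Q k x -> Q l x) -> (forall x, exists k, Q k x) ->
  exists k, forall x, x \in s -> Q k x.
Proof.
move=> Qle Qex; elim: s => [|x s [k IH]]; first by exists 0%N.
have [l Ql] := Qex x; exists (maxn k l) => y; rewrite inE => /orP[/eqP ->|/IH].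
  by apply: Qle Ql; apply: leq_maxr.
by apply: Qle; apply: leq_maxl.
Qed.

Lemma len_gt_bound (L : int) (w d k : nat) : (w < k)%N ->
  - w%:Z + (L - d%:Z) + (d + k)%N%:Z <= L -> False.
Proof. lia. Qed.

Lemma len_le_bound (L l : int) (w d k : nat) : (w <= k)%N ->
  - w%:Z + l + (d + k)%N%:Z <= L -> l + d%:Z <= L.
Proof. lia. Qed.

Lemma mulrz_signK (V : zmodType) (x : V) s : x *~ (-1) ^+ s *~ (-1) ^+ s = x.
Proof. by rewrite -mulrzA -exprD addnn -signr_odd odd_double mulr1z. Qed.

(** * Filtration of the induced complex by braid length *)

Section Acyclicity.
Variables (n : nat) (A : gmodule (braid_group n)).
Local Notation m := n.-1.
Local Notation G := (braid_group n).
Local Notation P := (induced A).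
Local Notation X := (gmod_ops P).
Implicit Types (f : seq nat -> P) (g y : G).

Definition icoef g (v : P) : A := mcoeff g v.
HB.instance Definition _ g := GRing.Additive.copy (icoef g) (mcoeff g).

Lemma icoef0 g : icoef g 0 = 0. Proof. exact: raddf0. Qed.
Lemma icoefB g u v : icoef g (u - v) = icoef g u - icoef g v.
Proof. exact: raddfB. Qed.
Lemma icoefD g u v : icoef g (u + v) = icoef g u + icoef g v.
Proof. exact: raddfD. Qed.
Lemma icoefMz g v z : icoef g (v *~ z) = icoef g v *~ z. Proof. exact: raddfMz. Qed.
Lemma icoef_sum g (I : Type) (r : seq I) (F : I -> P) :
  icoef g (\sum_(i <- r) F i) = \sum_(i <- r) icoef g (F i).
Proof. exact: raddf_sum. Qed.

Lemma icoef_gact g h v : icoef g (gact h v) = icoef (h^-1 * g)%g v.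
Proof. exact: ind_actE. Qed.

Lemma icoef_imon g h (x : A) : icoef g (imon h x) = if h == g then x else 0.
Proof. by rewrite [LHS]mcoeffU; case: eqP. Qed.

Lemma icoefP (u v : P) : (forall g, icoef g u = icoef g v) -> u = v.
Proof. by move=> H; apply/malgP => g; apply: H. Qed.

Lemma icoef_word_act g w v : all (gtn m) w ->
  icoef g (word_act X w v) = icoef ((pos_elt n w)^-1 * g)%g v *~ (-1) ^+ size w.
Proof. by move=> wm; rewrite word_act_gmod // icoefMz icoef_gact. Qed.

Local Notation dl := (cell_delta 0).
Local Notation De c := (pos_elt n (dl c)).

Lemma dl_letters c : wt c = n -> all (gtn m) (dl c).
Proof. by move=> wc; apply/allP => j /cell_delta_letters /=; lia. Qed.

Lemma len_dl c g : wt c = n -> braid_len ((De c)^-1 * g)%g = braid_len g - (size (dl c))%:Z.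
Proof. by move=> wc; rewrite braid_lenM braid_lenV braid_len_elt ?dl_letters //; lia. Qed.

(** The filtration degree of the coefficient at the cell [c] and the element [g] is the length of
    [De c * g]; positivity of [g] bounds it below. *)
Definition bounded p (L : int) f := forall c g, size c = p -> wt c = n ->
  icoef g (f c) <> 0 -> positive g /\ braid_len g + (size (dl c))%:Z <= L.

(** The coefficients with common product [y = De c * g], indexed by the cell. The sign absorbs the
    one with which words act through [gmod_ops]. *)
Definition lead f y c : A := icoef ((De c)^-1 * y)%g (f c) *~ (-1) ^+ size (dl c).

Section Merge.
Variables (c1 : seq nat) (a b : nat) (c2 : seq nat).
Local Notation c := (c1 ++ [:: a, b & c2]).
Local Notation c' := (c1 ++ (a + b).+1 :: c2).
Hypothesis wc : wt c = n.

Let wc' : wt c' = n.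
Proof. by rewrite -wc !wt_cat !wt_cons; lia. Qed.

Lemma size_dl_merge : size (dl c') = (size (dl c) + a.+1 * b.+1)%N.
Proof. by rewrite (pcong_size (cell_delta_merge 0 c1 a b c2)) size_cat size_top. Qed.

Lemma De_merge : De c' = (De c * pos_elt n (top (wt c1) a.+1 b.+1))%g.
Proof.
rewrite -pos_elt_cat; apply: pos_elt_pcong; first exact: dl_letters.
exact: cell_delta_merge.
Qed.

Lemma merge_letters w : (forall j, j \in w -> (j.+1 < wt c1 + a.+1 + b.+1)%N) ->
  all (gtn m) w.
Proof.
move=> H; apply/allP => j /H; rewrite /= -wc wt_cat !wt_cons; lia.
Qed.

(** A shuffle shorter than the longest one would need a coefficient of [f] whose filtration degree
    exceeds [L] by the difference of the lengths. The longest one turns [De c] into [De c'] and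
    keeps [y]. *)
Lemma icoef_sh_lead p L f y : bounded p L f -> (size c1 + size c2).+1 = p ->
  braid_len y = L ->
  icoef ((De c)^-1 * y)%g (sh X (wt c1) a.+1 b.+1 (f c')) *~ (-1) ^+ size (dl c) =
  lead f y c'.
Proof.
move=> bf sp yL; rewrite /sh (perm_big _ (perm_shuffles _ _ _)) big_cons.
have small w : w \in small_shuffles (wt c1) a.+1 b.+1 ->
    icoef ((De c)^-1 * y)%g (word_act X w (f c')) = 0.
  move=> wi; have sw := small_shuffles_size wi.
  have wm : all (gtn m) w.
    by apply: merge_letters => j /(small_shuffles_letters wi); lia.
  rewrite icoef_word_act //.
  case: (pselect (icoef ((pos_elt n w)^-1 * ((De c)^-1 * y))%g (f c') = 0)) => [->|].
    by rewrite mul0rz.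
  move=> /bf[||_ le]; rewrite ?size_cat //=; first by lia.
  exfalso; move: le; rewrite braid_lenM braid_lenV len_dl // yL size_dl_merge.
  by rewrite braid_len_elt //; apply: len_gt_bound.
rewrite icoefD icoef_sum big1_seq => [|w /andP[_ /small]//].
rewrite addr0 icoef_word_act; last by apply: merge_letters => j /top_letters; lia.
rewrite mulgA -invgM -De_merge -mulrzA -exprD /lead size_dl_merge size_top.
by rewrite [(a.+1 * b.+1 + _)%N]addnC.
Qed.

Lemma icoef_sh_bounded p L f g : bounded p L f -> (size c1 + size c2).+1 = p ->
  icoef g (sh X (wt c1) a.+1 b.+1 (f c')) <> 0 ->
  positive g /\ braid_len g + (size (dl c))%:Z <= L.
Proof.
move=> bf sp; rewrite /sh icoef_sum => H.
have [w wi] : exists2 w, w \in shuffles (wt c1) a.+1 b.+1 &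
    icoef g (word_act X w (f c')) <> 0.
  apply: contrapT => nw; apply: H; rewrite big1_seq // => w /= wi.
  by apply: contrapT => ne; apply: nw; exists w.
have wm : all (gtn m) w by apply: merge_letters => j /(shuffles_letters wi); lia.
rewrite icoef_word_act // => ne.
have /bf[||pg lg] : icoef ((pos_elt n w)^-1 * g)%g (f c') <> 0.
- by move=> E; apply: ne; rewrite E mul0rz.
- by rewrite size_cat /=; lia.
- exact: wc'.
split; first by rewrite -(mulVKg (pos_elt n w) g); apply: positiveM => //; apply: positive_elt.
move: lg; rewrite braid_lenM braid_lenV braid_len_elt // size_dl_merge.
by apply: len_le_bound; apply: shuffles_size wi.
Qed.
End Merge.

Lemma lead_cobar_d p L f y c1 c2 : bounded p L f -> braid_len y = L ->
  size (c1 ++ c2) = p.+1 -> wt (c1 ++ c2) = n ->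
  icoef ((De (c1 ++ c2))^-1 * y)%g (cobar_d X (wt c1) c2 (fun e => f (c1 ++ e)))
    *~ (-1) ^+ size (dl (c1 ++ c2)) =
  wallD c2 (fun e => lead f y (c1 ++ e)).
Proof.
move=> bf yL; elim: c2 c1 => [|a [|b c2] IH] c1 sc wc; rewrite ?icoef0 ?mul0rz //.
rewrite cobar_dE wallDE icoefB mulrzBl (icoef_sh_lead wc bf) //; last first.
  by move: sc; rewrite size_cat /=; lia.
congr (_ - _).
rewrite -(@eq_wallD _ _ (fun e => lead f y (rcons c1 a ++ e))); last first.
  by move=> e _ _; rewrite cat_rcons.
have := IH (rcons c1 a); rewrite cat_rcons => /(_ sc wc) <-.
rewrite wt_rcons (@eq_cobar_d _ _ _ _ _ (fun e => f (rcons c1 a ++ e))) // => e _ _.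
by rewrite cat_rcons.
Qed.

Lemma bounded_cobar_d p L f : bounded p L f -> bounded p.+1 L (fun c => cobar_d X 0 c f).
Proof.
move=> bf c g; suff H c1 c2 : size (c1 ++ c2) = p.+1 -> wt (c1 ++ c2) = n ->
    icoef g (cobar_d X (wt c1) c2 (fun e => f (c1 ++ e))) <> 0 ->
    positive g /\ braid_len g + (size (dl (c1 ++ c2)))%:Z <= L.
  exact: (H [::] c).
elim: c2 c1 => [|a [|b c2] IH] c1 sc wc; rewrite ?icoef0 //.
rewrite cobar_dE icoefB => ne.
case: (pselect (icoef g (sh X (wt c1) a.+1 b.+1 (f (c1 ++ (a + b).+1 :: c2))) = 0)).
  move=> E; move: ne; rewrite E sub0r => ne.
  have := IH (rcons c1 a); rewrite cat_rcons; apply=> // E'; apply: ne.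
  rewrite -oppr0 -E' wt_rcons; congr (- icoef _ _).
  by apply: eq_cobar_d => e _ _; rewrite cat_rcons.
by apply: icoef_sh_bounded bf _ => //; move: sc; rewrite size_cat /=; lia.
Qed.

Section Step.
Variables (q : nat) (L : int) (f : seq nat -> P).
Hypotheses (qn : (q.+1 < n)%N) (bf : bounded q.+1 L f)
  (cyc : forall c, size c = q.+2 -> wt c = n -> cobar_d X 0 c f = 0).

Let F y c : A := if (size c == q.+1) && (wt c == n) then lead f y c else 0.

(** Because the smallest generator dividing [y] is taken, every cell with a nonzero leading term at
    [y] starts with [apex y] parts of size 1, as [cone_homotopy] demands. *)
Let apex y := find (fun s => `[< dvdw [:: s] y >]) (iota 0 m).

Let Hy y c : P :=
  imon ((De c)^-1 * y)%g (cone (apex y) (F y) c *~ (-1) ^+ size (dl c)).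

Lemma F_neq0 y c : F y c <> 0 -> [/\ size c = q.+1, wt c = n & dvdw (dl c) y].
Proof.
rewrite /F; case: ifP => // /andP[/eqP sc /eqP wc] ne; split=> //.
have /(bf sc wc)[] // : icoef ((De c)^-1 * y)%g (f c) <> 0.
by move=> E; apply: ne; rewrite /lead E mul0rz.
Qed.

Lemma lead_cycle y c : braid_len y = L -> wallD c (F y) = 0.
Proof.
move=> yL; case: (boolP ((size c == q.+2) && (wt c == n))) => [|nv].
  move=> /andP[/eqP sc /eqP wc]; have := @lead_cobar_d _ _ _ y [::] c bf yL sc wc.
  rewrite (cyc sc wc) icoef0 mul0rz => E; rewrite [RHS]E.
  by apply: eq_wallD => e se we; rewrite /F we wc -eqSS se sc !eqxx.
apply: wallD0 => e se we; rewrite /F we -eqSS se; case: ifP => // v.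
by rewrite v in nv.
Qed.

Lemma dvdw_positive u y : dvdw u y -> positive y.
Proof.
move=> uy; rewrite -(mulVKg (pos_elt n u) y); apply: positiveM => //.
exact: positive_elt.
Qed.

Lemma apexP y c : F y c <> 0 ->
  [/\ (apex y < m)%N, dvdw [:: apex y] y & starts_with_ones (apex y) c].
Proof.
move=> /F_neq0[sc wc dy].
have inn s : s \in inner 0 c -> dvdw [:: s] y.
  by move=> si; apply: dvdw_inner si dy; lia.
have has_apex : has (fun s => `[< dvdw [:: s] y >]) (iota 0 m).
  have [s si] : exists s, s \in inner 0 c.
    have : (size (inner 0 c) + size c = wt c)%N.
      elim: (c) 0%N => //= a e IH k; rewrite size_cat size_iota wt_cons -(IH (k + a.+1)%N).
      by lia.
    rewrite sc wc; case: (inner 0 c) => [|s t _]; first by rewrite /=; lia.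
    by exists s; rewrite mem_head.
  apply/hasP; exists s; last by apply/asboolP/inn.
  by have := inner_letters si; rewrite mem_iota; lia.
have am : (apex y < m)%N by move: has_apex; rewrite has_find size_iota.
split=> //.
  have := nth_find 0%N has_apex; rewrite -/(apex y) nth_iota // add0n.
  by move/asboolP.
apply: (inner_starts (j := 0%N)); first by lia.
move=> s si; rewrite add0n leqNgt; apply/negP => sa.
have := before_find 0%N sa; rewrite nth_iota ?add0n; last by lia.
by move/asboolP; apply; apply: inn.
Qed.

(** The inner letters of [e] are those of a cell with nonzero leading term, together with the apex.
    All of them divide [y], hence so does the product of half twists [De e]. *)
Lemma cone_positive y e : size e = q -> wt e = n ->
  cone (apex y) (F y) e <> 0 -> positive ((De e)^-1 * y)%g.
Proof.
move=> se we /cone_neq0[a [c' [eE ne]]].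
have [_ wc dy] := F_neq0 ne; have [am da _] := apexP ne.
apply: dvdw_cell => //; [by lia|exact: dvdw_positive dy|].
move=> s; rewrite eE inner_cat; set k := apex y in eE ne wc dy am da *.
have wk : wt (nseq k 0%N) = k.
  by rewrite /wt size_nseq; elim: (k) => //= ? ; lia.
have inn t : t \in inner 0 (nseq k 0%N ++ [:: 0%N, a & c']) -> dvdw [:: t] y.
  by move=> ti; apply: dvdw_inner ti dy; lia.
rewrite inner_cat wk add0n mem_cat in inn *.
move=> /orP[sk|]; first by apply: inn; rewrite mem_cat sk.
rewrite /= !inE => /orP[/eqP -> //|si]; apply: inn; rewrite mem_cat; apply/orP; right.
by rewrite /= addn1 addSnnS.
Qed.

Lemma Hy_bounded y : braid_len y = L -> bounded q L (Hy y).
Proof.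
move=> yL c g sc wc; rewrite /Hy icoef_imon; case: eqP => // <- ne.
split; last by rewrite len_dl // yL subrK.
by apply: cone_positive => // E; apply: ne; rewrite E mul0rz.
Qed.

Lemma Hy_lead y y' c : lead (Hy y) y' c = if y == y' then cone (apex y) (F y) c else 0.
Proof.
rewrite /lead /Hy icoef_imon (inj_eq (mulgI _)); case: eqP => _; last by rewrite mul0rz.
by rewrite mulrz_signK.
Qed.

Lemma wallD_cone y c : braid_len y = L -> size c = q.+1 -> wt c = n ->
  wallD c (cone (apex y) (F y)) = F y c.
Proof.
move=> yL sc wc.
have cone0 k (E : seq nat -> A) e : (forall e', E e' = 0) -> cone k E e = 0.
  move=> E0; apply: contrapT => /cone_neq0[a [c' [_]]]; apply; exact: E0.
case: (pselect (exists e, F y e <> 0)) => [[e0 Fe0]|F0].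
  rewrite -(@cone_homotopy A (apex y) (F y) c).
  - by rewrite [X in _ + X]cone0 ?addr0 // => e'; apply: lead_cycle.
  - by have [] := apexP Fe0; lia.
  - move=> e; apply: contraNeq => /eqP Fe; by have [] := apexP Fe.
have {}F0 e : F y e = 0 by apply: contrapT => Fe; apply: F0; exists e.
by rewrite F0 wallD0 // => e _ _; apply: cone0.
Qed.

Lemma lower_bound : exists h, bounded q.+1 (L - 1) (fun c => f c - cobar_d X 0 c h).
Proof.
(* The finitely many products of length [L] in the support of [f]; the chain [h] is the sum of their
   cones. *)
pose Y : seq G := undup [seq y <- flatten
  [seq [seq (De c * g)%g | g <- (msupp (f c : {malg A[G]}) : seq G)]
     | c <- cells n q.+1] | braid_len y == L].
have YL y : y \in Y -> braid_len y = L.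
  by rewrite mem_undup mem_filter => /andP[/eqP].
have inY y c : braid_len y = L -> F y c <> 0 -> y \in Y.
  move=> yL Fy; have [sc wc _] := F_neq0 Fy.
  rewrite mem_undup mem_filter yL eqxx; apply/flatten_mapP; exists c.
    by rewrite mem_cells sc wc !eqxx.
  apply/mapP; exists ((De c)^-1 * y)%g; last by rewrite mulVKg.
  rewrite -mcoeff_neq0; apply/eqP => E; apply: Fy.
  by rewrite /F; case: ifP => // _; rewrite /lead /icoef E mul0rz.
exists (fun c => \sum_(y <- Y) Hy y c) => c g sc wc; rewrite cobar_d_sum icoefB icoef_sum => ne.
have bD y : y \in Y -> icoef g (cobar_d X 0 c (Hy y)) <> 0 ->
    positive g /\ braid_len g + (size (dl c))%:Z <= L.
  by move=> /YL yL; apply: (bounded_cobar_d (Hy_bounded yL)).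
have [pg lg] : positive g /\ braid_len g + (size (dl c))%:Z <= L.
  case: (pselect (icoef g (f c) = 0)) => [E|]; last exact: bf.
  apply: contrapT => nb; apply: ne; rewrite E sub0r big1_seq ?oppr0 // => y /= yY.
  by apply: contrapT => /(bD y yY).
(* The bound [L] persists; it drops to [L - 1] once the terms of degree exactly [L] are shown to
   cancel. *)
split=> //; suff neL : braid_len g + (size (dl c))%:Z <> L by lia.
move=> gL; apply: ne.
pose y := (De c * g)%g; have yL : braid_len y = L.
  by rewrite braid_lenM braid_len_elt ?dl_letters // addrC.
have gE : g = ((De c)^-1 * y)%g by rewrite mulKg.
have E1 : icoef g (f c) = F y c *~ (-1) ^+ size (dl c).
  by rewrite /F sc wc !eqxx /lead -gE mulrz_signK.
have E2 z : z \in Y -> icoef g (cobar_d X 0 c (Hy z)) =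
    (if z == y then F y c else 0) *~ (-1) ^+ size (dl c).
  move=> /YL zL; have := @lead_cobar_d _ _ _ y [::] c (Hy_bounded zL) yL sc wc.
  rewrite -gE => E.
  rewrite -[LHS](mulrz_signK _ (size (dl c))) E; congr (_ *~ _).
  case: (eqVneq z y) => [E0|zy]; last first.
    by apply: wallD0 => e _ _; rewrite Hy_lead (negPf zy).
  rewrite E0 in zL *; rewrite -[RHS](wallD_cone zL sc wc); apply: eq_wallD => e _ _.
  by rewrite Hy_lead eqxx.
rewrite E1 (eq_big_seq _ E2).
case: (pselect (F y c = 0)) => [F0|/(inY _ _ yL) yY].
  by rewrite F0 mul0rz sub0r big1 ?oppr0 // => z _; case: eqP; rewrite mul0rz.
rewrite (bigD1_seq y) ?undup_uniq //= eqxx big1 ?addr0 ?subrr // => z /negPf ->.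
by rewrite mul0rz.
Qed.

End Step.
Lemma bounded_exact q N f : (q.+1 < n)%N -> bounded q.+1 (N%:Z - 1) f ->
  (forall c, size c = q.+2 -> wt c = n -> cobar_d X 0 c f = 0) ->
  exists h, forall c, size c = q.+1 -> wt c = n -> cobar_d X 0 c h = f c.
Proof.
move=> qn; elim: N f => [|N IH] f bf cyc.
  (* The bound is now [-1], which leaves only the zero chain since positive braids have nonnegative
     length. *)
  exists (fun=> 0) => c sc wc; rewrite cobar_d0 //; apply: icoefP => g; rewrite icoef0.
  apply: contrapT => /nesym /(bf _ _ sc wc)[/braid_len_ge0]; lia.
have [h bh] := lower_bound qn bf cyc.
have [||h' h'E] := IH (fun c => f c - cobar_d X 0 c h).
- by move: bh; congr bounded; lia.
- by move=> c sc wc; rewrite cobar_dB cyc // cobar_dK subr0.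
by exists (fun c => h' c + h c) => c sc wc; rewrite cobar_dD h'E // subrK.
Qed.

Lemma zpow_equivariant k c f :
  cobar_d X 0 c (fun e => gact (pos_elt n (zpow n k)) (f e)) =
  gact (pos_elt n (zpow n k)) (cobar_d X 0 c f).
Proof.
rewrite -[RHS]/(gact_add _ _); symmetry; apply: (cobar_d_nat (s := 0%N)) => j v _ _.
rewrite -[LHS]/(gact _ (neg_gen j v)) -[RHS]/(neg_gen j (gact _ v)) /neg_gen.
case: (j < m)%N; last by rewrite gact0.
by rewrite gactN -!gactM (zpow_central k (pos_elt n [:: j])).
Qed.

(** The support of [f] on the relevant cells is finite, so one power of the central full twist makes
    it positive and bounds its length. Translation by that power is invertible and commutes with the
    differential. *)
Lemma induced_cobar_exact q j : (0 < q)%N -> n = (q + j.+1)%N -> cobar_exact X n q.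
Proof.
case: q => // q _ nq f cyc.
have qn : (q.+1 < n)%N by lia.
pose s := flatten [seq [seq (c, g) | g <- (msupp (f c : {malg A[G]}) : seq G)]
  | c <- cells n q.+1].
have sP c g : size c = q.+1 -> wt c = n -> icoef g (f c) <> 0 -> (c, g) \in s.
  move=> sc wc /eqP ne; apply/flatten_mapP; exists c.
    by rewrite mem_cells sc wc !eqxx.
  by apply/mapP; exists g => //; rewrite -mcoeff_neq0.
have [k kP] := @bound_seq _ s (fun k x => positive (pos_elt n (zpow n k) * x.2)%g)
  (fun k l x kl => zpow_positive_le kl) (fun x => zpow_positive x.2).
pose z := pos_elt n (zpow n k); pose f' c := gact z (f c) : P.
have [||N NP] := @bound_seq _ s (fun N x =>
    braid_len (z * x.2)%g + (size (dl x.1))%:Z <= N%:Z - 1).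
- by move=> k1 k2 x; lia.
- by move=> x; exists (absz (braid_len (z * x.2)%g + (size (dl x.1))%:Z)).+1; lia.
have bf' : bounded q.+1 (N%:Z - 1) f'.
  move=> c g sc wc; rewrite /f' icoef_gact => /(sP _ _ sc wc) cs.
  by have := kP _ cs; have := NP _ cs; rewrite /= mulVKg.
have [|h hE] := bounded_exact qn bf'.
  by move=> c sc wc; rewrite zpow_equivariant cyc // gact0.
exists (fun c => gact z^-1%g (h c)) => c sc wc.
suff E : gact z (cobar_d X 0 c (fun c => gact z^-1%g (h c))) = gact z (f c).
  by rewrite -[LHS]gact1 -(mulVg z) gactM E -gactM mulVg gact1.
rewrite -zpow_equivariant -[RHS]hE //; apply: eq_cobar_d => e _ _.
by rewrite -gactM mulgV gact1.
Qed.

End Acyclicity.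

Theorem trivial_homology_cobar n i p (A : gmodule (braid_group n)) :
  (0 < p)%N -> n = (p + i)%N ->
  trivial_zmod (group_homology A i) <-> cobar_exact (gmod_ops A) n p.
Proof.
move=> p0 np; apply: trivial_homologyP => // B q j.
exact: induced_cobar_exact.
Qed.

(** * Tensor powers *)

Section ShiftedOps.
Variables (A : zmodType) (X : braid_ops A) (s : nat).

Lemma shift_far i j v : far i j -> X (s + i)%N (X (s + j)%N v) = X (s + j)%N (X (s + i)%N v).
Proof. by move=> ij; apply: op_far; move: ij; rewrite /far; lia. Qed.

Lemma shift_near i j v : near i j ->
  X (s + i)%N (X (s + j)%N (X (s + i)%N v)) = X (s + j)%N (X (s + i)%N (X (s + j)%N v)).
Proof. by move=> ij; apply: op_near; move: ij; rewrite /near; lia. Qed.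

Definition shift_ops : braid_ops A :=
  @BraidOps A (fun j => X (s + j)%N) (fun j => @op_is_zmod_morphism A X (s + j)%N)
    shift_far shift_near.

Lemma cobar_d_shift k c f : cobar_d shift_ops k c f = cobar_d X (s + k) c f.
Proof. exact: (@cobar_d_nat A A shift_ops X idfun). Qed.
End ShiftedOps.

(** * Operators on windows of tensor factors *)

Section TensorOps.
Context {F : fieldType} (V : braided_vspace F).
Local Notation T n := (tpow V n).
Local Notation idx n := {ffun 'I_n -> 'I_(\dim {: V})}.

Definition tens_ops n : braid_ops (T n) := gmod_ops (braid_module V n).

Lemma tens_opsE n j (jn : (j < n.-1)%N) (v : T n) :
  tens_ops n j v = - adjacent_op (braiding V) (Ordinal jn) v.
Proof.
rewrite /= /neg_gen jn -[j]/(val (Ordinal jn)) pos_elt1; congr (- _).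
by rewrite [LHS]braid_act_word /= comp_lfun1r.
Qed.

Lemma tens_ops_out n j (v : T n) : (n.-1 <= j)%N -> tens_ops n j v = 0.
Proof. by move=> nj; rewrite /= /neg_gen ltnNge nj. Qed.

Lemma tens_ops_linear n j : linear (tens_ops n j).
Proof.
move=> a u v; case: (ltnP j n.-1) => jn; last by rewrite !tens_ops_out // scaler0 addr0.
by rewrite !(tens_opsE jn) linearP opprD scalerN.
Qed.

Lemma cobar_d_scale n k c a (f : seq nat -> T n) :
  cobar_d (tens_ops n) k c (fun e => a *: f e) = a *: cobar_d (tens_ops n) k c f.
Proof.
symmetry; apply: (@cobar_d_nat (T n) (T n) (tens_ops n) (tens_ops n) (GRing.scale a) 0%N).
by move=> j v _ _; have := tens_ops_linear j a v 0; rewrite !addr0 raddf0 addr0.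
Qed.

(** The tensor in the factors [e] that is left when the indices of all other factors are frozen to
    those of [t]. Slices stand in for a splitting of the tensor power into the window and its
    complement. *)
Definition slice m n (e : 'I_m -> 'I_n) (t : idx n) (f : T n) : T m :=
  [ffun p => f (put e t p)].

Lemma slice_is_zmod_morphism m n (e : 'I_m -> 'I_n) t : zmod_morphism (slice e t).
Proof. by move=> u v; apply/ffunP => p; rewrite !ffunE. Qed.

HB.instance Definition _ m n (e : 'I_m -> 'I_n) t :=
  GRing.isZmodMorphism.Build (T n) (T m) (slice e t) (slice_is_zmod_morphism e t).

Lemma slice_inj m n (e : 'I_m -> 'I_n) (u v : T n) :
  (forall t, slice e t u = slice e t v) -> u = v.
Proof.
move=> uv; apply/ffunP => t; have /ffunP/(_ [ffun l => t (e l)]) := uv t.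
rewrite !ffunE; suff -> : put e t [ffun l => t (e l)] = t by [].
by apply/ffunP => k; rewrite ffunE; case: pickP => // l /eqP <-; rewrite ffunE.
Qed.

Lemma slice_factor m n (e : 'I_m -> 'I_n) t (A : 'End(T m)) (f : T n) :
  injective e -> slice e t (factor_op e A f) = A (slice e t f).
Proof.
move=> ei; apply/ffunP => p; rewrite ffunE factor_opE; congr (A _ _).
  by apply/ffunP => p'; rewrite !ffunE put_put.
by apply/ffunP => l; rewrite ffunE put_in.
Qed.

Lemma slice_tens_ops k m n (h : (k + m <= n)%N) t j (v : T n) : (j.+1 < m)%N ->
  slice (window h) t (tens_ops n (k + j)%N v) = tens_ops m j (slice (window h) t v).
Proof.
move=> jm; have jm' : (j < m.-1)%N by lia.
have jn : (k + j < n.-1)%N by lia.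
rewrite (tens_opsE jm') (tens_opsE jn) raddfN; congr (- _).
have wi : injective (window h) by move=> x y /(congr1 val) /addnI /val_inj.
rewrite /adjacent_op -(slice_factor _ _ _ wi) factor_op_trans //; last first.
  by move=> x y /(congr1 val) /addnI /val_inj.
congr (slice _ _ (factor_op _ _ _)); apply/funext => l; apply: val_inj => /=.
by rewrite addnA.
Qed.

Lemma slice_cobar_d k m n (h : (k + m <= n)%N) t c (f : seq nat -> T n) : (wt c <= m)%N ->
  slice (window h) t (cobar_d (tens_ops n) k c f) =
  cobar_d (tens_ops m) 0 c (fun e => slice (window h) t (f e)).
Proof.
move=> cm; rewrite -[k in cobar_d _ k](addn0 k) -cobar_d_shift.
apply: (@cobar_d_nat _ _ _ _ (slice (window h) t) 0%N) => j v _ jc.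
by apply: slice_tens_ops; lia.
Qed.

Lemma window_exact k m n p (h : (k + m <= n)%N) (f : seq nat -> T n) :
  cobar_exact (tens_ops m) m p ->
  (forall c, size c = p.+1 -> wt c = m -> cobar_d (tens_ops n) k c f = 0) ->
  exists g, forall c, size c = p -> wt c = m -> cobar_d (tens_ops n) k c g = f c.
Proof.
move=> ex fc; pose e := window h.
pose sf t c := slice e t (f c).
(* Primitives are chosen per chain [s] and not per index [t]: indices that agree outside the window
   have the same [sf t], hence the same primitive, so the values assemble to tensors. A chain that
   is not a cycle gets itself as a default. *)
have /choice [g gE] : forall s : seq nat -> T m, exists g, 
    (forall c, size c = p.+1 -> wt c = m -> cobar_d (tens_ops m) 0 c s = 0) ->
    forall c, size c = p -> wt c = m -> cobar_d (tens_ops m) 0 c g = s c.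
  move=> s; case: (pselect (forall c, size c = p.+1 -> wt c = m -> cobar_d (tens_ops m) 0 c s = 0)).
    by move=> /ex[g gE]; exists g.
  by move=> ns; exists s.
have sf_put t q : sf (put e t q) = sf t.
  by apply/funext => c; apply/ffunP => r; rewrite !ffunE put_put.
exists (fun c => [ffun t => g (sf t) c [ffun l => t (e l)]]) => c sc wc.
apply: (@slice_inj _ _ e) => t; rewrite slice_cobar_d ?wc //.
transitivity (cobar_d (tens_ops m) 0 c (g (sf t))).
  apply: eq_cobar_d => c' _ _; apply/ffunP => q; rewrite !ffunE sf_put.
  congr (g _ _ _); apply/ffunP => l; rewrite ffunE put_in //.
  by move=> x y /(congr1 val) /addnI /val_inj.
rewrite gE // => d sd wd.
by rewrite -(slice_cobar_d h t f) ?wd // fc // raddf0.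
Qed.

(** Total in [m] and [n], with value 0 for [m > n], because in [gam] the number of factors acted on
    depends on the composition. *)
Definition lift_op n m (A : 'End(T m)) : 'End(T n) :=
  match @idP (0 + m <= n)%N with
  | ReflectT h => factor_op (window h) A
  | ReflectF _ => 0
  end.

Lemma lift_opE n m (h : (0 + m <= n)%N) A : lift_op n A = factor_op (window h) A.
Proof.
rewrite /lift_op; case: {-}_ / idP => // h'; congr (factor_op (window _) A).
exact: bool_irrelevance.
Qed.

Lemma lift_op0 n m : lift_op n (0 : 'End(T m)) = 0.
Proof.
rewrite /lift_op; case: {-}_ / idP => // h; apply/lfunP => v; apply/ffunP => t.
by rewrite factor_opE !lfunE !ffunE.
Qed.

Lemma window0_inj n m (h : (0 + m <= n)%N) : injective (window h).
Proof. by move=> x y /(congr1 val) /addnI /val_inj. Qed.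

Lemma lift_op_slice l m n (h : (0 + m <= n)%N) t (A : 'End(T l)) (v : T n) : (l <= m)%N ->
  slice (window h) t (lift_op n A v) = lift_op m A (slice (window h) t v).
Proof.
move=> lm; have lm' : (0 + l <= m)%N by [].
have ln : (0 + l <= n)%N by lia.
rewrite (lift_opE lm') (lift_opE ln) -(slice_factor _ _ _ (window0_inj (h:=h))).
rewrite factor_op_trans; [|exact: window0_inj|exact: window0_inj].
by congr (slice _ _ (factor_op _ _ _)); apply/funext => x; apply: val_inj.
Qed.

Lemma lift_op_id m (A : 'End(T m)) : lift_op m A = A.
Proof.
have h : (0 + m <= m)%N by [].
rewrite (lift_opE h); apply/lfunP => f; apply/ffunP => t.
have wE (x : 'I_m) : window h x = x by apply: val_inj.
rewrite factor_opE; congr (A _ _); apply/ffunP => p; rewrite ffunE ?wE //.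
congr (f _); apply/ffunP => k; rewrite ffunE; case: pickP => [l|/(_ k)].
  by rewrite wE => /eqP ->.
by rewrite wE eqxx.
Qed.

Lemma lift_op_far l n j (A : 'End(T l)) (v : T n) : (l <= n)%N -> (l <= j)%N ->
  lift_op n A (tens_ops n j v) = tens_ops n j (lift_op n A v).
Proof.
move=> ln lj; case: (ltnP j n.-1) => jn; last by rewrite !tens_ops_out // raddf0.
have h : (0 + l <= n)%N by [].
rewrite !(tens_opsE jn) raddfN /= (lift_opE h) /adjacent_op -!comp_lfunE; congr (- _).
rewrite factor_op_disjoint // => x y; apply/eqP => /(congr1 val) /= E.
by have := ltn_ord y; rewrite -[nat_of_ord y]add0n -E; lia.
Qed.

Lemma lift_op_cobar_d l n k c (A : 'End(T l)) (f : seq nat -> T n) :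
  (l <= n)%N -> (l <= k)%N ->
  cobar_d (tens_ops n) k c (fun e => lift_op n A (f e)) = lift_op n A (cobar_d (tens_ops n) k c f).
Proof.
move=> ln lk; symmetry; apply: (@cobar_d_nat _ _ _ _ (lift_op n A) 0%N) => j v kj _.
by apply: lift_op_far => //; lia.
Qed.

End TensorOps.

(** * Contraction of the first parts *)

Section Gamma.
Context {F : fieldType} (V : braided_vspace F).
Local Notation T n := (tpow V n).
Local Notation Dn n := (cobar_d (tens_ops V n)).
Variable q' : nat.
Local Notation q := q'.+1.

(** [Gam m e c1] is the matrix entry of a homotopy on [m] strands, from the cell [c1] with [q] parts
    to the cell [e] with [q'] parts. *)
Definition homotopy_family := forall m, seq nat -> seq nat -> 'End(T m).
Implicit Types Gam : homotopy_family.

Definition gam Gam n (phi : seq nat -> T n) e : T n :=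
  \sum_(c1 <- cells (wt e) q) lift_op n (Gam (wt e) e c1) (phi c1).

(** The identity [1 = d h + h d] in cobar degree [q] on [m] strands, where [h] in degree [q.+1] is
    [gam] on the parts before the last. The second term thus involves [Gam] on fewer than [m]
    strands only. *)
Definition gam_spec Gam n m := forall (phi : seq nat -> T n) c b,
  size c = q' -> (wt c + b.+1)%N = m ->
  phi (rcons c b) = Dn n 0 (rcons c b) (gam Gam phi) +
    gam Gam (fun c1 => Dn n 0 (rcons c1 b) phi) c.

Definition gam_tail Gam n (f : seq nat -> T n) c :=
  gam Gam (fun c1 => f (c1 ++ drop q' c)) (take q' c).

Lemma gam_bounded Gam N n phi e : (forall m c c1, (N < m)%N -> Gam m c c1 = 0) ->
  (N < wt e)%N -> gam Gam phi e = 0 :> T n.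
Proof.
by move=> G0 Ne; rewrite /gam big1 // => c1 _; rewrite G0 // lift_op0 lfunE.
Qed.

(** Split the differential at the part [b] that follows the first [q'] parts. To the right of the
    cut it commutes with [Gam], and the cycle condition on [f] exchanges it for the differential to
    the left, where [gam_spec] applies. If the first [q] parts exceed [N], every term is zero. *)
Lemma gam_tail_primitive Gam N n p (f : seq nat -> T n) :
  (forall m c c1, (N < m)%N -> Gam m c c1 = 0) ->
  (forall m, (m <= N)%N -> gam_spec Gam n m) ->
  (forall c, size c = (q + p).+1 -> wt c = n -> Dn n 0 c f = 0) ->
  (forall c1 c2, size c1 = q -> size c2 = p -> wt (c1 ++ c2) = n -> (N < wt c1)%N ->
     f (c1 ++ c2) = 0) ->
  forall c, size c = (q + p)%N -> wt c = n -> Dn n 0 c (gam_tail Gam f) = f c.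
Proof.
move=> G0 Gspec cyc f0 c sc wc; pose c' := take q' c.
have sc' : size c' = q' by rewrite size_take sc; case: ifP => //; lia.
have [b [c2 cE]] : exists b c2, c = c' ++ b :: c2.
  have : size (drop q' c) = p.+1 by rewrite size_drop sc; lia.
  case dE: (drop q' c) => [|b c2] // _.
  by exists b, c2; rewrite -dE cat_take_drop.
have sc2 : size c2 = p by move: sc; rewrite cE size_cat sc' /=; lia.
have wc2 : (wt c' + b.+1 + wt c2)%N = n by rewrite -wc cE wt_cat wt_cons; lia.
rewrite cE cobar_d_split; set phi := fun e => f (e ++ c2).
rewrite (@eq_cobar_d _ _ 0 (rcons c' b) _ (gam Gam phi)); last first.
  move=> e se _; have {}se : size e = q' by move: se; rewrite size_rcons sc' => -[].
  by rewrite /gam_tail (take_size_cat _ se) (drop_size_cat _ se).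
have -> : Dn n (0 + wt c') (b :: c2) (fun e => gam_tail Gam f (c' ++ e)) *~ (-1) ^+ size c' =
    gam Gam (fun c1 => Dn n 0 (rcons c1 b) phi) c'.
  rewrite (@eq_cobar_d _ _ _ _ _ (fun e => \sum_(c1 <- cells (wt c') q)
      lift_op n (Gam (wt c') c' c1) (f (c1 ++ e)))); last first.
    by move=> e _ _; rewrite /gam_tail (take_size_cat _ sc') (drop_size_cat _ sc').
  rewrite cobar_d_sum /gam mulrz_suml; apply: eq_big_seq => c1.
  rewrite mem_cells => /andP[/eqP sc1 /eqP wc1].
  rewrite lift_op_cobar_d; [|lia|lia]; rewrite -raddfMz /=; congr (lift_op _ _ _).
  have : Dn n 0 (c1 ++ b :: c2) f = 0.
    apply: cyc; first by rewrite size_cat /= sc1 sc2 addnS.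
    by rewrite wt_cat wt_cons wc1 -wc2 addnA.
  rewrite cobar_d_split sc1 sc' wc1 exprS mulN1r mulrNz => /eqP.
  by rewrite subr_eq0 => /eqP ->.
have fE : f (c' ++ b :: c2) = phi (rcons c' b) by rewrite /phi cat_rcons.
rewrite fE; case: (leqP (wt c' + b.+1) N) => le_N; first by rewrite -(Gspec _ le_N).
have phi0 e : size e = q -> wt e = (wt c' + b.+1)%N -> phi e = 0.
  by move=> se we; apply: f0 => //; rewrite ?wt_cat ?we; lia.
rewrite [RHS]phi0 ?size_rcons ?wt_rcons ?sc' // cobar_d0 ?add0r; last first.
  by move=> e _ we; apply: gam_bounded G0 _; rewrite we wt_rcons.
rewrite /gam big1_seq // => c1 /andP[_]; rewrite mem_cells => /andP[/eqP sc1 /eqP wc1].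
rewrite cobar_d0 ?raddf0 // => e se we; apply: phi0.
  by move: se; rewrite size_rcons sc1 => -[].
by rewrite we wt_rcons wc1.
Qed.

Lemma gam_spec_slice Gam n m : (m <= n)%N -> gam_spec Gam m m -> gam_spec Gam n m.
Proof.
move=> mn spec phi c b sc wc; have h : (0 + m <= n)%N by [].
apply: (@slice_inj _ _ _ _ (window h)) => t.
have sg psi e : (wt e <= m)%N ->
    slice (window h) t (gam Gam psi e) = gam Gam (fun c => slice (window h) t (psi c)) e.
  by move=> we; rewrite raddf_sum; apply: eq_bigr => c1 _; apply: lift_op_slice.
rewrite raddfD /= slice_cobar_d ?wt_rcons ?wc // sg; last by lia.
rewrite [LHS](spec (fun c => slice (window h) t (phi c)) c b sc wc); congr (_ + _).
  by apply: eq_cobar_d => e _ we; rewrite sg // we wt_rcons wc.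
apply: eq_big_seq => c1; rewrite mem_cells => /andP[/eqP sc1 /eqP wc1].
by congr (lift_op _ _ _); rewrite slice_cobar_d // wt_rcons wc1 wc.
Qed.

Definition basis_chain n c0 t (c : seq nat) : T n :=
  if c == c0 then tens (btup t) else 0.

Definition basis_index n m p : seq (seq nat * {ffun 'I_n -> 'I_(\dim {: V})}) :=
  [seq (c0, t) | c0 <- cells m p, t <- index_enum _].

Lemma basis_chain_expand n m p (phi : seq nat -> T n) c : size c = p -> wt c = m ->
  phi c = \sum_(x <- basis_index n m p) phi x.1 x.2 *: basis_chain x.1 x.2 c.
Proof.
move=> sc wc; rewrite big_allpairs /=.
rewrite (bigD1_seq c) ?cells_uniq ?mem_cells ?sc ?wc ?eqxx //=.
rewrite [X in _ + X]big1 ?addr0 => [|c0 cc0].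
  rewrite {1}(tpow_expand (phi c)); apply: eq_bigr => t _.
  by rewrite /basis_chain eqxx.
rewrite big1 // => t _; rewrite /basis_chain eq_sym (negPf cc0).
exact: scaler0.
Qed.

Lemma cobar_d_comb n k c (I : Type) (r : seq I) (a : I -> F) (psi : I -> seq nat -> T n) :
  Dn n k c (fun e => \sum_(x <- r) a x *: psi x e) =
  \sum_(x <- r) a x *: Dn n k c (psi x).
Proof. by rewrite cobar_d_sum; apply: eq_bigr => x _; rewrite cobar_d_scale. Qed.

Lemma gam_comb Gam n e (I : Type) (r : seq I) (a : I -> F) (psi : I -> seq nat -> T n) :
  gam Gam (fun c => \sum_(x <- r) a x *: psi x c) e =
  \sum_(x <- r) a x *: gam Gam (psi x) e.
Proof.
rewrite /gam (eq_bigr (fun x => \sum_(c1 <- cells (wt e) q)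
    a x *: lift_op n (Gam (wt e) e c1) (psi x c1))) => [|x _]; last first.
  by rewrite scaler_sumr.
rewrite exchange_big; apply: eq_bigr => c1 _; rewrite linear_sum.
by apply: eq_bigr => x _; rewrite linearZ.
Qed.

Lemma lfun_on_basis n (w : {ffun 'I_n -> 'I_(\dim {: V})} -> T n) :
  exists A : 'End(T n), forall v, A v = \sum_t v t *: w t.
Proof.
pose g0 (v : T n) : T n := \sum_t v t *: w t.
have g0L : linear g0.
  move=> a x y; rewrite /g0 scaler_sumr -big_split /=; apply: eq_bigr => t _.
  by rewrite !ffunE scalerDl scalerA.
pose gl : {linear T n -> T n} := HB.pack g0 (GRing.isLinear.Build F _ _ *:%R _ g0L).
by exists (linfun gl) => v; rewrite lfunE.
Qed.

Definition update_family Gam m0 (H : seq nat -> seq nat -> 'End(T m0)) : homotopy_family :=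
  fun m => if @eqP _ m0 m is ReflectT e
    then eq_rect m0 (fun m => seq nat -> seq nat -> 'End(T m)) H m e else Gam m.

Lemma update_familyE Gam m0 H : update_family Gam H m0 = H.
Proof. by rewrite /update_family; case: eqP => // e; rewrite eq_axiomK. Qed.

Lemma update_family_neq Gam m0 (H : seq nat -> seq nat -> 'End(T m0)) m :
  m0 <> m -> update_family Gam H m = Gam m.
Proof. by rewrite /update_family; case: eqP. Qed.

Lemma eq_gam Gam Gam' n (phi psi : seq nat -> T n) e :
  Gam (wt e) = Gam' (wt e) ->
  (forall c, size c = q -> wt c = wt e -> phi c = psi c) ->
  gam Gam phi e = gam Gam' psi e.
Proof.
move=> GG pp; rewrite /gam GG; apply: eq_big_seq => c.
by rewrite mem_cells => /andP[/eqP sc /eqP wc]; rewrite pp.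
Qed.

(** Let the homotopy [h] be known on at most [N] strands. For a basis chain [x] on [N.+1] strands,
    [x - h d x] is a cycle, by [gam_tail_primitive] for the cycle [d x]; exactness provides [h x],
    and linear extension from the basis makes [h] an operator. *)
Lemma gam_exists N : (forall m, (m <= N)%N -> cobar_exact (tens_ops V m) m q) ->
  exists Gam, (forall m c c1, (N < m)%N -> Gam m c c1 = 0) /\
    forall m n, (m <= N)%N -> (m <= n)%N -> gam_spec Gam n m.
Proof.
elim: N => [|N IH] ex.
  by exists (fun _ _ _ => 0); split=> // m n m0 _ phi c b _ wc; exfalso; lia.
have [m mN|Gam [G0 Gspec]] := IH; first by apply: ex; lia.
pose M := N.+1.
have /choice [g gE] : forall x : seq nat * {ffun 'I_M -> 'I_(\dim {: V})},
    exists g : seq nat -> T M, forall c, size c = q -> wt c = M ->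
    Dn M 0 c g = basis_chain x.1 x.2 c -
      gam_tail Gam (fun c => Dn M 0 c (basis_chain x.1 x.2)) c.
  move=> x; apply: (ex M (leqnn _) (fun c => _ - _)) => c sc wc.
  rewrite cobar_dB (gam_tail_primitive (p := 1) G0) ?subrr //.
  - by move=> m mN; apply: Gspec => //; rewrite /M; lia.
  - by move=> c' _ _; apply: cobar_dK.
  - by move=> c1 c2 sc1 sc2; rewrite wt_cat /wt /M sc2; lia.
  - by rewrite sc addn1.
have /choice [H HE] : forall cc : seq nat * seq nat, exists A : 'End(T M),
    forall v, A v = \sum_t v t *: g (cc.2, t) cc.1.
  by move=> cc; apply: lfun_on_basis.
pose Gam' := update_family Gam (fun c c1 => H (c, c1)).
have GM : Gam' M = fun c c1 => H (c, c1) by apply: update_familyE.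
have Gneq m : m <> M -> Gam' m = Gam m.
  by move=> mM; apply: update_family_neq => /esym.
exists Gam'; split=> [m c c1 Mm|m n mM mn].
  by rewrite Gneq ?G0 //; rewrite /M; lia.
case: (eqVneq m M) => [mE|/eqP neM]; last first.
  move=> phi c b sc wc.
  have -> := Gspec m n (ltac:(move: neM; rewrite /M; lia)) mn phi c b sc wc.
  congr (_ + _); last by apply: eq_gam => //; rewrite Gneq //; rewrite /M; lia.
  apply: eq_cobar_d => e _ we; apply: eq_gam => //; rewrite Gneq // we wt_rcons wc //.
apply: gam_spec_slice mn _; rewrite {}mE => {m n mM} phi c b sc wc.
pose f x := fun c => Dn M 0 c (basis_chain x.1 x.2 : seq nat -> T M).
have E1 e : size e = q' -> wt e = M ->
    gam Gam' phi e = \sum_(x <- basis_index M M q) phi x.1 x.2 *: g x e.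
  move=> se we; rewrite big_allpairs /gam we GM; apply: eq_bigr => c1 _.
  by rewrite lift_op_id HE.
have E2 e : size e = q -> wt e = M -> phi e =
    \sum_(x <- basis_index M M q) phi x.1 x.2 *: basis_chain x.1 x.2 e.
  exact: basis_chain_expand.
rewrite (@eq_cobar_d _ _ 0 (rcons c b) _
  (fun e => \sum_(x <- basis_index M M q) phi x.1 x.2 *: g x e)); last first.
  move=> e se we; apply: E1; last by rewrite we wt_rcons.
  by move: se; rewrite size_rcons sc => -[].
rewrite cobar_d_comb.
have wrc : wt (rcons c b) = M by rewrite wt_rcons.
have src : size (rcons c b) = q by rewrite size_rcons sc.
rewrite (@eq_gam Gam' Gam _ _ (fun c1 => \sum_(x <- basis_index M M q)
    phi x.1 x.2 *: f x (rcons c1 b))); first last.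
- move=> c1 sc1 wc1; rewrite -cobar_d_comb; apply: eq_cobar_d => e se we; apply: E2.
    by move: se; rewrite size_rcons sc1 => -[].
  by rewrite we wt_rcons wc1.
- by apply: Gneq; lia.
rewrite gam_comb -big_split [LHS]E2 //; apply: eq_bigr => x _ /=.
rewrite gE // -scalerDr; congr (_ *: _); rewrite -[LHS](subrK (gam_tail Gam (f x) (rcons c b))).
congr (_ + _); rewrite /gam_tail -cats1 (take_size_cat _ sc) (drop_size_cat _ sc).
by apply: eq_gam => // c1 _ _; rewrite cats1.
Qed.

(** When the first [q] parts have more than [N] strands, at most [N'] remain, so exactness in degree
    [p] applies to the other parts. The components go in decreasing weight of the first parts: a
    correction at one weight affects only that weight and smaller ones. *)
Lemma kill_large_first_parts N N' p n (f : seq nat -> T n) : (0 < p)%N ->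
  (forall m, (m <= N')%N -> cobar_exact (tens_ops V m) m p) ->
  (n <= N + N'.+1)%N ->
  (forall c, size c = (q + p).+1 -> wt c = n -> Dn n 0 c f = 0) ->
  exists h, forall c1 c2, size c1 = q -> size c2 = p -> wt (c1 ++ c2) = n ->
    (N < wt c1)%N -> f (c1 ++ c2) - Dn n 0 (c1 ++ c2) h = 0.
Proof.
move=> p0 ex le_n cyc.
suff /(_ n) [h hE] : forall k, exists h, forall c1 c2, size c1 = q -> size c2 = p ->
    wt (c1 ++ c2) = n -> (N < wt c1)%N -> (n < wt c1 + k)%N ->
    f (c1 ++ c2) - Dn n 0 (c1 ++ c2) h = 0.
  by exists h => c1 c2 s1 s2 w12 Nw; apply: hE => //; lia.
elim=> [|k [h hE]].
  by exists (fun=> 0) => c1 c2 _ _; rewrite wt_cat => w12 _ ?; exfalso; lia.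
pose f' c := f c - Dn n 0 c h.
have cyc' c : size c = (q + p).+1 -> wt c = n -> Dn n 0 c f' = 0.
  by move=> sc wc; rewrite cobar_dB cyc // cobar_dK subr0.
pose new c1 := [&& size c1 == q, (wt c1 + k == n)%N & (N < wt c1)%N].
have /choice [y yE] : forall c1, exists y, new c1 -> forall c2, size c2 = p -> wt c2 = k ->
    Dn n (wt c1) c2 y = f' (c1 ++ c2).
  move=> c1; case: (boolP (new c1)) => [|_]; last by exists (fun=> 0).
  move=> /and3P[/eqP s1 /eqP w1 N1].
  have hw : (wt c1 + k <= n)%N by rewrite w1.
  have [||y yE] := @window_exact F V (wt c1) k n p hw (fun e => f' (c1 ++ e)).
  - by apply: ex; lia.
  - move=> [|b c2] // sc wc; have := cyc' (c1 ++ b :: c2).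
    rewrite cobar_d_split cobar_d0 => [|e se we]; last first.
      apply: hE; rewrite ?we ?wt_rcons //; first by move: se; rewrite size_rcons s1 => -[].
      + by move: sc => [].
      + by rewrite wt_cat we wt_rcons -w1 -wc wt_cons; lia.
      + by lia.
      + by lia.
    rewrite add0r => H; rewrite -[LHS](mulrz_signK _ (size c1)) H ?mul0rz //.
      by rewrite size_cat s1 sc; lia.
    by rewrite wt_cat wc.
  - by exists y.
pose h2 c := if new (take q c) then y (take q c) (drop q c) *~ (-1) ^+ q else 0.
exists (fun c => h c + h2 c) => c1 [|b c3] s1 s2 w12 N1 n1; first by move: p0; rewrite -s2.
have h2E e c : size e = q -> h2 (e ++ c) = if new e then y e c *~ (-1) ^+ q else 0.
  by move=> se; rewrite /h2 (take_size_cat _ se) (drop_size_cat _ se).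
rewrite cobar_dD opprD addrA -/(f' _) cobar_d_split (@cobar_d0 _ _ 0 (rcons c1 b)); last first.
  move=> e se we; have se' : size e = q by move: se; rewrite size_rcons s1 => -[].
  rewrite h2E // /new we wt_rcons; case: ifP => // /and3P[_ /eqP]; lia.
rewrite add0r add0n s1 (@eq_cobar_d _ _ _ _ _ (fun e => if new c1 then y c1 e *~ (-1) ^+ q else 0)).
  case: (boolP (new c1)) => nc; last first.
    rewrite cobar_d0 // mul0rz subr0; apply: hE => //.
    by move: nc; rewrite /new s1 eqxx N1 andbT /=; lia.
  rewrite cobar_d_mulrz mulrz_signK yE ?subrr //.
  by move: nc w12 => /and3P[_ /eqP <- _]; rewrite wt_cat; lia.
by move=> e _ _; rewrite h2E.
Qed.

Lemma cobar_exact_superadditive N N' p n : (0 < p)%N ->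
  (forall m, (m <= N)%N -> cobar_exact (tens_ops V m) m q) ->
  (forall m, (m <= N')%N -> cobar_exact (tens_ops V m) m p) ->
  (n <= N + N'.+1)%N -> cobar_exact (tens_ops V n) n (q + p).
Proof.
move=> p0 exq exp le_n f cyc.
have [h hE] := kill_large_first_parts p0 exp le_n cyc.
(* The homotopy has to act inside [T n], so it is built on at most [n] strands; the first parts
   never have more. *)
have [m mN|Gam [G0 Gspec]] := @gam_exists (minn N n).
  by apply: exq; apply: leq_trans mN (geq_minl _ _).
pose f' c := f c - Dn n 0 c h.
have f'E : forall c, size c = (q + p)%N -> wt c = n -> Dn n 0 c (gam_tail Gam f') = f' c.
  apply: (gam_tail_primitive G0).
  - by move=> m mN; apply: Gspec => //; apply: leq_trans mN (geq_minr _ _).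
  - by move=> e se we; rewrite cobar_dB cyc // cobar_dK subr0.
  move=> c1 c2 s1 s2 w12 lt1; apply: hE => //.
  by move: lt1 w12; rewrite wt_cat; lia.
exists (fun c => gam_tail Gam f' c + h c) => c sc wc.
by rewrite cobar_dD (f'E c sc wc) subrK.
Qed.

End Gamma.

(** * Vanishing *)

Lemma trivial_homology_coef (G : groupType) (A : gmodule G) i :
  trivial_zmod A -> trivial_zmod (group_homology A i).
Proof.
move=> A0; apply/trivial_homologyE => c _; exists 0; rewrite bdiff0.
by apply/malgP => t; rewrite [LHS]A0 [RHS]A0.
Qed.

Lemma cobar_exact_small (A : zmodType) (X : braid_ops A) n p :
  (n < p)%N -> cobar_exact X n p.
Proof. by move=> np f _; exists f => c sc; rewrite /wt sc; lia. Qed.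

Section Vanishing.
Context {F : fieldType} (V : braided_vspace F).

(** No generator acts on one strand, so homology in degree 0 is [V] itself; a basis index of a
    tensor power would yield a nonzero element of it. *)
Lemma tpow_trivial n : (0 < n)%N -> trivial_zmod (braid_homology V 1 0) ->
  trivial_zmod (tpow V n).
Proof.
move=> n0 /trivial_homology0P H; case: n n0 => // n _ x; apply/ffunP => t.
exfalso; pose u := [ffun _ : 'I_1 => t ord0].
have [v] := H (tens (btup u)); rewrite big_ord0 => /ffunP/(_ u).
by rewrite tens_btup eqxx ffunE => /eqP; rewrite oner_eq0.
Qed.

Variables (N I : nat).
Hypotheses (IN : (I < N)%N) (staircase : vanishes_in_staircase V N I).
Local Notation q := (N - I)%N.
Local Notation exact_at n p := (cobar_exact (tens_ops V n) n p).

(** For [p = q] the homological degree [m - q] is exactly the limit [I + m - N] of the staircase. *)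
Lemma staircase_exact m : (m <= N)%N -> exact_at m q.
Proof.
move=> mN; case: (ltnP m q) => [|qm]; first exact: cobar_exact_small.
have [||H _] := @trivial_homology_cobar m (m - q) q (braid_module V m); try lia.
by apply: H; apply: staircase; lia.
Qed.

Lemma exact_iter a s n : (0 < q * a + s)%N -> (n.+1 <= N.+1 * a + s)%N ->
  exact_at n (q * a + s).
Proof.
elim: a n => [|a IH] n p0 le_n.
  (* Fewer than [s] strands have no composition with [s] parts. *)
  by apply: cobar_exact_small; move: le_n; rewrite !muln0 !add0n.
case: (posnP (q * a + s)) => [z|p0'].
  (* Superadditivity needs two positive degrees; here the second one is 0, and the claim is the
     staircase itself. *)
  have [a0 s0] : a = 0%N /\ s = 0%N by move: z IN; nia.
  by rewrite a0 s0 muln1 addn0; apply: staircase_exact; move: le_n; rewrite a0 s0; lia.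
have -> : (q * a.+1 + s = q.-1.+1 + (q * a + s))%N by rewrite mulnS; lia.
apply: (cobar_exact_superadditive (N := N) (N' := (N.+1 * a + s).-1)) => //.
- by have -> : q.-1.+1 = q; [lia|exact: staircase_exact].
- move=> m le_m; apply: IH => //; apply: leq_ltn_trans le_m _; rewrite ltn_predL.
  by case: (a) p0' => [|b]; rewrite ?muln0 // mulnS.
by move: le_n; rewrite mulnS; lia.
Qed.

Lemma staircase_bound n i : (0 < n)%N ->
  i%:Z <= (I%:Z + 1) * ((n + 1) %/ (N + 1))%N%:Z
          + Num.max (I%:Z + ((n + 1) %% (N + 1))%N%:Z - N%:Z) 0 - 1 ->
  trivial_zmod (braid_homology V n i).
Proof.
move=> n0; rewrite !addn1; set a := (_ %/ _)%N; set r := (_ %% _)%N => le_i.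
have nE : (n.+1 = a * I + a * q + a + r)%N.
  rewrite [LHS](divn_eq _ N.+1) -/a -/r -[in X in (a * X.+1)%N](subnK (ltnW IN)).
  by rewrite -addn1 !mulnDr muln1; lia.
have rN : (r <= N)%N by rewrite -ltnS ltn_mod.
(* As [I + r - N = r - q], the maximum with 0 is truncated subtraction. *)
have {}le_i : (i.+1 <= a * I + a + (r - q))%N.
  move: le_i; have -> : (I%:Z + 1) * a%:Z = (a * I + a)%N%:Z.
    by rewrite PoszD PoszM mulrDl mul1r mulrC.
  by case: leP; lia.
have q0 : (0 < q)%N by lia.
have p0 : (0 < a * q + minn r q)%N.
  case: (a) nE => [|b _]; last by rewrite mulSn -addnA addn_gt0 q0.
  by rewrite !mul0n !add0n leq_min q0 andbT => <-.
have le_p : (a * q + minn r q <= n - i)%N by lia.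
have i_n : (i < n)%N by lia.
have [||_ H] := @trivial_homology_cobar n i (n - i) (braid_module V n); try lia.
apply: H.
(* Divide the cobar degree [n - i] by [q]. If the quotient exceeds [a], then
   [n + 1 <= (N + 1) (a + 1)] suffices. If it equals [a], the remainder [s < q] is at least
   [minn r q], hence at least [r]. *)
rewrite [(n - i)%N](divn_eq _ q) mulnC; set a' := (_ %/ _)%N; set s := (_ %% _)%N.
have pE : (n - i = a' * q + s)%N by apply: divn_eq.
have sq : (s < q)%N by rewrite ltn_mod.
have aa' : (a <= a')%N by rewrite leq_divRL //; lia.
apply: exact_iter; first by rewrite mulnC -pE; lia.
case: (ltngtP a a') aa' => // [lt_aa _|eq_aa _].
  apply: (@leq_trans (N.+1 * a.+1)); last first.
    by apply: (@leq_trans (N.+1 * a')); [rewrite leq_mul2l lt_aa orbT|apply: leq_addr].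
  rewrite [n.+1](divn_eq _ N.+1) -/a -/r [(N.+1 * _)%N]mulnC mulSn addnC leq_add2r.
  exact: leqW.
rewrite [n.+1](divn_eq _ N.+1) -/a -/r -eq_aa mulnC leq_add2l.
by move: le_p; rewrite pE -eq_aa leq_add2l; lia.
Qed.

End Vanishing.

Lemma vanishes_with_slope_of_bound (R : realType) (V : braided_vspace R[i]) (N I : nat) :
  (forall n i : nat, (1 <= n)%N ->
     i%:Z <= (I%:Z + 1) * ((n + 1) %/ (N + 1))%N%:Z
             + Num.max (I%:Z + ((n + 1) %% (N + 1))%N%:Z - N%:Z) 0 - 1 ->
     trivial_zmod (braid_homology V n i)) ->
  vanishes_with_slope V ((I%:R + 1) / (N%:R + 1)).
Proof.
(* Replacing the floor by [n / (N + 1) - 1] costs [I + 1], and the final [- 1] of the bound costs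
   one more. *)
move=> H; exists (- (I%:R + 2)) => n i n1 le_i; apply: H => //.
set a := (_ %/ _)%N; set r := (_ %% _)%N.
suff : (i.+1 <= I.+1 * a)%N.
  move=> le; have : i.+1%:Z <= (I%:Z + 1) * a%:Z by rewrite [I%:Z + 1]addrC -intS -PoszM lez_nat.
  have : 0 <= Num.max (I%:Z + r%:Z - N%:Z) 0 by rewrite le_max lexx orbT.
  by move: (Num.max _ _) => z; lia.
have N0 : 0 < N%:R + 1 :> R by rewrite ltr_wpDl.
have le_n : n%:R <= (a%:R + 1) * (N%:R + 1) :> R.
  have : (n <= (a + 1) * (N + 1))%N.
    have := divn_eq (n + 1) (N + 1); rewrite -/a -/r => E.
    have : (r < N + 1)%N by rewrite ltn_mod addn1.
    by rewrite mulnDl mul1n; lia.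
  by rewrite -(ler_nat R) natrM !natrD.
rewrite -(ler_nat R) natrM -!natr1.
have le2 : (I%:R + 1) / (N%:R + 1) * n%:R <= (I%:R + 1) * (a%:R + 1) :> R.
  rewrite mulrAC ler_pdivrMr // -mulrA ler_wpM2l // addr_ge0 //.
by lra.
Qed.

Theorem theorem1p2 (R : realType) (V : braided_vspace R[i]) (N I : nat)
    (N_ge2 : (2 <= N)%N) (staircase : vanishes_in_staircase V N I) :
  vanishes_with_slope V ((I%:R + 1) / (N%:R + 1)) /\
  (forall n i : nat, (1 <= n)%N ->
     i%:Z <= (I%:Z + 1) * ((n + 1) %/ (N + 1))%N%:Z
             + Num.max (I%:Z + ((n + 1) %% (N + 1))%N%:Z - N%:Z) 0 - 1 ->
     trivial_zmod (braid_homology V n i)).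
Proof.
suff H : forall n i : nat, (1 <= n)%N ->
     i%:Z <= (I%:Z + 1) * ((n + 1) %/ (N + 1))%N%:Z
             + Num.max (I%:Z + ((n + 1) %% (N + 1))%N%:Z - N%:Z) 0 - 1 ->
     trivial_zmod (braid_homology V n i).
  by split=> //; apply: vanishes_with_slope_of_bound H.
move=> n i n1; case: (ltnP I N) => [IN|NI]; first exact: staircase_bound.
(* For [I >= N] the staircase contains the pair [(1, 0)]. *)
move=> _; apply: trivial_homology_coef; apply: tpow_trivial => //.
by apply: staircase => //; lia.
Qed.
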